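(* Fix $1<p\le r<\infty$. Let $(A_n)_{n\in\mathbb N}$ be a sequence of symmetric random matrices satisfying assumptions (i)--(iii) of the context, with associated means $\mu_n$ and variances $\sigma_n^2$, and define $\bar A_n := n^{-(\frac1p-\frac1r)}A_n$. Then, as $n\to\infty$, $$\frac{1}{\sigma_n}\big(\|\bar A_n\|_{r\to p}-\alpha_n(p,r)\big)\xrightarrow{d} Z\sim \mathrm{Normal}(0,2),$$ where $$\alpha_n(p,r)=(n-1)\mu_n+\Big(p-1+\frac{1}{r-1}\Big)\frac{\sigma_n^2}{2\mu_n}.$$
   Context: For an $n\times n$ matrix $A$ and $r,p\ge 1$, $\|A\|_{r\to p}:=\sup_{x\in\mathbb R^n:\|x\|_r\le 1}\|Ax\|_p$, where $\|x\|_q=(\sum_i|x_i|^q)^{1/q}$. $\mathrm{Normal}(m,s^2)$ is the normal law with mean $m$ and variance $s^2$; $\xrightarrow{d}$ is convergence in distribution. $f(n)=\omega(g(n))$ means $f(n)/g(n)\to\infty$. Assumptions on the matrices. For each $n\ge1$, $F_n$ is a distribution supported on $[0,\infty)$ with finite mean $\mu_n$ and variance $\sigma_n^2$, and $A_n=(a^n_{ij})_{i,j=1}^n$ is a symmetric random matrix such that: (i) $(a^n_{ij})_{1\le i<j\le n}$ are i.i.d. with common distribution $F_n$, and $a^n_{ii}=0$ for all $i\in[n]=\{1,\dots,n\}$; (ii) $\mu_n=O(1)$, $\mu_n=\omega\big(\frac{\log^{2/3}n}{n^{1/3}}\big)$, $\sigma_n\ge n^{-\frac12+c_0}$ for some constant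 $c_0>0$, and $\frac{\sigma_n^2}{\mu_n}=O(1)$; (iii) there exists $c<\infty$ (independent of $n$) such that $\mathbb E\big[|a^n_{12}-\mu_n|^k\big]\le\frac{k!}{2}c^{k-2}\sigma_n^2$ for all $k\ge3$. *)

(* Defs.v *)
From mathcomp Require Import all_boot all_order all_algebra.
From mathcomp Require Import all_classical all_reals all_analysis.

Set Implicit Arguments.
Unset Strict Implicit.
Unset Printing Implicit Defensive.

Import Order.TTheory GRing.Theory Num.Theory.
Import numFieldNormedType.Exports.

Local Open Scope classical_set_scope.
Local Open Scope ring_scope.

Definition lpnorm (R : realType) (n : nat) (q : R) (x : 'cV[R]_n) : R :=
  (\sum_(i < n) `|x i ord0| `^ q) `^ q^-1.

Definition opnorm (R : realType) (n : nat) (r p : R) (A : 'M[R]_n) : R :=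
  sup [set lpnorm p (A *m x) | x in [set x : 'cV[R]_n | lpnorm r x <= 1]].

Definition law_mean (R : realType)
    (F : probability (measurableTypeR R) R) : R := fine 'E_F[id].

Definition law_sd (R : realType)
    (F : probability (measurableTypeR R) R) : R := Num.sqrt (fine 'V_F[id]).

Definition mutually_independent (d : measure_display) (T : measurableType d)
    (R : realType) (P : probability T R) (I : finType)
    (X : I -> {RV P >-> R}) : Prop :=
  forall (J : {set I}) (B : I -> set R),
    (forall i, measurable (B i)) ->
    P (\bigcap_(i in [set` J]) (X i @^-1` B i)) =
      (\prod_(i in J) P (X i @^-1` B i))%E.

(* Convergence at the continuity points of the limiting distribution function.
   Every variable may live on its own probability space; measurability is a
   conjunct since X n is given as a bare function. *)
Definition cvg_in_distribution (R : realType) (d : nat -> measure_display)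
    (T : forall n, measurableType (d n)) (P : forall n, probability (T n) R)
    (X : forall n, T n -> R) (Q : probability (measurableTypeR R) R) : Prop :=
  (forall n, measurable_fun [set: T n] (X n)) /\
  (forall x : R, {for x, continuous (fun y : R => Q [set` `]-oo, y]])} ->
     P n (X n @^-1` `]-oo, x]) @[n --> \oo] --> Q [set` `]-oo, x]]).

Definition random_mx (d : measure_display) (T : measurableType d)
    (R : realType) (P : probability T R) (n : nat)
    (a : 'I_n -> 'I_n -> {RV P >-> R}) (t : T) : 'M[R]_n :=
  \matrix_(i, j) a i j t.

Definition alpha (R : realType) (p r mu sigma : R) (n : nat) : R :=
  (n%:R - 1) * mu + (p - 1 + (r - 1)^-1) * (sigma ^+ 2 / (2 * mu)).

(* Main.v *)
From HB Require Import structures.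
Require Import Defs.
From mathcomp Require Import all_boot all_order all_algebra.
From mathcomp Require Import all_classical all_reals all_analysis.
From mathcomp Require Import measurable_realfun ring lra.

Set Implicit Arguments.
Unset Strict Implicit.
Unset Printing Implicit Defensive.

Import Order.TTheory GRing.Theory Num.Theory.
Import numFieldNormedType.Exports.

Local Open Scope classical_set_scope.
Local Open Scope ring_scope.

(** Divided by [n * mu], the matrix is the flat matrix with entries [1 / n] off the diagonal plus a
    noise [E] of independent centered entries. Let [eps] be the vector of the row sums of [E]. The flat
    matrix attains its norm at the constant vector, and for small noise the optimal vector is
    [1 + eps / (r - 1)] up to second order. Expanding the ratio of norms at this vector gives
    [1 - 1/n + mean eps + (p - 1 + 1/(r - 1)) / 2 * mean (eps ^+ 2)], up to the third power of the typical
    size [t] of a row sum. The mean of [eps] is the sum of all entries, which obeys the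
    central limit theorem with variance [2] after division by [sigma]; the mean of [eps ^+ 2]
    concentrates at [sigma ^+ 2 / (n * mu ^+ 2)] and produces the correction in [alpha].
    The remainder [n * mu * t ^+ 3] is negligible against [sigma] under the growth conditions.

    The vector gives a lower bound for the norm. For the matching upper bound ([noisy_upper]) Schur's
    test is used with the same vector, keeping the quadratic gain in Young's inequality.
    Almost flat weights make this gain coercive ([noisy_coercive]), and it pays for the
    residual of the vector, which is of second order ([test_vec_expansion]). The outcome is the
    deterministic expansion [noisy_opnorm]. It asks of the noise only that a few
    quadratic functionals have the size that independence suggests; [edge_mx_quadratics] shows
    that they do, by decomposing them into closed and open paths of length two,
    where distinct open paths are uncorrelated. Only fourth moments enter, so the event on which the
    expansion holds is controlled by a single use of Markov's inequality ([opnorm_near_sum]).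

    The central limit theorem ([lindeberg]) comes from replacing the entries by Gaussians one at a
    time inside smooth test functions, and sigmoids turn the convergence of smooth
    expectations, together with the closeness of the norm to the sum of the entries, into
    convergence of distribution functions ([cvg_normal_of_tests]). *)

(** * Expectations and independence *)

(** Real-valued integrals, used for probabilities and for Lebesgue measure alike. *)
Definition itg d (T : measurableType d) (R : realType) (P : {measure set T -> \bar R})
    (f : T -> R) : Prop := P.-integrable [set: T] (EFin \o f).

Definition ex d (T : measurableType d) (R : realType) (P : {measure set T -> \bar R})
    (f : T -> R) : R := \int[P]_t f t.

Lemma itg_measurable d (T : measurableType d) (R : realType)
    (P : {measure set T -> \bar R}) (f : T -> R) : itg P f -> measurable_fun setT f.
Proof. by move=> /measurable_int /measurable_EFinP. Qed.

Lemma itg_cst d (T : measurableType d) (R : realType)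
    (P : probability T R) (c : R) : itg P (fun=> c).
Proof. exact: finite_measure_integrable_cst. Qed.

Lemma itg_le d (T : measurableType d) (R : realType)
    (P : {measure set T -> \bar R}) (g f : T -> R) : measurable_fun setT f ->
  (forall t, `|f t| <= g t) -> itg P g -> itg P f.
Proof.
move=> mf fg ig; apply: le_integrable ig => //; first exact/measurable_EFinP.
by move=> t _ /=; rewrite lee_fin (le_trans (fg t)) ?ler_norm.
Qed.

Lemma itg_bounded d (T : measurableType d) (R : realType)
    (P : probability T R) (c : R) (f : T -> R) : measurable_fun setT f ->
  (forall t, `|f t| <= c) -> itg P f.
Proof. by move=> mf fc; apply: (@itg_le _ _ _ _ (fun=> c)) => //; exact: itg_cst. Qed.

Lemma itgD d (T : measurableType d) (R : realType)
    (P : {measure set T -> \bar R}) (f g : T -> R) :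
  itg P f -> itg P g -> itg P (fun t => f t + g t).
Proof. by move=> fi gi; exact: (integrableD measurableT fi gi). Qed.

Lemma itgZ d (T : measurableType d) (R : realType)
    (P : {measure set T -> \bar R}) (c : R) (f : T -> R) :
  itg P f -> itg P (fun t => c * f t).
Proof. by move=> fi; exact: (integrableZl measurableT c fi). Qed.

Lemma itgN d (T : measurableType d) (R : realType)
    (P : {measure set T -> \bar R}) (f : T -> R) : itg P f -> itg P (fun t => - f t).
Proof. by move=> fi; have := itgZ (-1) fi; congr (_.-integrable _ _); apply/funext => t /=; rewrite mulN1r. Qed.

Lemma itg_norm d (T : measurableType d) (R : realType)
    (P : {measure set T -> \bar R}) (f : T -> R) : itg P f -> itg P (fun t => `|f t|).
Proof. exact: integrable_norm. Qed.

Lemma itg_sum d (T : measurableType d) (R : realType) (P : {measure set T -> \bar R})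
    (I : Type) (s : seq I) (Q : pred I) (f : I -> T -> R) :
  (forall i, Q i -> itg P (f i)) -> itg P (fun t => \sum_(i <- s | Q i) f i t).
Proof.
move=> fi; have := integrable_sum measurableT s (h := fun i => EFin \o f i) fi.
by congr (_.-integrable _ _); apply/funext => t /=; rewrite sumEFin.
Qed.

Lemma eq_ex d (T : measurableType d) (R : realType) (P : {measure set T -> \bar R})
    (f g : T -> R) : f =1 g -> ex P f = ex P g.
Proof. by move=> fg; congr ex; exact/funext. Qed.

Lemma ex_cst d (T : measurableType d) (R : realType) (P : probability T R)
    (c : R) : ex P (fun=> c) = c.
Proof. rewrite /ex Rintegral_cst//; rewrite -[X in fine X]/(P setT) (@probability_setT _ _ _ P) mulr1 //. Qed.

Lemma exD d (T : measurableType d) (R : realType) (P : {measure set T -> \bar R})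
    (f g : T -> R) : itg P f -> itg P g ->
  ex P (fun t => f t + g t) = ex P f + ex P g.
Proof. by move=> fi gi; rewrite /ex RintegralD. Qed.

Lemma exZ d (T : measurableType d) (R : realType) (P : {measure set T -> \bar R})
    (c : R) (f : T -> R) : itg P f -> ex P (fun t => c * f t) = c * ex P f.
Proof. by move=> fi; rewrite /ex RintegralZl. Qed.

Lemma exB d (T : measurableType d) (R : realType) (P : {measure set T -> \bar R})
    (f g : T -> R) : itg P f -> itg P g ->
  ex P (fun t => f t - g t) = ex P f - ex P g.
Proof. by move=> fi gi; rewrite /ex RintegralB. Qed.

Lemma le_ex d (T : measurableType d) (R : realType) (P : {measure set T -> \bar R})
    (f g : T -> R) : itg P f -> itg P g -> (forall t, f t <= g t) ->
  ex P f <= ex P g.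
Proof. by move=> fi gi fg; apply: le_Rintegral. Qed.

Lemma ex_ge0 d (T : measurableType d) (R : realType) (P : {measure set T -> \bar R})
    (f : T -> R) : (forall t, 0 <= f t) -> 0 <= ex P f.
Proof. by move=> f0; apply: Rintegral_ge0. Qed.

Lemma norm_ex_le d (T : measurableType d) (R : realType) (P : {measure set T -> \bar R})
    (f : T -> R) : itg P f -> `|ex P f| <= ex P (fun t => `|f t|).
Proof. by move=> fi; apply: le_normr_Rintegral. Qed.

Lemma ex_sum d (T : measurableType d) (R : realType) (P : {measure set T -> \bar R})
    (I : Type) (s : seq I) (Q : pred I) (f : I -> T -> R) :
  (forall i, Q i -> itg P (f i)) ->
  ex P (fun t => \sum_(i <- s | Q i) f i t) = \sum_(i <- s | Q i) ex P (f i).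
Proof.
move=> fi; elim: s => [|i s IH].
  rewrite big_nil -[RHS](@Rintegral_set0 _ _ _ P (fun=> 0)) /ex.
  rewrite (@eq_Rintegral _ _ _ _ _ (fun=> 0)); last by move=> t _; rewrite big_nil.
  by rewrite Rintegral_cst// mul0r Rintegral_set0.
rewrite big_cons; case: ifPn => Qi.
  rewrite -IH -exD; [|exact: fi|exact: itg_sum].
  by apply: eq_ex => t; rewrite big_cons Qi.
by rewrite -IH; apply: eq_ex => t; rewrite big_cons (negbTE Qi).
Qed.

Lemma exE d (T : measurableType d) (R : realType) (P : {measure set T -> \bar R})
    (f : T -> R) : itg P f -> (ex P f)%:E = (\int[P]_t (f t)%:E)%E.
Proof. by move=> fi; rewrite fineK//; exact: integrable_fin_num. Qed.

(** The event need not be a level set of [f]; this lets one function [f] with a small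
    expectation control several bad events at once. *)
Lemma markov_ex d (T : measurableType d) (R : realType) (P : probability T R)
    (f : T -> R) (c : R) (A : set T) : itg P f -> (forall t, 0 <= f t) ->
  0 < c -> measurable A -> (forall t, A t -> c <= f t) ->
  (P A <= (ex P f / c)%:E)%E.
Proof.
move=> fi f0 c0 mA Ac.
have ii : itg P (\1_A : T -> R).
  apply: (@itg_bounded _ _ _ _ 1) => [|t]; first exact: measurable_indic.
  by rewrite indicE normr_nat; case: (_ \in _) => //=; rewrite ler01.
have -> : P A = (ex P (\1_A : T -> R))%:E.
  by rewrite exE//= integral_indic// setIT.
rewrite lee_fin ler_pdivlMr// mulrC -exZ//.
apply: le_ex => //; first exact: itgZ.
move=> t; rewrite indicE; case: (boolP (t \in A)) => [/set_mem/Ac|_] /=.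
  by rewrite mulr1.
by rewrite mulr0.
Qed.

(** Independent integrable variables: their joint law is the product of the laws,
    so the expectation of the product factors by Fubini. *)
Lemma ex_indepM d (T : measurableType d) (R : realType) (P : probability T R)
    (f g : T -> R) : itg P f -> itg P g ->
  (forall A B, measurable A -> measurable B ->
    P (f @^-1` A `&` g @^-1` B) = (P (f @^-1` A) * P (g @^-1` B))%E) ->
  itg P (fun t => f t * g t) /\ ex P (fun t => f t * g t) = ex P f * ex P g.
Proof.
move=> fi gi indep.
have mf := itg_measurable fi; have mg := itg_measurable gi.
pose X : {RV P >-> R} := HB.pack f (isMeasurableFun.Build _ _ _ _ _ mf).
pose Y : {RV P >-> R} := HB.pack g (isMeasurableFun.Build _ _ _ _ _ mg).
pose m1 := distribution P X; pose m2 := distribution P Y.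
have mfg : measurable_fun setT (fun t => (f t, g t)) by exact/measurable_fun_pairP.
pose XY : {RV P >-> (R * R)%type} := HB.pack (fun t => (f t, g t))
  (isMeasurableFun.Build _ _ _ _ _ mfg).
pose m := distribution P XY.
have mE A : measurable A -> (m1 \x m2)%E A = m A.
  by apply: product_measure_unique => A1 A2 mA1 mA2; exact: indep.
have mM : measurable_fun setT (fun z : R * R => (z.1 * z.2)%:E).
  by apply/measurable_EFinP; apply: measurable_funM.
have mabs : measurable_fun setT (fun y : R => `|y|%:E).
  by apply/measurable_EFinP; exact: normr_measurable.
have eqm h : measurable_fun setT h ->
    (forall z, (0 <= h z)%E) -> (\int[m1 \x m2]_z h z = \int[P]_t h (f t, g t))%E.
  move=> mh h0; rewrite (eq_measure_integral m); last by move=> A mA _; exact: mE.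
  by rewrite ge0_integral_distribution.
have ni : (m1 \x m2)%E.-integrable setT (fun z : R * R => (z.1 * z.2)%:E).
  apply/integrable12ltyP => //=.
  have -> : (\int[m1]_x \int[m2]_y `|(x * y)%:E| =
     \int[m1]_x (`|x|%:E * (ex P (fun t => `|g t|))%:E))%E.
    apply: eq_integral => x _.
    under eq_integral do rewrite EFinM abseM.
    rewrite ge0_integralZl//=.
    congr (_ * _)%E; rewrite exE; last exact: itg_norm.
    rewrite (@ge0_integral_distribution _ _ _ _ R P Y (fun y => `|y|%:E))//.
  rewrite ge0_integralZr//=; last first.
    by rewrite lee_fin ex_ge0.
  rewrite (@ge0_integral_distribution _ _ _ _ R P X (fun y => `|y|%:E))//.
  by rewrite -(@exE _ _ _ P (fun t => `|f t|)) ?ltry//; exact: itg_norm.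
have fgi : itg P (fun t => f t * g t).
  apply/integrableP; split.
    by apply/measurable_EFinP; apply: measurable_funM.
  move/integrableP : ni => [_]; rewrite eqm//.
  exact: measurableT_comp.
split => //; apply/EFin_inj; rewrite exE//.
transitivity (\int[m1 \x m2]_z (z.1 * z.2)%:E)%E.
  rewrite (eq_measure_integral m); last by move=> A mA _; exact: mE.
  by rewrite integral_distribution.
rewrite -integral12_prod_meas1//= /fubini_F /=.
have -> : (\int[m1]_x \int[m2]_y (x * y)%:E = \int[m1]_x (x%:E * (ex P g)%:E))%E.
  apply: eq_integral => x _.
  under eq_integral do rewrite EFinM.
  rewrite integralZl//=.
    by rewrite exE// integral_distribution.
  by apply: (@integrable_pushforward _ _ _ _ _ Y).
rewrite integralZr//=; last by apply: (@integrable_pushforward _ _ _ _ _ X).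
by rewrite integral_distribution// -(exE fi) EFinM.
Qed.

(** The pi-system of cylinder events generated by the coordinates in [J]. *)
Definition cylinders d (T : measurableType d) (R : realType)
    (P : probability T R) (I : finType) (X : I -> {RV P >-> R}) (J : {set I}) :
    set (set T) :=
  [set D | exists2 B : I -> set R, (forall i, measurable (B i)) &
     D = \bigcap_(i in [set` J]) (X i @^-1` B i)].

(** Measurability for the sigma-algebra of the coordinates in [J]. Measurable operations
    preserve it, which is what allows coordinates to be split off one at a time. *)
Definition depends_on d (T : measurableType d) (R : realType)
    (P : probability T R) (I : finType) (X : I -> {RV P >-> R}) (J : {set I})
    (f : T -> R) : Prop :=
  measurable_fun setT (f : g_sigma_algebraType (cylinders X J) -> R).

Lemma cylinders_setI d (T : measurableType d) (R : realType)
    (P : probability T R) (I : finType) (X : I -> {RV P >-> R}) (J : {set I}) :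
  setI_closed (cylinders X J).
Proof.
move=> _ _ [B mB ->] [C mC ->]; exists (fun i => B i `&` C i).
  by move=> i; exact: measurableI.
by rewrite -bigcapI; apply: eq_bigcapr => i _; rewrite preimage_setI.
Qed.

Lemma cylinders_measurable d (T : measurableType d) (R : realType)
    (P : probability T R) (I : finType) (X : I -> {RV P >-> R}) (J : {set I}) :
  <<s cylinders X J >> `<=` (measurable : set (set T)).
Proof.
apply: smallest_sub; first exact: sigma_algebra_measurable.
move=> _ [B mB ->]; apply: fin_bigcap_measurable => // i _.
by rewrite -[X in measurable X]setTI; exact: measurable_funP.
Qed.

Lemma depends_on_measurable d (T : measurableType d) (R : realType)
    (P : probability T R) (I : finType) (X : I -> {RV P >-> R}) (J : {set I})
    (f : T -> R) : depends_on X J f -> measurable_fun setT f.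
Proof. by move=> mf _ B mB; apply: (@cylinders_measurable _ _ _ _ _ X J); exact: mf. Qed.

Lemma depends_on_coord d (T : measurableType d) (R : realType)
    (P : probability T R) (I : finType) (X : I -> {RV P >-> R}) (J : {set I})
    (j : I) : j \in J -> depends_on X J (X j).
Proof.
move=> jJ _ B mB; rewrite setTI; apply: sub_sigma_algebra.
exists (fun i => if i == j then B else setT); first by move=> i; case: ifP.
apply/seteqP; split => [t Bt i _ /=|t /(_ j jJ) /=]; last by rewrite eqxx.
by case: eqP => // ->.
Qed.

(** The finite measures [P (. & {g (X e) in B})] and [P {g (X e) in B} * P] agree on the
    pi-system of cylinders, hence on the sigma-algebra that it generates. *)
Lemma depends_on_indep d (T : measurableType d) (R : realType)
    (P : probability T R) (I : finType) (X : I -> {RV P >-> R}) (J : {set I})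
    (e : I) (f : T -> R) (g : R -> R) :
  mutually_independent X -> e \notin J -> depends_on X J f ->
  measurable_fun setT g ->
  forall A B, measurable A -> measurable B ->
    P (f @^-1` A `&` (g \o X e) @^-1` B) =
    (P (f @^-1` A) * P ((g \o X e) @^-1` B))%E.
Proof.
move=> indep eJ df mg A B mA mB.
have mgB : measurable (g @^-1` B) by rewrite -[X in measurable X]setTI; exact: mg.
have -> : (g \o X e) @^-1` B = X e @^-1` (g @^-1` B) by [].
move: (g @^-1` B) mgB => {mB}B mB.
have mE : measurable (X e @^-1` B).
  by rewrite -[X in measurable X]setTI; exact: measurable_funP.
have pr : 0 <= fine (P (X e @^-1` B)) by rewrite fine_ge0.
pose m1 : {measure set T -> \bar R} := mrestr P mE.
pose m2 : {measure set T -> \bar R} := mscale (NngNum pr) P.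
have m1E D : m1 D = P (D `&` X e @^-1` B) by [].
have m2E D : m2 D = (P (X e @^-1` B) * P D)%E.
  transitivity ((fine (P (X e @^-1` B)))%:E * P D)%E; first by [].
  by rewrite fineK ?fin_num_measure.
have sA : <<s cylinders X J >> (f @^-1` A).
  by have := df measurableT _ mA; rewrite setTI.
have eqm : forall D, <<s cylinders X J >> D -> m1 D = m2 D.
  move=> D sD; apply: (@g_sigma_algebra_measure_unique _ R T (cylinders X J) _ (fun=> setT) _ _ m1 m2 _ _ _ D sD).
  - by move=> D' GD'; apply: (@cylinders_measurable _ _ _ _ _ X J); exact: sub_sigma_algebra.
  - move=> _; exists (fun=> setT) => //.
    by apply/seteqP; split.
  - by apply/seteqP; split => // t _; exists 0%N.
  - exact: cylinders_setI.
  - move=> _ [C mC ->]; rewrite m1E m2E.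
    pose C' i := if i == e then B else C i.
    have mC' i : measurable (C' i) by rewrite /C'; case: ifP.
    have C'e : C' e = B by rewrite /C' eqxx.
    have C'J i : i \in J -> C' i = C i.
      by rewrite /C'; case: eqP => // -> ; rewrite (negbTE eJ).
    have := indep (e |: J) C' mC'; rewrite big_setU1//= C'e.
    rewrite (eq_bigr (fun i => P (X i @^-1` C i))); last by move=> i /C'J ->.
    rewrite -indep// => <-; congr (P _).
    apply/seteqP; split => [t [Ct Bt] i /=|t Ct].
      rewrite !inE => /orP[/eqP ->|iJ]; first by rewrite C'e.
      by rewrite C'J//; exact: Ct.
    split=> [i iJ|]; first by rewrite -C'J//; apply: Ct; rewrite /= !inE iJ orbT.
    by rewrite -C'e; apply: Ct; rewrite /= !inE eqxx.
  - by move=> _; rewrite m1E setTI (le_lt_trans (probability_le1 P _))// ltry.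
have := eqm _ sA; rewrite m1E m2E => ->.
by rewrite muleC.
Qed.

Lemma ex_coordM d (T : measurableType d) (R : realType)
    (P : probability T R) (I : finType) (X : I -> {RV P >-> R}) (J : {set I})
    (e : I) (f : T -> R) (g : R -> R) :
  mutually_independent X -> e \notin J -> depends_on X J f ->
  measurable_fun setT g -> itg P f -> itg P (g \o X e) ->
  itg P (fun t => f t * g (X e t)) /\
  ex P (fun t => f t * g (X e t)) = ex P f * ex P (g \o X e).
Proof.
by move=> indep eJ df mg fi gi; apply: ex_indepM => // A B mA mB; exact: (depends_on_indep indep eJ).
Qed.

Lemma depends_onD d (T : measurableType d) (R : realType)
    (P : probability T R) (I : finType) (X : I -> {RV P >-> R}) (J : {set I})
    (f g : T -> R) : depends_on X J f -> depends_on X J g ->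
  depends_on X J (fun t => f t + g t).
Proof. exact: measurable_funD. Qed.

Lemma depends_onM d (T : measurableType d) (R : realType)
    (P : probability T R) (I : finType) (X : I -> {RV P >-> R}) (J : {set I})
    (f g : T -> R) : depends_on X J f -> depends_on X J g ->
  depends_on X J (fun t => f t * g t).
Proof. exact: measurable_funM. Qed.

Lemma depends_on_cst d (T : measurableType d) (R : realType)
    (P : probability T R) (I : finType) (X : I -> {RV P >-> R}) (J : {set I})
    (c : R) : depends_on X J (fun=> c).
Proof. exact: measurable_cst. Qed.

Lemma depends_on_comp d (T : measurableType d) (R : realType)
    (P : probability T R) (I : finType) (X : I -> {RV P >-> R}) (J : {set I})
    (f : T -> R) (g : R -> R) : measurable_fun setT g -> depends_on X J f ->
  depends_on X J (fun t => g (f t)).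
Proof. exact: measurableT_comp. Qed.

(** * Moments of the Gaussian law *)

Lemma ge0_integral_shift (R : realType) (a : R) (f : R -> \bar R) :
  measurable_fun [set: R] f -> (forall x, (0 <= f x)%E) ->
  (\int[lebesgue_measure]_x f x = \int[lebesgue_measure]_x f (a + x)%R)%E.
Proof.
move=> mf f0.
have mphi : measurable_fun [set: measurableTypeR R] (fun x : measurableTypeR R => a + x : measurableTypeR R).
  exact: measurable_funD.
pose phi : {mfun measurableTypeR R >-> measurableTypeR R} :=
  HB.pack (fun x : measurableTypeR R => a + x : measurableTypeR R) (isMeasurableFun.Build _ _ _ _ _ mphi).
have shiftE A : measurable A -> pushforward lebesgue_measure phi A = lebesgue_measure A.
  move=> mA; apply/esym/lebesgue_measure_unique => //= _ [[b c]] _ <-.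
  rewrite /pushforward (_ : _ @^-1` _ = [set` `](b - a), (c - a)]]); last first.
    by apply/seteqP; split => x /=; rewrite !in_itv/= ltrBlDl lerBrDl.
  rewrite !lebesgue_measure_itv/= !lte_fin ltrD2r.
  by rewrite -!EFinD; case: ifP => // _; congr EFin; ring.
transitivity (\int[pushforward lebesgue_measure phi]_x f x)%E.
  by apply: eq_measure_integral => //= A mA _; exact/esym/shiftE.
by rewrite (@ge0_integral_pushforward _ _ _ _ R phi)//.
Qed.

Lemma integral_oddfun (R : realType) (f : R -> R) :
  itg (@lebesgue_measure R) f -> (forall x, f (- x) = - f x) ->
  ex (@lebesgue_measure R) f = 0.
Proof.
move=> fi fN.
suff : ex (@lebesgue_measure R) f = - ex (@lebesgue_measure R) f by lra.
have mf := itg_measurable fi.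
transitivity (ex (@lebesgue_measure R) (fun x => f (- x))); last first.
  rewrite -mulN1r -exZ//; apply: eq_ex => x; by rewrite fN mulN1r.
apply: EFin_inj; rewrite !exE//; last first.
  by have := itgN fi; congr (_.-integrable _ _); apply/funext => x /=; rewrite fN.
transitivity (\int[pushforward lebesgue_measure
    (-%R : measurableTypeR R -> measurableTypeR R)]_x (EFin \o f) x)%E.
  by apply: eq_measure_integral => //= A mA _; exact/esym/lebesgue_measureN.
rewrite (@integral_pushforward _ _ _ _ R (-%R : measurableTypeR R -> measurableTypeR R))//.
  exact/measurable_EFinP.
rewrite preimage_setT.
by have := itgN fi; congr (_.-integrable _ _); apply/funext => x /=; rewrite fN.
Qed.

Lemma normal_pdf0E (R : realType) (s x : R) : 0 < s ->
  normal_pdf 0 s x = normal_peak s * expR (- (2 * s ^+ 2)^-1 * x ^+ 2).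
Proof.
move=> s0; rewrite normal_pdfE ?gt_eqF// /normal_fun subr0; congr (_ * expR _).
by rewrite mulNr [in RHS]mulNr mulr_natl mulrC.
Qed.

Lemma normal_pdf0N (R : realType) (s x : R) : 0 < s ->
  normal_pdf 0 s (- x) = normal_pdf 0 s x.
Proof. by move=> s0; rewrite !normal_pdf0E// sqrrN. Qed.

Lemma is_derive_normal_pdf (R : realType) (s x : R) : 0 < s ->
  is_derive x 1 (normal_pdf 0 s) (- (s ^- 2 * x) * normal_pdf 0 s x).
Proof.
move=> s0.
have -> : normal_pdf 0 s = (fun x => normal_peak s * expR (- (2 * s ^+ 2)^-1 * x ^+ 2)).
  by apply/funext => y; rewrite normal_pdf0E.
apply: is_derive_eq.
rewrite /GRing.scale /=.
have s20 : s != 0 by rewrite gt_eqF.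
by field.
Qed.

Lemma normal_peak_le (R : realType) (s : R) : 0 < s -> normal_peak s <= s^-1.
Proof.
move=> s0; rewrite /normal_peak lef_pV2 ?posrE//; last first.
  by rewrite sqrtr_gt0 mulrn_wgt0// mulr_gt0 ?exprn_gt0 ?pi_gt0.
have {1}-> : s = Num.sqrt (s ^+ 2) by rewrite sqrtr_sqr ger0_norm ?ltW.
rewrite ler_sqrt; last first.
  by rewrite mulrn_wge0// mulr_ge0 ?sqr_ge0 ?pi_ge0.
rewrite -mulrnAr ler_peMr ?sqr_ge0//.
by have := pi_ge2 R; rewrite mulr2n; lra.
Qed.

(** The exponential dominates the square of its argument, and the argument is quadratic
    in [x]. *)
Lemma normal_pdf_decay (R : realType) (s x : R) : 0 < s -> 0 < x ->
  x ^+ 4 * normal_pdf 0 s x <= 16 * s ^+ 3.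
Proof.
move=> s0 x0; rewrite normal_pdf0E//.
set u := (2 * s ^+ 2)^-1 * x ^+ 2.
have u0 : 0 < u by rewrite /u mulr_gt0 ?invr_gt0 ?mulr_gt0 ?exprn_gt0.
have e4 : u ^+ 2 / 4 <= expR u.
  have -> : u = u / 2 + u / 2 by lra.
  rewrite expRD -expr2; have -> : (u / 2 + u / 2) ^+ 2 / 4 = (u / 2) ^+ 2 by lra.
  rewrite ler_sqr ?nnegrE ?expR_ge0 ?divr_ge0 ?ltW//.
  by have := expR_ge1Dx (u / 2); lra.
have -> : - (2 * s ^+ 2)^-1 * x ^+ 2 = - u by rewrite /u; ring.
have sn : s != 0 by rewrite gt_eqF.
have xu : x ^+ 4 = 4 * s ^+ 4 * u ^+ 2 by rewrite /u; field.
have p1 : normal_peak s <= s^-1 by exact: normal_peak_le.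
have p0 : 0 <= normal_peak s by exact: normal_peak_ge0.
have e1 : u ^+ 2 * expR (- u) <= 4.
  by rewrite expRN ler_pdivrMr ?expR_gt0//; lra.
have -> : x ^+ 4 * (normal_peak s * expR (- u)) =
    4 * s ^+ 4 * (u ^+ 2 * expR (- u)) * normal_peak s by rewrite xu; ring.
have -> : 16 * s ^+ 3 = 4 * s ^+ 4 * 4 * s^-1 by field.
have s4 : 0 < 4 * s ^+ 4 by rewrite mulr_gt0 ?exprn_gt0.
apply: ler_pM => //; last by rewrite ler_pM2l.
by rewrite mulr_ge0 ?ltW// mulr_gt0 ?exprn_gt0 ?expR_gt0.
Qed.

Lemma continuous_exprn_normal (R : realType) (s c : R) (k : nat) : 0 < s ->
  continuous (fun x : R => (x ^+ k - c) * normal_pdf 0 s x).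
Proof.
move=> s0 x; apply: cvgM; last by apply: continuous_normal_pdf; rewrite gt_eqF.
apply: cvgB; last exact: cvg_cst.
exact: exprn_continuous.
Qed.

Lemma cvg_exprn_normal (R : realType) (s : R) (k : nat) : 0 < s -> (k <= 3)%N ->
  (x ^+ k * normal_pdf 0 s x) @[x --> +oo%R] --> (0 : R).
Proof.
move=> s0 k3.
apply: (@squeeze_cvgr _ _ _ _ (fun=> 0) (fun x => 16 * s ^+ 3 * x^-1)).
- near=> x.
  have x1 : 1 < x by near: x; exact: nbhs_pinfty_gt.
  have x0 : 0 < x by lra.
  apply/andP; split; first by rewrite mulr_ge0 ?exprn_ge0 ?normal_pdf_ge0 ?ltW.
  rewrite ler_pdivlMr//.
  apply: le_trans (normal_pdf_decay s0 x0).
  rewrite mulrAC -exprSr ler_wpM2r ?normal_pdf_ge0//.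
  by rewrite ler_weXn2l ?ltW.
- exact: cvg_cst.
- rewrite -[X in _ --> X](mulr0 (16 * s ^+ 3)); apply: cvgM; first exact: cvg_cst.
  apply/gtr0_cvgV0; last exact: cvg_id.
  near=> x; near: x; exact: nbhs_pinfty_gt.
Unshelve. all: by end_near. Qed.

(** [x ^+ 3] times the density is exactly the derivative of
    [- s ^+ 2 * (x ^+ 2 + 2 * s ^+ 2)] times the density. *)
Lemma normal_third_moment (R : realType) (s : R) : 0 < s ->
  (\int[lebesgue_measure]_(x in `[0%R, +oo[) (x ^+ 3 * normal_pdf 0 s x)%:E =
   (2 * s ^+ 4 * normal_peak s)%:E)%E.
Proof.
move=> s0; have sn : s != 0 by rewrite gt_eqF.
pose F (x : R^o) : R^o := - s ^+ 2 * (x ^+ 2 + 2 * s ^+ 2) * normal_pdf 0 s x.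
have dF (x : R^o) : is_derive x 1 F (x ^+ 3 * normal_pdf 0 s x).
  have d1 := is_derive_normal_pdf x s0.
  rewrite /F; apply: is_derive_eq.
  rewrite /GRing.scale /=; field.
  exact: sn.
have F0 : F 0 = - (2 * s ^+ 4 * normal_peak s).
  by rewrite /F normal_pdf0E// expr0n /= mulr0 expR0; ring.
have FE : F = fun x => - s ^+ 2 * (x ^+ 2 * normal_pdf 0 s x +
    2 * s ^+ 2 * (x ^+ 0 * normal_pdf 0 s x)).
  by apply/funext => x; rewrite /F; ring.
have Fy : F x @[x --> +oo%R] --> (0 : R).
  rewrite FE -[X in _ --> X](_ : - s ^+ 2 * (0 + 2 * s ^+ 2 * 0) = 0); last first.
    by rewrite mulr0 addr0 mulr0.
  apply: cvgM; first exact: cvg_cst.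
  apply: cvgD; first exact: cvg_exprn_normal.
  by apply: cvgM; [exact: cvg_cst|exact: cvg_exprn_normal].
have cF : F x @[x --> 0] --> F 0.
  by apply/differentiable_continuous/derivable1_diffP; have [] := dF 0.
rewrite (@ge0_continuous_FTC2y _ _ F 0 0)//.
- by rewrite F0 sub0e -EFinN opprK.
- by move=> x x0; rewrite mulr_ge0 ?exprn_ge0 ?normal_pdf_ge0.
- apply: continuous_subspaceT => x.
  have := @continuous_exprn_normal _ s 0 3 s0 x.
  by under eq_fun do rewrite subr0.
- exact: cvg_at_right_filter.
- by move=> x _; rewrite derive1E; have [] := dF x.
Qed.

(** By symmetry, twice the integral over the half-line. *)
Lemma integrable_cube_normal (R : realType) (s : R) : 0 < s ->
  itg (@lebesgue_measure R) (fun x => `|x| ^+ 3 * normal_pdf 0 s x) /\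
  ex (@lebesgue_measure R) (fun x => `|x| ^+ 3 * normal_pdf 0 s x) =
    4 * s ^+ 4 * normal_peak s.
Proof.
move=> s0.
have cn : continuous (normal_pdf 0 s) by apply: continuous_normal_pdf; rewrite gt_eqF.
have c3 : continuous (fun x : R => `|x| ^+ 3 * normal_pdf 0 s x).
  move=> x; apply: cvgM; last exact: cn.
  apply: (@continuous_comp _ _ _ (fun x : R^o => `|x| : R) (fun y : R => y ^+ 3)).
    exact: norm_continuous.
  exact: exprn_continuous.
have E : (\int[lebesgue_measure]_x (`|x| ^+ 3 * normal_pdf 0 s x)%:E =
    (4 * s ^+ 4 * normal_peak s)%:E)%E.
  rewrite ge0_symfun_integralT//; last 2 first.
  - by move=> x; rewrite mulr_ge0 ?exprn_ge0 ?normal_pdf_ge0.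
  - by move=> x /=; rewrite normrN normal_pdf0N.
  rewrite -set_itvcy (eq_integral (fun x : measurableTypeR R => ((x : R) ^+ 3 * normal_pdf 0 s x)%:E)).
    by rewrite normal_third_moment// -EFinM; congr EFin; ring.
  by move=> x /[!inE]/= /[!in_itv]/= /andP[x0 _]; rewrite ger0_norm.
have i3 : itg (@lebesgue_measure R) (fun x => `|x| ^+ 3 * normal_pdf 0 s x).
  apply/integrableP; split.
    by apply/measurable_EFinP; exact: continuous_measurable_fun.
  under eq_integral do rewrite gee0_abs ?lee_fin ?mulr_ge0 ?exprn_ge0 ?normal_pdf_ge0//.
  by rewrite E ltry.
by split => //; apply: EFin_inj; rewrite exE.
Qed.

Lemma integrable_exprn_normal (R : realType) (s : R) (k : nat) : 0 < s ->
  (k <= 3)%N -> itg (@lebesgue_measure R) (fun x => x ^+ k * normal_pdf 0 s x).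
Proof.
move=> s0 k3.
have [i3 _] := integrable_cube_normal s0.
have i0 : itg (@lebesgue_measure R) (normal_pdf 0 s) by exact: integrable_normal_pdf.
apply: (itg_le _ _ (itgD i0 i3)) => [|x].
  apply: continuous_measurable_fun => x.
  have := @continuous_exprn_normal _ s 0 k s0 x.
  by under eq_fun do rewrite subr0.
rewrite normrM normrX (ger0_norm (normal_pdf_ge0 _ _ _)) -{2}[normal_pdf 0 s x]mul1r -mulrDl.
rewrite ler_wpM2r ?normal_pdf_ge0//.
have [x1|x1] := leP `|x| 1.
  by have := @exprn_ile1 _ k _ (normr_ge0 x) x1; have := exprn_ge0 3 (normr_ge0 x); lra.
by rewrite (le_trans (ler_weXn2l (ltW x1) k3))// lerDr.
Qed.

(** The contributions of [`[0, s]] and of [`[s, +oo[] to the integral of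
    [(x ^+ 2 - s ^+ 2)] times the density cancel: [- s ^+ 2 * x] times the density is
    a primitive. *)
Lemma normal_second_moment (R : realType) (s : R) : 0 < s ->
  ex (@lebesgue_measure R) (fun x => x ^+ 2 * normal_pdf 0 s x) = s ^+ 2.
Proof.
move=> s0; have sn : s != 0 by rewrite gt_eqF.
pose n := normal_pdf 0 s.
have n0 x : 0 <= n x by exact: normal_pdf_ge0.
pose F (x : R^o) : R^o := - s ^+ 2 * x * n x.
have dF (x : R^o) : is_derive x 1 F ((x ^+ 2 - s ^+ 2) * n x).
  have d1 := is_derive_normal_pdf x s0.
  rewrite /F /n; apply: is_derive_eq.
  by rewrite /GRing.scale /=; field.
have cF (x : R^o) : F x @[x --> x] --> F x.
  by apply/differentiable_continuous/derivable1_diffP; have [] := dF x.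
have cg : continuous (fun x : R => (x ^+ 2 - s ^+ 2) * n x).
  exact: continuous_exprn_normal.
have F'E x : (F^`())%classic x = (x ^+ 2 - s ^+ 2) * n x.
  by rewrite derive1E; have [] := dF x.
have I1 : \int[lebesgue_measure]_(x in `[0, s]) ((x ^+ 2 - s ^+ 2) * n x) = F s.
  rewrite /Rintegral (@continuous_FTC2 _ _ F 0 s)//.
  - by rewrite -EFinB /= /F mulr0 mul0r subr0.
  - exact: continuous_subspaceT.
  - split; first by move=> x _; have [] := dF x.
      by apply: cvg_at_right_filter; exact: cF.
    by apply: cvg_at_left_filter; exact: cF.
have I2 : \int[lebesgue_measure]_(x in `[s, +oo[) ((x ^+ 2 - s ^+ 2) * n x) = - F s.
  rewrite /Rintegral (@ge0_continuous_FTC2y _ _ F s 0)//.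
  - by rewrite -EFinB /= sub0r.
  - by move=> x sx; rewrite mulr_ge0// subr_ge0 ler_sqr ?nnegrE//; lra.
  - exact: continuous_subspaceT.
  - rewrite -[X in _ --> X](mulr0 (- s ^+ 2)) /F.
    under eq_fun do rewrite -mulrA; apply: cvgM; first exact: cvg_cst.
    exact: (@cvg_exprn_normal _ s 1).
  - by apply: cvg_at_right_filter; exact: cF.
have i2 := @integrable_exprn_normal _ s 2 s0 isT.
have i0 : itg (@lebesgue_measure R) n by exact: integrable_normal_pdf.
have ig : itg (@lebesgue_measure R) (fun x => (x ^+ 2 - s ^+ 2) * n x).
  have := itgD i2 (itgZ (- s ^+ 2) i0).
  by congr (_.-integrable _ _); apply/funext => x /=; congr EFin; rewrite /n; ring.
have half (f : R -> R) : itg (@lebesgue_measure R) f -> (forall x, 0 <= f x) -> continuous f ->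
    (forall x, f (- x) = f x) ->
    ex (@lebesgue_measure R) f = 2 * \int[lebesgue_measure]_(x in `[0, +oo[) f x.
  move=> fi f0 cf fN; apply: EFin_inj; rewrite exE// ge0_symfun_integralT//; last first.
    by move=> x /=; rewrite fN.
  rewrite EFinM -set_itvcy; congr (_ * _)%E; rewrite fineK//.
  by apply: integrable_fin_num => //; apply: integrableS fi.
rewrite half//; last 3 first.
- by move=> x; rewrite mulr_ge0 ?sqr_ge0.
- move=> x; have := @continuous_exprn_normal _ s 0 2 s0 x.
  by under eq_fun do rewrite subr0.
- by move=> x; rewrite sqrrN normal_pdf0N.
have : ex (@lebesgue_measure R) n = 1 by rewrite /ex /Rintegral integral_normal_pdf.
rewrite half//; last 2 first.
- by apply: continuous_normal_pdf.
- by move=> x; exact: normal_pdf0N.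
have : \int[lebesgue_measure]_(x in `[0, +oo[) ((x ^+ 2 - s ^+ 2) * n x) =
   \int[lebesgue_measure]_(x in `[0, +oo[) (x ^+ 2 * n x)
   - s ^+ 2 * \int[lebesgue_measure]_(x in `[0, +oo[) n x.
  rewrite -RintegralZl//; last by apply: integrableS i0.
  rewrite -RintegralB//; last 2 first.
  - by apply: integrableS i2.
  - by have := itgZ (s ^+ 2) i0; apply: integrableS.
  by apply: eq_Rintegral => x _; ring.
have -> : \int[lebesgue_measure]_(x in `[0, +oo[) ((x ^+ 2 - s ^+ 2) * n x) = 0.
  have := @Rintegral_itvB _ (fun x => (x ^+ 2 - s ^+ 2) * n x) (BLeft 0) +oo%O s.
  rewrite Rintegral_itv_obnd_cbnd; last by apply: integrableS ig.
  rewrite I1 I2 => H.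
  have {}H : \int[lebesgue_measure]_(t in `[0, +oo[) ((t ^+ 2 - s ^+ 2) * n t) - F s = - F s.
    apply: H => //; first by apply: integrableS ig.
    by rewrite bnd_simp ltW.
  lra.
rewrite -/n; set M2 := \int[_]_(_ in _) _; set M0 := \int[_]_(_ in _) _ => h1 h2.
have -> : M2 = s ^+ 2 * M0 by lra.
by rewrite mulrCA h2 mulr1.
Qed.

(** * Gaussian smoothing *)

(** The expectation of [f (y + s * Z)] for a standard Gaussian [Z]. *)
Definition gauss_smooth (R : realType) (s : R) (f : R -> R) (y : R) : R :=
  ex (@lebesgue_measure R) (fun x : R => f (y + x) * normal_pdf 0 s x).

Lemma ex_normal_pdf (R : realType) (s : R) :
  itg (@lebesgue_measure R) (normal_pdf 0 s) /\
  ex (@lebesgue_measure R) (normal_pdf 0 s) = 1.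
Proof.
split; first exact: integrable_normal_pdf.
by rewrite /ex /Rintegral integral_normal_pdf.
Qed.

Lemma measurable_shift (R : realType) (f : R -> R) (y : R) :
  measurable_fun setT f -> measurable_fun setT (fun x => f (y + x)).
Proof. by move=> mf; apply: (measurableT_comp mf); exact: measurable_funD. Qed.

Lemma itg_gauss_smooth (R : realType) (s M : R) (f : R -> R) (y : R) :
  measurable_fun setT f -> (forall x, `|f x| <= M) ->
  itg (@lebesgue_measure R) (fun x => f (y + x) * normal_pdf 0 s x).
Proof.
move=> mf fM; have [i0 _] := ex_normal_pdf s.
apply: (itg_le _ _ (itgZ M i0)) => [|x].
  by apply: measurable_funM; [exact: measurable_shift|exact: measurable_normal_pdf].
by rewrite normrM (ger0_norm (normal_pdf_ge0 _ _ _)) ler_wpM2r ?normal_pdf_ge0.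
Qed.

Lemma gauss_smooth_bounded (R : realType) (s M : R) (f : R -> R) (y : R) :
  measurable_fun setT f -> (forall x, `|f x| <= M) -> `|gauss_smooth s f y| <= M.
Proof.
move=> mf fM; have [i0 e0] := ex_normal_pdf s.
have ig := itg_gauss_smooth s y mf fM.
apply: (le_trans (norm_ex_le ig)).
rewrite -[leRHS]mulr1 -e0 -exZ//; apply: le_ex; [exact: itg_norm|exact: itgZ|].
by move=> x; rewrite normrM (ger0_norm (normal_pdf_ge0 _ _ _)) ler_wpM2r ?normal_pdf_ge0.
Qed.

Lemma measurable_gauss_smooth (R : realType) (s M : R) (f : R -> R) :
  measurable_fun setT f -> (forall x, `|f x| <= M) ->
  measurable_fun setT (gauss_smooth s f).
Proof.
move=> mf fM; have [i0 e0] := ex_normal_pdf s.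
pose h (z : measurableTypeR R * measurableTypeR R) : \bar R :=
  ((f ((z.1 : R) + z.2) + M) * normal_pdf 0 s z.2)%:E.
have mh : measurable_fun setT h.
  apply/measurable_EFinP; apply: measurable_funM.
    apply: measurable_funD => //; apply: (measurableT_comp mf).
    exact: measurable_funD.
  exact: (measurableT_comp (measurable_normal_pdf 0 s)).
have h0 z : (0 <= h z)%E.
  rewrite lee_fin mulr_ge0 ?normal_pdf_ge0//.
  by have := fM ((z.1 : R) + z.2); rewrite ler_norml; lra.
have mF := @measurable_fun_fubini_tonelli_F _ _ _ _ R lebesgue_measure h mh h0.
have /measurable_EFinP mg : measurable_fun setT (EFin \o (fun y => gauss_smooth s f y + M)).
  apply: (eq_measurable_fun (fubini_F lebesgue_measure h)) mF => y _.
  rewrite /fubini_F /h /= -[M in RHS]mulr1 -e0 -exZ// -exD//.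
  - rewrite exE.
      by apply: eq_integral => x _; rewrite mulrDl.
    by apply: itgD; [exact: itg_gauss_smooth mf fM|exact: itgZ].
  - exact: itg_gauss_smooth mf fM.
  - exact: itgZ.
have -> : gauss_smooth s f = (fun y => gauss_smooth s f y + M - M).
  by apply/funext => y; rewrite addrK.
exact: measurable_funB.
Qed.

(** Completing the square: the posterior law of the first Gaussian summand given
    the sum is again Gaussian. *)
Lemma normal_pdfM (R : realType) (a b x u : R) : 0 < a -> 0 < b ->
  let c := Num.sqrt (a ^+ 2 + b ^+ 2) in
  normal_pdf 0 b (u - x) * normal_pdf 0 a x =
  normal_pdf 0 c u * normal_pdf (a ^+ 2 * u / c ^+ 2) (a * b / c) x.
Proof.
move=> a0 b0 c; have c0 : 0 < c by rewrite sqrtr_gt0 addr_gt0 ?exprn_gt0.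
have cE : c ^+ 2 = a ^+ 2 + b ^+ 2 by rewrite sqr_sqrtr// ltW// addr_gt0 ?exprn_gt0.
have [an bn cn] : [/\ a != 0, b != 0 & c != 0] by rewrite !gt_eqF.
have pM (e f : R) : 0 < e -> 0 < f ->
    normal_peak e * normal_peak f = (Num.sqrt ((e * f) ^+ 2 * (pi *+ 2) ^+ 2))^-1.
  move=> e0 f0; rewrite /normal_peak -invfM -sqrtrM; last first.
    by rewrite mulrn_wge0// mulr_ge0 ?sqr_ge0 ?pi_ge0.
  have -> // : e ^+ 2 * pi *+ 2 * (f ^+ 2 * pi *+ 2) = (e * f) ^+ 2 * (pi *+ 2) ^+ 2.
  by move: (pi : R) => q; ring.
rewrite !normal_pdf0E// normal_pdfE; last by rewrite !mulf_neq0 ?invr_eq0.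
rewrite /normal_fun.
have -> : normal_peak b * expR (- (2 * b ^+ 2)^-1 * (u - x) ^+ 2) *
  (normal_peak a * expR (- (2 * a ^+ 2)^-1 * x ^+ 2)) =
  (normal_peak a * normal_peak b) * (expR (- (2 * b ^+ 2)^-1 * (u - x) ^+ 2) *
   expR (- (2 * a ^+ 2)^-1 * x ^+ 2)) by ring.
rewrite -expRD.
set E := expR _.
rewrite mulrACA -expRD !pM ?divr_gt0 ?mulr_gt0//.
have -> : c * (a * b / c) = a * b by field.
congr (_ * expR _); rewrite {E}.
rewrite -[(a * b / c) ^+ 2 *+ 2]mulr_natl !exprMn exprVn cE.
have cn2 : a ^+ 2 + b ^+ 2 != 0 by rewrite -cE expf_neq0.
by field; rewrite an bn cn2.
Qed.

(** In the double integral, the substitution [u = x + x'] and [normal_pdfM] leave a Gaussian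
    law in [x] of total mass [1], whatever [u] is. *)
Lemma gauss_smooth_semigroup (R : realType) (a b M : R) (f : R -> R) (y : R) :
  0 < a -> 0 < b -> measurable_fun setT f -> (forall x, 0 <= f x <= M) ->
  gauss_smooth a (gauss_smooth b f) y = gauss_smooth (Num.sqrt (a ^+ 2 + b ^+ 2)) f y.
Proof.
move=> a0 b0 mf f0M; set c := Num.sqrt _.
have fM x : `|f x| <= M by have /andP[f0 fM] := f0M x; rewrite ger0_norm.
have f0 x : 0 <= f x by have /andP[] := f0M x.
have mg := measurable_gauss_smooth b mf fM.
have gM x := gauss_smooth_bounded b x mf fM.
apply: EFin_inj; rewrite !exE; last 2 first.
- exact: itg_gauss_smooth mf fM.
- exact: itg_gauss_smooth mg gM.
pose h (z : measurableTypeR R * measurableTypeR R) : \bar R :=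
  (f (y + z.2) * (normal_pdf 0 b ((z.2 : R) - z.1) * normal_pdf 0 a z.1))%:E.
have mh : measurable_fun setT h.
  apply/measurable_EFinP; apply: measurable_funM.
    apply: (measurableT_comp mf); exact: measurable_funD.
  apply: measurable_funM.
    apply: (measurableT_comp (measurable_normal_pdf 0 b)).
    exact: measurable_funB.
  exact: (measurableT_comp (measurable_normal_pdf 0 a)).
have h0 z : (0 <= h z)%E by rewrite lee_fin !mulr_ge0 ?normal_pdf_ge0.
transitivity (\int[lebesgue_measure]_x \int[lebesgue_measure]_u h (x, u))%E.
  apply: eq_integral => x _.
  rewrite EFinM exE; last exact: itg_gauss_smooth mf fM.
  rewrite -ge0_integralZr//.
  - rewrite [RHS](@ge0_integral_shift _ x).
    + apply: eq_integral => u _; rewrite -EFinM /h /=.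
      have -> : y + x + u = y + (x + u) by ring.
      have -> : (x : R) + u - x = u by ring.
      by rewrite mulrA.
    + exact: measurableT_comp.
    + by move=> z; exact: h0.
  - apply/measurable_EFinP.
    by apply: measurable_funM; [exact: measurable_shift|exact: measurable_normal_pdf].
  - by move=> z _; rewrite lee_fin mulr_ge0 ?normal_pdf_ge0.
  - by rewrite lee_fin normal_pdf_ge0.
rewrite (@fubini_tonelli _ _ _ _ R lebesgue_measure lebesgue_measure h mh h0).
apply: eq_integral => u _.
under eq_integral do rewrite /h /= normal_pdfM// mulrA EFinM.
rewrite ge0_integralZl//.
- by rewrite integral_normal_pdf mule1.
- by apply/measurable_EFinP; exact: measurable_normal_pdf.
- by move=> x _; rewrite lee_fin normal_pdf_ge0.
- by rewrite lee_fin mulr_ge0 ?normal_pdf_ge0.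
Qed.

(** * The central limit theorem by replacement *)

(** Test functions for the replacement argument; [f1] and [f2] play the role of the first two
    derivatives, in the form of a Taylor bound, which averaging preserves. *)
Definition taylor_test (R : realType) (M C : R) (f f1 f2 : R -> R) : Prop :=
  [/\ [/\ measurable_fun setT f, measurable_fun setT f1 & measurable_fun setT f2],
      forall y, [/\ 0 <= f y <= M, `|f1 y| <= M & `|f2 y| <= M] &
      forall y x, `|f (y + x) - f y - f1 y * x - f2 y * (x ^+ 2 / 2)| <= C * `|x| ^+ 3].

Lemma taylor_test_bound (R : realType) (M C : R) (f f1 f2 : R -> R) :
  taylor_test M C f f1 f2 -> forall y, `|f y| <= M.
Proof. by move=> [_ fM _] y; have [/andP[f0 ?] _ _] := fM y; rewrite ger0_norm. Qed.

(** Averaging preserves every bound with its constant, so that the smoothing can be repeated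
    as often as there are summands. *)
Lemma gauss_smooth_taylor_test (R : realType) (M C s : R) (f f1 f2 : R -> R) :
  taylor_test M C f f1 f2 ->
  taylor_test M C (gauss_smooth s f) (gauss_smooth s f1) (gauss_smooth s f2).
Proof.
move=> tt; have fM := taylor_test_bound tt; case: tt => [[mf mf1 mf2] fb T].
have f1M y : `|f1 y| <= M by have [] := fb y.
have f2M y : `|f2 y| <= M by have [] := fb y.
have [i0 e0] := ex_normal_pdf s.
split.
- by split; [exact: measurable_gauss_smooth mf fM|exact: measurable_gauss_smooth mf1 f1M|
             exact: measurable_gauss_smooth mf2 f2M].
- move=> y; split; [|exact: gauss_smooth_bounded|exact: gauss_smooth_bounded].
  have := gauss_smooth_bounded s y mf fM; rewrite ler_norml => /andP[_ ->].
  rewrite andbT; apply: ex_ge0 => x; rewrite mulr_ge0 ?normal_pdf_ge0//.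
  by have [/andP[]] := fb (y + x).
- move=> y h; rewrite /gauss_smooth.
  have ia := itg_gauss_smooth s (y + h) mf fM.
  have ib := itg_gauss_smooth s y mf fM.
  have ic := itg_gauss_smooth s y mf1 f1M.
  have id := itg_gauss_smooth s y mf2 f2M.
  pose r x := (f (y + x + h) - f (y + x) - f1 (y + x) * h - f2 (y + x) * (h ^+ 2 / 2))
              * normal_pdf 0 s x.
  have iab := itgD ia (itgN ib); have icd := itgD (itgZ h ic) (itgZ (h ^+ 2 / 2) id).
  have rE : r = fun x => (f (y + h + x) * normal_pdf 0 s x - f (y + x) * normal_pdf 0 s x)
     - (h * (f1 (y + x) * normal_pdf 0 s x) + h ^+ 2 / 2 * (f2 (y + x) * normal_pdf 0 s x)).
    by apply/funext => x; rewrite /r [y + h + x]addrAC; ring.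
  have ir : itg (@lebesgue_measure R) r by rewrite rE; apply: itgD => //; exact: itgN.
  have -> : ex (@lebesgue_measure R) (fun x : R => f (y + h + x) * normal_pdf 0 s x) -
    ex (@lebesgue_measure R) (fun x : R => f (y + x) * normal_pdf 0 s x) -
    ex (@lebesgue_measure R) (fun x : R => f1 (y + x) * normal_pdf 0 s x) * h -
    ex (@lebesgue_measure R) (fun x : R => f2 (y + x) * normal_pdf 0 s x) * (h ^+ 2 / 2) =
    ex (@lebesgue_measure R) r.
    rewrite rE exB// exB// exD; [|exact: itgZ|exact: itgZ].
    by rewrite exZ// exZ//; ring.
  apply: (le_trans (norm_ex_le ir)).
  rewrite -[leRHS]mulr1 -e0 -exZ//; apply: le_ex; [exact: itg_norm|exact: itgZ|].
  move=> x; rewrite normrM (ger0_norm (normal_pdf_ge0 _ _ _)) ler_wpM2r ?normal_pdf_ge0//.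
Qed.

(** The odd Gaussian moments vanish, the second one is exact, and the third absolute
    moment is at most [4 * s ^+ 3]. *)
Lemma gauss_smooth_expand (R : realType) (M C s : R) (f f1 f2 : R -> R) (y : R) :
  0 < s -> 0 <= C -> taylor_test M C f f1 f2 ->
  `|gauss_smooth s f y - f y - f2 y * (s ^+ 2 / 2)| <= C * (4 * s ^+ 3).
Proof.
move=> s0 C0 tt; have fM := taylor_test_bound tt; case: tt => [[mf mf1 mf2] fb T].
have [i0 e0] := ex_normal_pdf s.
have [i3 e3] := integrable_cube_normal s0.
have ib := itg_gauss_smooth s y mf fM.
have i1 := @integrable_exprn_normal _ s 1 s0 isT.
have i2 := @integrable_exprn_normal _ s 2 s0 isT.
have e1 : ex (@lebesgue_measure R) (fun x => x ^+ 1 * normal_pdf 0 s x) = 0.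
  by apply: integral_oddfun => // x; rewrite !expr1 normal_pdf0N// mulNr.
have e2 := normal_second_moment s0.
pose r x := (f (y + x) - f y - f1 y * x - f2 y * (x ^+ 2 / 2)) * normal_pdf 0 s x.
have iA := itgD ib (itgN (itgZ (f y) i0)).
have iB := itgD (itgZ (f1 y) i1) (itgZ (f2 y / 2) i2).
have rE : r = fun x => (f (y + x) * normal_pdf 0 s x - f y * normal_pdf 0 s x)
  - (f1 y * (x ^+ 1 * normal_pdf 0 s x) + f2 y / 2 * (x ^+ 2 * normal_pdf 0 s x)).
  by apply/funext => x; rewrite /r; field.
have ir : itg (@lebesgue_measure R) r by rewrite rE; apply: itgD => //; exact: itgN.
have -> : gauss_smooth s f y - f y - f2 y * (s ^+ 2 / 2) = ex (@lebesgue_measure R) r.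
  rewrite rE exB// exB//; last exact: itgZ.
  rewrite exD; [|exact: itgZ|exact: itgZ].
  by rewrite !exZ// e0 e1 e2 /gauss_smooth; field.
apply: (le_trans (norm_ex_le ir)).
apply: (@le_trans _ _ (C * (4 * s ^+ 4 * normal_peak s))).
  rewrite -e3 -exZ//; apply: le_ex; [exact: itg_norm|exact: itgZ|].
  move=> x; rewrite normrM (ger0_norm (normal_pdf_ge0 _ _ _)) [leRHS]mulrA.
  by rewrite ler_wpM2r ?normal_pdf_ge0.
rewrite ler_wpM2l// -mulrA ler_wpM2l//.
rewrite exprSr -mulrA -[leRHS]mulr1; apply: ler_wpM2l; first by rewrite exprn_ge0 ?ltW.
by rewrite mulrC -ler_pdivlMr// div1r normal_peak_le.
Qed.

(** One step of the replacement argument: an independent centred summand may be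
    traded for a Gaussian of the same variance, at third-order cost. *)
Lemma replace_summand d (T : measurableType d) (R : realType)
    (P : probability T R) (I : finType) (X : I -> {RV P >-> R}) (J : {set I})
    (e : I) (g : R -> R) (U : T -> R) (M C s m : R) (f f1 f2 : R -> R) :
  mutually_independent X -> e \notin J -> depends_on X J U ->
  measurable_fun setT g -> 0 < s -> 0 <= C -> taylor_test M C f f1 f2 ->
  itg P (fun t => `|g (X e t)| ^+ 3) -> ex P (fun t => `|g (X e t)| ^+ 3) <= m ->
  ex P (fun t => g (X e t)) = 0 -> ex P (fun t => g (X e t) ^+ 2) = s ^+ 2 ->
  `|ex P (fun t => f (U t + g (X e t))) - ex P (fun t => gauss_smooth s f (U t))|
     <= C * (m + 4 * s ^+ 3).
Proof.
move=> indep eJ dU mg s0 C0 tt i3 e3 e1 e2.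
have fM := taylor_test_bound tt; have tt' := tt; case: tt' => [[mf mf1 mf2] fb Tb].
have f1M y : `|f1 y| <= M by have [] := fb y.
have f2M y : `|f2 y| <= M by have [] := fb y.
have mU := depends_on_measurable dU.
have mG : measurable_fun setT (fun t => g (X e t)) by apply: (measurableT_comp mg).
pose G t := g (X e t); rewrite -/G in mG *.
have iG1 : itg P G.
  apply: (itg_le mG _ (itgD (itg_cst P 1) i3)) => t; rewrite -/(G t).
  have [x1|x1] := leP `|G t| 1; first by rewrite (le_trans x1)// lerDl exprn_ge0.
  rewrite (le_trans _ (_ : `|G t| ^+ 3 <= _)) ?lerDr//.
  by rewrite -[leLHS]expr1 ler_weXn2l// ltW.
have iG2 : itg P (fun t => G t ^+ 2).
  apply: (itg_le _ _ (itgD (itg_cst P 1) i3)) => [|t]; first exact: measurable_funX.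
  rewrite -/(G t) normrX.
  have [x1|x1] := leP `|G t| 1.
    by have := @exprn_ile1 _ 2 _ (normr_ge0 (G t)) x1; have := exprn_ge0 3 (normr_ge0 (G t)); lra.
  rewrite (le_trans _ (_ : `|G t| ^+ 3 <= _)) ?lerDr//.
  by rewrite ler_weXn2l// ltW.
have bounded (k : R -> R) (V : T -> R) : measurable_fun setT k -> measurable_fun setT V ->
    (forall y, `|k y| <= M) -> itg P (fun t => k (V t)).
  by move=> mk mV kM; apply: (@itg_bounded _ _ _ _ M) => //; exact: measurableT_comp.
have [iA eA] : itg P (fun t => f1 (U t) * G t) /\ ex P (fun t => f1 (U t) * G t) = 0.
  have [iA eA] := @ex_coordM _ _ _ P I X J e (fun t => f1 (U t)) g indep eJ
    (depends_on_comp mf1 dU) mg (bounded _ _ mf1 mU f1M) iG1.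
  by split => //; rewrite eA e1 mulr0.
have mg2 : measurable_fun setT (fun x => g x ^+ 2) by exact: measurable_funX.
have [iB eB] : itg P (fun t => f2 (U t) * G t ^+ 2) /\
    ex P (fun t => f2 (U t) * G t ^+ 2) = ex P (fun t => f2 (U t)) * s ^+ 2.
  have [iB eB] := @ex_coordM _ _ _ P I X J e (fun t => f2 (U t)) (fun x => g x ^+ 2) indep eJ
    (depends_on_comp mf2 dU) mg2 (bounded _ _ mf2 mU f2M) iG2.
  by split => //; rewrite eB -e2.
have mUG : measurable_fun setT (fun t => U t + G t) by exact: measurable_funD.
have if0 := bounded _ _ mf mU fM.
have if2 := bounded _ _ mf2 mU f2M.
have ifs := bounded _ _ mf mUG fM.
have igs : itg P (fun t => gauss_smooth s f (U t)).
  by apply: bounded => //; [exact: measurable_gauss_smooth mf fM|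
     move=> y; exact: gauss_smooth_bounded].
pose r t := f (U t + G t) - f (U t) - f1 (U t) * G t - f2 (U t) * (G t ^+ 2 / 2).
pose q t := gauss_smooth s f (U t) - f (U t) - f2 (U t) * (s ^+ 2 / 2).
have rE : r = fun t => (f (U t + G t) - f (U t)) - (f1 (U t) * G t + 1 / 2 * (f2 (U t) * G t ^+ 2)).
  by apply/funext => t; rewrite /r; field.
have qE : q = fun t => (gauss_smooth s f (U t) - f (U t)) - (s ^+ 2 / 2) * f2 (U t).
  by apply/funext => t; rewrite /q; ring.
have i1 := itgD ifs (itgN if0); have i2 := itgD iA (itgZ (1 / 2) iB).
have i4 := itgD igs (itgN if0); have i5 := itgZ (s ^+ 2 / 2) if2.
have ir : itg P r by rewrite rE; apply: itgD => //; exact: itgN.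
have iq : itg P q by rewrite qE; apply: itgD => //; exact: itgN.
have -> : ex P (fun t => f (U t + G t)) - ex P (fun t => gauss_smooth s f (U t)) =
    ex P r - ex P q.
  have -> : ex P r = ex P (fun t => f (U t + G t)) - ex P (fun t => f (U t))
      - 1 / 2 * (ex P (fun t => f2 (U t)) * s ^+ 2).
    rewrite rE exB// exB// exD//; last exact: itgZ.
    by rewrite exZ// eA eB add0r.
  have -> : ex P q = ex P (fun t => gauss_smooth s f (U t)) - ex P (fun t => f (U t))
      - s ^+ 2 / 2 * ex P (fun t => f2 (U t)).
    by rewrite qE exB// exB// exZ.
  by field.
apply: (le_trans (ler_normB _ _)); rewrite mulrDr; apply: lerD.
  apply: (le_trans (norm_ex_le ir)).
  apply: (@le_trans _ _ (C * ex P (fun t => `|g (X e t)| ^+ 3))); last by rewrite ler_wpM2l.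
  rewrite -exZ//; apply: le_ex; [exact: itg_norm|exact: itgZ|].
  by move=> t; exact: Tb.
apply: (le_trans (norm_ex_le iq)).
rewrite -[leRHS](ex_cst P); apply: le_ex; [exact: itg_norm|exact: itg_cst|].
by move=> t; exact: gauss_smooth_expand tt.
Qed.

Lemma depends_on_sum d (T : measurableType d) (R : realType)
    (P : probability T R) (I : finType) (X : I -> {RV P >-> R}) (s : seq I)
    (g : R -> R) : measurable_fun setT g ->
  depends_on X [set i in s]%SET (fun t => \sum_(i <- s) g (X i t)).
Proof.
move=> mg.
have sub (s' : seq I) : {subset s' <= s} ->
    depends_on X [set i in s]%SET (fun t => \sum_(i <- s') g (X i t)).
  elim: s' => [|i s' IH] ss'.
    have -> : (fun t => \sum_(i <- [::]) g (X i t)) = (fun=> 0).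
      by apply/funext => t; rewrite big_nil.
    exact: depends_on_cst.
  have -> : (fun t => \sum_(j <- i :: s') g (X j t)) =
      (fun t => g (X i t) + \sum_(j <- s') g (X j t)).
    by apply/funext => t; rewrite big_cons.
  apply: depends_onD.
    by apply: depends_on_comp => //; apply: depends_on_coord; rewrite inE ss' ?mem_head.
  by apply: IH => j js'; apply: ss'; rewrite inE js' orbT.
exact: sub.
Qed.

(** The summands are replaced by Gaussians one after the other; the Gaussians already
    introduced stay inside [gauss_smooth] and merge by the semigroup property. *)
Lemma lindeberg d (T : measurableType d) (R : realType)
    (P : probability T R) (I : finType) (X : I -> {RV P >-> R}) (J : seq I)
    (g : R -> R) (M C s m : R) (f f1 f2 : R -> R) :
  mutually_independent X -> uniq J -> (0 < size J)%N ->
  measurable_fun setT g -> 0 < s -> 0 <= C -> taylor_test M C f f1 f2 ->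
  (forall e, itg P (fun t => `|g (X e t)| ^+ 3)) ->
  (forall e, ex P (fun t => `|g (X e t)| ^+ 3) <= m) ->
  (forall e, ex P (fun t => g (X e t)) = 0) ->
  (forall e, ex P (fun t => g (X e t) ^+ 2) = s ^+ 2) ->
  `|ex P (fun t => f (\sum_(i <- J) g (X i t))) -
    gauss_smooth (Num.sqrt ((size J)%:R * s ^+ 2)) f 0|
     <= (size J)%:R * (C * (m + 4 * s ^+ 3)).
Proof.
move=> indep uJ sJ mg s0 C0 tt i3 e3 e1 e2.
have fM := taylor_test_bound tt; have tt' := tt; case: tt' => [[mf mf1 mf2] fb Tb].
have f0M x : 0 <= f x <= M by have [] := fb x.
have step (e : I) (L : seq I) h h1 h2 : e \notin L -> taylor_test M C h h1 h2 ->
   `|ex P (fun t => h (\sum_(i <- e :: L) g (X i t))) -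
     ex P (fun t => gauss_smooth s h (\sum_(i <- L) g (X i t)))| <= C * (m + 4 * s ^+ 3).
  move=> eL th.
  under eq_ex do rewrite big_cons addrC.
  apply: (@replace_summand _ _ _ _ _ X [set i in L]%SET _ _ _ M _ _ _ _ h1 h2) => //.
    by rewrite inE.
  exact: depends_on_sum.
(* after the first exchange, the accumulated Gaussian has a positive deviation [v] *)
have ladder (L : seq I) : uniq L -> forall v, 0 < v ->
   `|ex P (fun t => gauss_smooth v f (\sum_(i <- L) g (X i t))) -
     gauss_smooth (Num.sqrt (v ^+ 2 + (size L)%:R * s ^+ 2)) f 0|
     <= (size L)%:R * (C * (m + 4 * s ^+ 3)).
  elim: L => [_ v v0|e L IH /= /andP[eL uL] v v0].
    under eq_ex do rewrite big_nil.
    by rewrite ex_cst [(size [::])%:R](_ : _ = 0)// !mul0r addr0 sqrtr_sqr (gtr0_norm v0) subrr normr0.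
  have th := gauss_smooth_taylor_test v tt.
  have := step e L _ _ _ eL th.
  under [X in ex P _ - ex P X]eq_fun do rewrite (gauss_smooth_semigroup _ _ _ mf f0M)//.
  pose v' := Num.sqrt (s ^+ 2 + v ^+ 2).
  have v'0 : 0 < v' by rewrite sqrtr_gt0 addr_gt0 ?exprn_gt0.
  have := IH uL _ v'0; rewrite -/v' sqr_sqrtr; last by rewrite addr_ge0 ?sqr_ge0.
  have -> : s ^+ 2 + v ^+ 2 + (size L)%:R * s ^+ 2 = v ^+ 2 + (size L).+1%:R * s ^+ 2.
    by rewrite -natr1; ring.
  move=> h1 h2.
  rewrite [leRHS](_ : _ = C * (m + 4 * s ^+ 3) + (size L)%:R * (C * (m + 4 * s ^+ 3))); last first.
    by rewrite -natr1; ring.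
  by apply: (le_trans (ler_distD (ex P (fun t => gauss_smooth v' f (\sum_(i <- L) g (X i t)))) _ _)); apply: lerD.
case: J uJ sJ => // e L /= /andP[eL uL] _.
have h1 := step e L _ _ _ eL tt; have h2 := ladder L uL s s0.
have E : s ^+ 2 + (size L)%:R * s ^+ 2 = (size L).+1%:R * s ^+ 2.
  by rewrite -natr1; ring.
rewrite -E [leRHS](_ : _ = C * (m + 4 * s ^+ 3) + (size L)%:R * (C * (m + 4 * s ^+ 3))); last first.
  by rewrite -natr1; ring.
by apply: (le_trans (ler_distD (ex P (fun t => gauss_smooth s f (\sum_(i <- L) g (X i t)))) _ _)); apply: lerD.
Qed.

(** * Taylor bounds *)

Lemma is_derive_shift (R : realType) (c u : R) :
  is_derive u (1 : R) (fun v : R => c + v) (1 : R).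
Proof.
by apply: (is_derive_eq (is_deriveD (is_derive_cst c u 1) (is_derive_id u 1))); rewrite add0r.
Qed.

(** Integrating a bound on the derivative, by the mean value theorem. *)
Lemma derive_growth (R : realType) (k : nat) (K x : R) (g g' : R -> R) :
  0 <= K -> g 0 = 0 -> (forall u : R, `|u| <= `|x| -> is_derive u 1 g (g' u)) ->
  (forall u, `|u| <= `|x| -> `|g' u| <= K * `|u| ^+ k) ->
  `|g x| <= K * `|x| ^+ k.+1.
Proof.
move=> K0 g0 dg gK.
have cg (u : R) : `|u| <= `|x| -> {for u, continuous g}.
  move=> ux; apply/differentiable_continuous/derivable1_diffP.
  by have [] := dg u ux.
have key c : `|c| <= `|x| -> g x = g' c * x -> `|g x| <= K * `|x| ^+ k.+1.
  move=> cx ->; rewrite normrM exprSr mulrA ler_wpM2r//.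
  by rewrite (le_trans (gK _ cx))// ler_wpM2l// lerXn2r.
have [x0|x0] := leP 0 x.
- have inx u : u \in `[0, x] -> `|u| <= `|x|.
    by rewrite in_itv/= => /andP[u0 ux]; rewrite !ger0_norm.
  have dI u : u \in `]0, x[ -> is_derive u 1 g (g' u).
    rewrite in_itv/= => /andP[u0 ux]; apply: dg; apply: inx.
    by rewrite in_itv/= !ltW.
  have cI : {within `[0, x], continuous g}.
    by apply: continuous_in_subspaceT => u /set_mem /= /inx; exact: cg.
  have [c c0x E] := MVT_segment x0 dI cI.
  by apply: (key c (inx _ c0x)); move: E; rewrite g0 !subr0.
- have inx u : u \in `[x, 0] -> `|u| <= `|x|.
    rewrite in_itv/= => /andP[u0 ux]; rewrite !ler0_norm//; last exact: ltW.
    by rewrite lerN2.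
  have dI u : u \in `]x, 0[ -> is_derive u 1 g (g' u).
    rewrite in_itv/= => /andP[u0 ux]; apply: dg; apply: inx.
    by rewrite in_itv/= !ltW.
  have cI : {within `[x, 0], continuous g}.
    by apply: continuous_in_subspaceT => u /set_mem /= /inx; exact: cg.
  have [c c0x E] := MVT_segment (ltW x0) dI cI.
  apply: (key c (inx _ c0x)); move: E; rewrite g0 !sub0r => /eqP.
  by rewrite mulrN eqr_opp => /eqP.
Qed.

Lemma taylor3_bound (R : realType) (K : R) (f f1 f2 f3 : R -> R) :
  0 <= K ->
  (forall u : R, is_derive u 1 f (f1 u)) -> (forall u : R, is_derive u 1 f1 (f2 u)) ->
  (forall u : R, is_derive u 1 f2 (f3 u)) -> (forall u, `|f3 u| <= K) ->
  forall y x, `|f (y + x) - f y - f1 y * x - f2 y * (x ^+ 2 / 2)| <= K * `|x| ^+ 3.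
Proof.
move=> K0 d1 d2 d3 f3K y x.
have shift (g g' : R -> R) (u : R) : (forall u : R, is_derive u 1 g (g' u)) ->
    is_derive u 1 (fun v => g (y + v)) (g' (y + u)).
  move=> dg; have d := dg (y + u).
  have dd := is_derive_shift y u.
  have := @is_derive1_comp _ g (fun v => y + v) u _ _ d dd.
  by rewrite mulr1.
have s1 u := shift _ _ u d1; have s2 u := shift _ _ u d2; have s3 u := shift _ _ u d3.
have b2 u : `|f2 (y + u) - f2 y| <= K * `|u| ^+ 1.
  apply: (@derive_growth _ 0 K u (fun u => f2 (y + u) - f2 y) (fun u => f3 (y + u))) => //.
  - by rewrite addr0 subrr.
  - by move=> v _; have := s3 v => dv; apply: is_derive_eq; rewrite subr0.
  - by move=> v _; rewrite expr0 mulr1.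
have b1 u : `|f1 (y + u) - f1 y - f2 y * u| <= K * `|u| ^+ 2.
  apply: (@derive_growth _ 1 K u (fun u => f1 (y + u) - f1 y - f2 y * u)
     (fun u => f2 (y + u) - f2 y)) => //.
  - by rewrite addr0 subrr mulr0 subr0.
  - by move=> v _; have := s2 v => dv; apply: is_derive_eq; rewrite /GRing.scale /=; ring.
apply: (@derive_growth _ 2 K x (fun u => f (y + u) - f y - f1 y * u - f2 y * (u ^+ 2 / 2))
     (fun u => f1 (y + u) - f1 y - f2 y * u)) => //.
- by rewrite addr0 subrr mulr0 expr0n mul0r mulr0 !subr0.
- by move=> v _; have := s1 v => dv; apply: is_derive_eq; rewrite /GRing.scale /=; field.
Qed.

Lemma powR_near1_bound (R : realType) (s u : R) : `|u| <= 1 / 2 ->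
  `|(1 + u) `^ s| <= 2 `^ `|s|.
Proof.
rewrite ler_norml => /andP[u1 u2].
have up : 0 < 1 + u by lra.
rewrite ger0_norm ?powR_ge0// /powR (gt_eqF up) (gt_eqF (ltr0Sn _ 1)).
rewrite ler_expR.
have l2 : `|ln (1 + u)| <= ln 2.
  rewrite ler_norml; apply/andP; split.
    rewrite lerNl -lnV ?posrE// ler_ln ?posrE ?invr_gt0//.
    by rewrite -[leRHS]invrK lef_pV2 ?posrE ?invr_gt0//; lra.
  by rewrite ler_ln ?posrE//; lra.
by rewrite (le_trans (ler_norm _))// normrM ler_wpM2l.
Qed.

Lemma is_derive_powR1 (R : realType) (s u : R) : `|u| <= 1 / 2 ->
  is_derive u 1 (fun v => (1 + v) `^ s) (s * (1 + u) `^ (s - 1)).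
Proof.
rewrite ler_norml => /andP[u1 u2].
have up : 0 < 1 + u by lra.
have d := is_derive1_powR s up.
have dd := is_derive_shift 1 u.
have := @is_derive1_comp _ (fun v => v `^ s) (fun v => 1 + v) u _ _ d dd.
by rewrite mulr1.
Qed.

(** [derive_growth] applied to the three orders in turn, each integrating the previous one. *)
Lemma powR_taylor (R : realType) (s : R) : exists2 K : R, 0 <= K &
  forall u : R, `|u| <= 1 / 2 ->
  [/\ `|(1 + u) `^ s - 1| <= K * `|u|,
      `|(1 + u) `^ s - 1 - s * u| <= K * u ^+ 2 &
      `|(1 + u) `^ s - 1 - s * u - s * (s - 1) / 2 * u ^+ 2| <= K * `|u| ^+ 3].
Proof.
pose K1 (t : R) := `|t| * 2 `^ `|t - 1|.
have first t u : `|u| <= 1 / 2 -> `|(1 + u) `^ t - 1| <= K1 t * `|u| ^+ 1.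
  move=> u2.
  apply: (@derive_growth _ 0 (K1 t) u (fun u => (1 + u) `^ t - 1)
     (fun u => t * (1 + u) `^ (t - 1))) => //.
  - by rewrite mulr_ge0 ?powR_ge0.
  - by rewrite addr0 powR1 subrr.
  - move=> v vu; have v2 := le_trans vu u2; have := is_derive_powR1 t v2 => dv.
    by apply: is_derive_eq; rewrite subr0.
  - move=> v vu; have v2 := le_trans vu u2; rewrite expr0 mulr1 normrM ler_wpM2l//.
    exact: powR_near1_bound.
have second t u : `|u| <= 1 / 2 ->
    `|(1 + u) `^ t - 1 - t * u| <= `|t| * K1 (t - 1) * `|u| ^+ 2.
  move=> u2.
  apply: (@derive_growth _ 1 (`|t| * K1 (t - 1)) u (fun u => (1 + u) `^ t - 1 - t * u)
     (fun u => t * ((1 + u) `^ (t - 1) - 1))) => //.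
  - by rewrite !mulr_ge0 ?powR_ge0.
  - by rewrite addr0 powR1 subrr mulr0 subrr.
  - move=> v vu; have v2 := le_trans vu u2; have := is_derive_powR1 t v2 => dv.
    by apply: is_derive_eq; rewrite /GRing.scale /=; ring.
  - move=> v vu; have v2 := le_trans vu u2; rewrite normrM -mulrA ler_wpM2l//.
    exact: first.
have third t u : `|u| <= 1 / 2 ->
    `|(1 + u) `^ t - 1 - t * u - t * (t - 1) / 2 * u ^+ 2| <=
    `|t| * (`|t - 1| * K1 (t - 1 - 1)) * `|u| ^+ 3.
  move=> u2.
  apply: (@derive_growth _ 2 (`|t| * (`|t - 1| * K1 (t - 1 - 1))) u
     (fun u => (1 + u) `^ t - 1 - t * u - t * (t - 1) / 2 * u ^+ 2)
     (fun u => t * ((1 + u) `^ (t - 1) - 1 - (t - 1) * u))) => //.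
  - by rewrite !mulr_ge0 ?powR_ge0.
  - by rewrite addr0 powR1 subrr mulr0 subrr expr0n mulr0 subrr.
  - move=> v vu; have v2 := le_trans vu u2; have := is_derive_powR1 t v2 => dv.
    by apply: is_derive_eq; rewrite /GRing.scale /=; field.
  - move=> v vu; have v2 := le_trans vu u2; rewrite normrM -mulrA ler_wpM2l//.
    exact: second.
pose a1 := K1 s; pose a2 := `|s| * K1 (s - 1).
pose a3 := `|s| * (`|s - 1| * K1 (s - 1 - 1)).
have [n1 n2 n3] : [/\ 0 <= a1, 0 <= a2 & 0 <= a3].
  by split; rewrite !mulr_ge0 ?powR_ge0.
exists (a1 + a2 + a3); first by rewrite !addr_ge0.
move=> u u2; split.
- apply: (le_trans (first s u u2)); rewrite expr1 ler_wpM2r//; rewrite -/a1; lra.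
- by apply: (le_trans (second s u u2)); rewrite real_normK ?num_real// ler_wpM2r ?sqr_ge0//; rewrite -/a2; lra.
- by apply: (le_trans (third s u u2)); rewrite ler_wpM2r ?exprn_ge0//; rewrite -/a3; lra.
Qed.

(** * A criterion for convergence to a Gaussian law *)

(** A decreasing sigmoid: a smooth stand-in for the indicator of the negative
    half-line, whose derivatives are polynomials in itself. *)
Definition sigmoid (R : realType) (x : R) : R := (1 + expR x)^-1.

Lemma sigmoid_bounds (R : realType) (x : R) : 0 <= sigmoid x <= 1.
Proof.
have e0 := expR_gt0 x.
have p : 0 < 1 + expR x by lra.
by rewrite /sigmoid invr_ge0 ltW//= invf_le1//; lra.
Qed.

Lemma sigmoid_le_inv (R : realType) (x : R) : 0 < x -> sigmoid x <= x^-1.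
Proof.
move=> x0; have e0 := expR_gt0 x; have := expR_ge1Dx x => e1.
by rewrite /sigmoid lef_pV2 ?posrE//; lra.
Qed.

Lemma sigmoidN (R : realType) (x : R) : sigmoid (- x) = 1 - sigmoid x.
Proof.
have e0 := expR_gt0 x.
have p : 1 + expR x != 0 by rewrite gt_eqF// addr_gt0.
rewrite /sigmoid expRN; field.
by rewrite p gt_eqF//= -[X in X + _]mulr1 gt_eqF ?addr_gt0.
Qed.

Lemma sigmoid_nonincreasing (R : realType) (x y : R) : x <= y -> sigmoid y <= sigmoid x.
Proof.
move=> xy; have e0 := expR_gt0 x; have e1 := expR_gt0 y.
by rewrite /sigmoid lef_pV2 ?posrE ?lerD2l ?ler_expR// addr_gt0.
Qed.

Lemma is_derive_sigmoid (R : realType) (x : R) :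
  is_derive x (1 : R) (@sigmoid R) (- (sigmoid x * (1 - sigmoid x))).
Proof.
have e0 := expR_gt0 x; have p : 1 + expR x != 0 by rewrite gt_eqF// addr_gt0.
have d1 : is_derive x (1 : R) (fun u : R => 1 + expR u) (expR x).
  have := @is_derive1_comp _ (fun v : R => 1 + v) expR x _ _
    (is_derive_shift 1 (expR x)) (is_derive_expR x).
  by rewrite mul1r.
have d2 := is_deriveV (f := fun u : R => 1 + expR u) p d1.
apply: (is_derive_eq d2).
by rewrite /sigmoid /GRing.scale /=; field.
Qed.

(** The derivatives of the sigmoid are polynomials in the sigmoid, which lies in [[0, 1]]. *)
Lemma sigmoid_taylor_test (R : realType) (k a : R) : 0 < k ->
  exists f1 f2, taylor_test (1 + k + k ^+ 2) (k ^+ 3)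
    (fun y => sigmoid (k * (y - a))) f1 f2.
Proof.
move=> k0; pose s y := sigmoid (k * (y - a)).
pose f1 y := - k * (s y * (1 - s y)).
pose f2 y := k ^+ 2 * (s y * (1 - s y) * (1 - 2 * s y)).
pose f3 y := - k ^+ 3 * (s y * (1 - s y) * (1 - 6 * s y + 6 * s y ^+ 2)).
have ds (y : R) : is_derive y (1 : R) s (f1 y).
  have dd : is_derive y (1 : R) (fun y : R => k * (y - a)) k.
    have da := is_derive_shift (- a) y.
    have -> : (fun y : R => k * (y - a)) = (fun y : R => k *: (- a + y)).
      by apply/funext => z; rewrite /GRing.scale /= [- a + z]addrC.
    by apply: (is_derive_eq (is_deriveZ k da)); rewrite /GRing.scale /= mulr1.
  have := @is_derive1_comp _ (@sigmoid R) (fun y => k * (y - a)) y _ _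
     (is_derive_sigmoid (k * (y - a))) dd.
  by move=> d; apply: (is_derive_eq d); rewrite /f1 /s; ring.
have d1 (y : R) : is_derive y (1 : R) f1 (f2 y).
  have := ds y => d; rewrite /f1; apply: is_derive_eq.
  by rewrite /GRing.scale /= /f2 /f1; ring.
have d2 (y : R) : is_derive y (1 : R) f2 (f3 y).
  have := ds y => d; rewrite /f2; apply: is_derive_eq.
  by rewrite /GRing.scale /= /f3 /f1; ring.
have s01 y : 0 <= s y <= 1 by exact: sigmoid_bounds.
have mea (g g' : R -> R) : (forall y : R, is_derive y (1 : R) g (g' y)) -> measurable_fun setT g.
  move=> dg; apply: continuous_measurable_fun => y.
  by apply/differentiable_continuous/derivable1_diffP; have [] := dg y.
have k2 : 0 < k ^+ 2 by rewrite exprn_gt0.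
have k3 : 0 < k ^+ 3 by rewrite exprn_gt0.
have q1 y : 0 <= s y * (1 - s y) <= 1 by have := s01 y; nra.
exists f1, f2; split.
- by split; [exact: mea ds|exact: mea d1|exact: mea d2].
- move=> y; have /andP[s0 s1] := s01 y; have /andP[p0 p1] := q1 y; split.
  + by rewrite -/(s y) s0 /=; lra.
  + rewrite /f1 normrM normrN (gtr0_norm k0) (ger0_norm p0); nra.
  + rewrite /f2 normrM (normrM (s y * (1 - s y))) (ger0_norm (ltW k2)) (ger0_norm p0).
    have : `|1 - 2 * s y| <= 1 by rewrite ler_norml; lra.
    move=> n1; have : k ^+ 2 * (s y * (1 - s y) * `|1 - 2 * s y|) <= k ^+ 2.
      by rewrite ler_piMr ?(ltW k2)// mulr_ile1.
    lra.
- apply: (@taylor3_bound R (k ^+ 3) s f1 f2 f3 (ltW k3) ds d1 d2).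
  move=> y; have /andP[s0 s1] := s01 y; have /andP[p0 p1] := q1 y.
  rewrite /f3 normrM normrN (gtr0_norm k3) -[leRHS]mulr1; apply: ler_wpM2l; first exact: ltW.
  have n1 : `|1 - 6 * s y + 6 * s y ^+ 2| <= 1 by rewrite ler_norml; nra.
  by rewrite normrM (ger0_norm p0) mulr_ile1.
Qed.

Lemma ex_indic_normal (R : realType) (s : R) (V : set R) : measurable V ->
  itg (@lebesgue_measure R) (fun x : R => \1_V x * normal_pdf 0 s x) /\
  ex (@lebesgue_measure R) (fun x : R => \1_V x * normal_pdf 0 s x) =
  fine (normal_prob 0 s V).
Proof.
move=> mV; have [i0 _] := ex_normal_pdf s.
have E x : (\1_V x * normal_pdf 0 s x)%:E = ((EFin \o normal_pdf 0 s) \_ V) x.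
  by rewrite patchE indicE /=; case: (x \in V); rewrite ?mul1r ?mul0r.
split.
  apply: (itg_le _ _ i0) => [|x].
    by apply: measurable_funM; [exact: measurable_indic|exact: measurable_normal_pdf].
  rewrite normrM (ger0_norm (normal_pdf_ge0 _ _ _)) ger0_norm// indicE.
  by case: (x \in V); rewrite ?mul1r ?mul0r ?normal_pdf_ge0.
rewrite /ex /Rintegral /normal_prob [in RHS]integral_mkcond; congr fine.
by apply: eq_integral => x _; exact: E.
Qed.

(** Steep sigmoids centred at [x - 2 * dl] and [x + 2 * dl] enclose the indicator of the
    half-line up to [x], with room [dl] for the distance between [W] and [S]; the continuity
    of the limit at [x] then closes the gap. *)
Lemma cvg_normal_of_tests (R : realType) (d : nat -> measure_display)
    (T : forall n, measurableType (d n)) (P : forall n, probability (T n) R)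
    (W S : forall n, T n -> R) (s : R) :
  (forall n, measurable_fun setT (W n)) -> (forall n, measurable_fun setT (S n)) ->
  (forall M C f f1 f2, 0 <= C -> taylor_test M C f f1 f2 ->
     ex (P n) (fun t => f (S n t)) @[n --> \oo] --> gauss_smooth s f 0) ->
  (forall e b : R, 0 < e -> 0 < b ->
     \forall n \near \oo, (P n [set t | (e < `|W n t - S n t|)%R] <= b%:E)%E) ->
  cvg_in_distribution P W (normal_prob 0 s).
Proof.
move=> mW mS tests close; split => // x cx.
pose Q : probability (measurableTypeR R) R := normal_prob 0 s.
pose FQ y := fine (Q [set` `]-oo, y]]).
pose D n y := W n @^-1` [set` `]-oo, y]].
have mD n y : measurable (D n y).
  by rewrite -[D n y]setTI; apply: mW => //; exact: measurable_itv.
pose pn n := fine (P n (D n x)).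
have -> : (fun n => P n (W n @^-1` [set` `]-oo, x]])) = (fun n => (pn n)%:E).
  by apply/funext => n; rewrite /pn fineK ?fin_num_measure.
rewrite [X in _ --> X](_ : _ = (FQ x)%:E); last first.
  by rewrite /FQ fineK ?fin_num_measure//; exact: measurable_itv.
apply: cvg_EFin; first by near=> n.
have cFQ : FQ y @[y --> x] --> FQ x.
  apply: fine_cvg; rewrite fineK; first exact: cx.
  by rewrite fin_num_measure//; exact: measurable_itv.
apply/cvgrPdist_le => e e0.
pose b := e / 10; have b0 : 0 < b by rewrite divr_gt0.
have [dl dl0 Hdl] : exists2 dl, 0 < dl & forall y, `|y - x| <= 3 * dl -> `|FQ y - FQ x| <= b.
  move/cvgrPdist_le : cFQ => /(_ b b0) /nbhs_ballP[r /= r0 Hr].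
  exists (r / 6); first by rewrite divr_gt0.
  move=> y yx; rewrite distrC; apply: Hr.
  by rewrite /ball /= distrC (le_lt_trans yx)//; lra.
(* the slope for which the sigmoid is within [b] of its limits at distance [dl] *)
pose k := (dl * b)^-1; have k0 : 0 < k by rewrite invr_gt0 mulr_gt0.
have kd : k * dl = b^-1 by rewrite /k invfM mulrAC mulVf ?mul1r// gt_eqF.
pose f c y := sigmoid (k * (y - c)).
have f01 c y : 0 <= f c y <= 1 by exact: sigmoid_bounds.
have f_small c y : c + dl <= y -> f c y <= b.
  move=> cy; apply: (@le_trans _ _ (sigmoid (k * dl))).
    by apply: sigmoid_nonincreasing; apply: ler_wpM2l; [exact: ltW|lra].
  by rewrite kd (le_trans (sigmoid_le_inv _)) ?invr_gt0// invrK.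
have f_large c y : y <= c - dl -> 1 - b <= f c y.
  move=> cy; apply: (@le_trans _ _ (sigmoid (- (k * dl)))).
    rewrite sigmoidN lerD2l lerN2 kd (le_trans (sigmoid_le_inv _)) ?invr_gt0//.
    by rewrite invrK.
  by apply: sigmoid_nonincreasing; rewrite -mulrN; apply: ler_wpM2l; [exact: ltW|lra].
have mf c : measurable_fun setT (f c).
  by have [f1 [f2 [[]]]] := sigmoid_taylor_test c k0.
have fM c y : `|f c y| <= 1 by have /andP[u0 u1] := f01 c y; rewrite ger0_norm.
have [i0 e01] := ex_normal_pdf s.
have mI y : measurable ([set` `]-oo, y]] : set R) by exact: measurable_itv.
have Gup c : gauss_smooth s (f c) 0 <= FQ (c + dl) + b.
  have [iI eI] := ex_indic_normal s (mI (c + dl)).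
  rewrite /FQ /Q -eI -[b]mulr1 -e01 -exZ// -exD//; last exact: itgZ.
  apply: le_ex; [exact: itg_gauss_smooth (fM c)|by apply: itgD => //; exact: itgZ|].
  move=> y; rewrite add0r -mulrDl ler_wpM2r ?normal_pdf_ge0//.
  rewrite indicE; have [yI|yI] := boolP (y \in _) => /=.
    by have /andP[_ u1] := f01 c y; rewrite (le_trans u1)// lerDl ltW.
  rewrite add0r; apply: f_small; move: yI; rewrite notin_setE /= in_itv/= => /negP.
  by rewrite -ltNge => /ltW.
have Glo c : FQ (c - dl) - b <= gauss_smooth s (f c) 0.
  have [iI eI] := ex_indic_normal s (mI (c - dl)).
  rewrite /FQ /Q -eI -[b]mulr1 -e01 -exZ// -exB//; last exact: itgZ.
  apply: le_ex; [|exact: itg_gauss_smooth (fM c)|].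
    by apply: itgD => //; apply: itgN; exact: itgZ.
  move=> y; rewrite add0r -mulrBl ler_wpM2r ?normal_pdf_ge0//.
  rewrite indicE; have [yI|yI] := boolP (y \in _) => /=.
    by apply: f_large; move: yI; rewrite inE /= in_itv.
  by have /andP[u0 _] := f01 c y; rewrite (le_trans _ u0)// sub0r oppr_le0 ltW.
have tst c : \forall n \near \oo,
    `|gauss_smooth s (f c) 0 - ex (P n) (fun t => f c (S n t))| <= b.
  have [f1 [f2 tt]] := sigmoid_taylor_test c k0.
  by have /cvgrPdist_le /(_ b b0) := tests _ _ _ _ _ (exprn_ge0 3 (ltW k0)) tt.
have cl := close dl b dl0 b0.
have t1 := tst (x + 2 * dl); have t2 := tst (x - 2 * dl).
apply: filterS (filterI cl (filterI t1 t2)) => n [PE0 [h2u h2l]].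
pose E := [set t | dl < `|W n t - S n t|].
have mE : measurable E.
  rewrite (_ : E = (fun t => `|W n t - S n t|) @^-1` [set` `]dl, +oo[]); last first.
    by apply/seteqP; split => t /=; rewrite in_itv/= andbT.
  rewrite -[X in measurable X]setTI; apply: (_ : measurable_fun setT _) => //.
  by apply: (@measurableT_comp _ _ _ _ _ _ (@Num.norm R R)) => //; exact: measurable_funB.
have PE : fine (P n E) <= b.
  by rewrite -lee_fin fineK ?fin_num_measure.
have ind V : measurable V -> itg (P n) (\1_V : _ -> R) /\ ex (P n) (\1_V : _ -> R) = fine (P n V).
  move=> mV; split; last by rewrite /ex /Rintegral integral_indic// setIT.
  apply: (@itg_bounded _ _ _ _ 1) => [|t]; first exact: measurable_indic.
  by rewrite indicE; case: (_ \in _); rewrite ?normr1 ?normr0 ?ler01.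
have [iD eD] := ind _ (mD n x); have [iE eE] := ind _ mE.
have ifS c : itg (P n) (fun t => f c (S n t)).
  apply: (@itg_bounded _ _ _ _ 1) => //; exact: (measurableT_comp (mf c)).
have sumE (g : T n -> R) : itg (P n) g ->
    itg (P n) (fun t => g t + b + \1_E t) /\
    ex (P n) g + b + fine (P n E) = ex (P n) (fun t => g t + b + \1_E t).
  move=> ig; have ib := itg_cst (P n) b; have igb := itgD ig ib.
  by split; [exact: itgD|rewrite exD// exD// ex_cst eE].
have up : pn n <= FQ (x + 3 * dl) + 4 * b.
  have h1 : pn n <= ex (P n) (fun t => f (x + 2 * dl) (S n t)) + b + fine (P n E).
    have [ig ->] := sumE _ (ifS (x + 2 * dl)).
    rewrite /pn -eD; apply: le_ex => // t.
    have /andP[u0 u1] := f01 (x + 2 * dl) (S n t).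
    rewrite !indicE; have [tE|tE] := boolP (t \in E) => /=.
      by case: (t \in D n x); clear -b0 u0 u1 => /=; lra.
    have [tD|tD] := boolP (t \in D n x) => /=; last by clear -b0 u0 u1; lra.
    move: tD; rewrite inE /D /= in_itv/= => Wx.
    move: tE; rewrite notin_setE /E /= => /negP; rewrite -leNgt ler_norml => /andP[a1 a2].
    have := @f_large (x + 2 * dl) (S n t).
    clear -Wx a1 a2 b0 => /(_ ltac:(lra)); lra.
  move: h2u; rewrite ler_norml => /andP[h2 _].
  have := Gup (x + 2 * dl); rewrite -addrA (_ : 2 * dl + dl = 3 * dl); last ring.
  by clear -h1 h2 PE; lra.
have lo : FQ (x - 3 * dl) - 4 * b <= pn n.
  have h1 : ex (P n) (fun t => f (x - 2 * dl) (S n t)) <= pn n + b + fine (P n E).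
    have [ig] := sumE _ iD; rewrite /pn -eD => ->.
    apply: le_ex => // t.
    have /andP[u0 u1] := f01 (x - 2 * dl) (S n t).
    rewrite !indicE; have [tE|tE] := boolP (t \in E) => /=.
      by case: (t \in D n x); clear -b0 u0 u1 => /=; lra.
    have [tD|tD] := boolP (t \in D n x) => /=; first by clear -b0 u0 u1; lra.
    move: tD; rewrite notin_setE /D /= in_itv/= => /negP; rewrite -ltNge => Wx.
    move: tE; rewrite notin_setE /E /= => /negP; rewrite -leNgt ler_norml => /andP[a1 a2].
    have := @f_small (x - 2 * dl) (S n t).
    clear -Wx a1 a2 b0 => /(_ ltac:(lra)); lra.
  move: h2l; rewrite ler_norml => /andP[_ h2].
  have := Glo (x - 2 * dl); rewrite -addrA (_ : - (2 * dl) - dl = - (3 * dl)); last ring.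
  by clear -h1 h2 PE; lra.
have := Hdl (x + 3 * dl); have := Hdl (x - 3 * dl).
have -> : x + 3 * dl - x = 3 * dl by ring.
have -> : x - 3 * dl - x = - (3 * dl) by ring.
have d30 : 0 <= 3 * dl by rewrite mulr_ge0 ?ltW.
rewrite normrN ger0_norm// => /(_ (lexx _)); rewrite ler_norml => /andP[z1 z2].
move=> /(_ (lexx _)); rewrite ler_norml => /andP[z3 z4].
have e10 : e = 10 * b by rewrite /b; field.
have PE1 : fine (P n E) <= b by [].
rewrite /= ler_norml; move: (pn n) (FQ x) (FQ _) (FQ _) up lo z1 z2 z3 z4 => v0 v1 v2 v3.
by clear -e10 b0; lra.
Unshelve. all: by end_near. Qed.

(** * Matrices with small noise *)

Definition l2 (R : realType) (I : finType) (v : I -> R) : R :=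
  Num.sqrt (\sum_i v i ^+ 2).

Lemma l2_ge0 (R : realType) (I : finType) (v : I -> R) : 0 <= l2 v.
Proof. exact: sqrtr_ge0. Qed.

Lemma l2_sqr (R : realType) (I : finType) (v : I -> R) : l2 v ^+ 2 = \sum_i v i ^+ 2.
Proof. by rewrite sqr_sqrtr// sumr_ge0// => i _; exact: sqr_ge0. Qed.

Lemma l2_le_sqr (R : realType) (I : finType) (v : I -> R) (c : R) : 0 <= c ->
  \sum_i v i ^+ 2 <= c ^+ 2 -> l2 v <= c.
Proof. by move=> c0 vc; rewrite -ler_sqr ?nnegrE ?l2_ge0// l2_sqr. Qed.

Lemma l2_CS (R : realType) (I : finType) (u v : I -> R) :
  `|\sum_i u i * v i| <= l2 u * l2 v.
Proof.
rewrite -ler_sqr ?nnegrE ?mulr_ge0 ?l2_ge0// exprMn !l2_sqr real_normK ?num_real//.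
rewrite -subr_ge0.
have E : \sum_i \sum_j (u i * v j - u j * v i) ^+ 2 =
   2 * ((\sum_i u i ^+ 2) * (\sum_i v i ^+ 2) - (\sum_i u i * v i) ^+ 2).
  have -> : \sum_i \sum_j (u i * v j - u j * v i) ^+ 2 =
    \sum_i (u i ^+ 2 * (\sum_j v j ^+ 2) + (\sum_j u j ^+ 2) * v i ^+ 2
            - 2 * (u i * v i) * (\sum_j u j * v j)).
    apply: eq_bigr => i _; rewrite mulr_suml !mulr_sumr -big_split -sumrB /=.
    by apply: eq_bigr => j _; ring.
  rewrite sumrB big_split /= -!mulr_suml -mulr_sumr -mulr_sumr.
  ring.
suff : 0 <= \sum_i \sum_j (u i * v j - u j * v i) ^+ 2 by rewrite E pmulr_rge0.
by apply: sumr_ge0 => i _; apply: sumr_ge0 => j _; exact: sqr_ge0.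
Qed.

Lemma l2D (R : realType) (I : finType) (u v : I -> R) :
  l2 (fun i => u i + v i) <= l2 u + l2 v.
Proof.
apply: l2_le_sqr; first by rewrite addr_ge0 ?l2_ge0.
have := l2_CS u v; rewrite ler_norml => /andP[_ h].
rewrite sqrrD !l2_sqr.
have -> : \sum_i (u i + v i) ^+ 2 =
    \sum_i u i ^+ 2 + 2 * (\sum_i u i * v i) + \sum_i v i ^+ 2.
  by rewrite mulr_sumr -!big_split /=; apply: eq_bigr => i _; ring.
rewrite mulr2n; lra.
Qed.

Lemma l2Z (R : realType) (I : finType) (c : R) (v : I -> R) :
  l2 (fun i => c * v i) = `|c| * l2 v.
Proof.
rewrite /l2 -sqrtr_sqr -sqrtrM ?sqr_ge0// mulr_sumr.
by congr Num.sqrt; apply: eq_bigr => i _; rewrite exprMn.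
Qed.

Lemma le_l2 (R : realType) (I : finType) (u v : I -> R) :
  (forall i, `|u i| <= `|v i|) -> l2 u <= l2 v.
Proof.
move=> uv; rewrite ler_sqrt; last by rewrite sumr_ge0// => i _; exact: sqr_ge0.
by apply: ler_sum => i _; rewrite -[leLHS]real_normK ?num_real// -[leRHS]real_normK ?num_real// lerXn2r ?nnegrE.
Qed.

Lemma l2_coord (R : realType) (I : finType) (v : I -> R) (i : I) : `|v i| <= l2 v.
Proof.
rewrite -ler_sqr ?nnegrE ?l2_ge0// l2_sqr real_normK ?num_real// (bigD1 i)//=.
by rewrite lerDl sumr_ge0// => j _; exact: sqr_ge0.
Qed.

Lemma l2_cst (R : realType) (n : nat) (c : R) :
  l2 (fun _ : 'I_n => c) = Num.sqrt n%:R * `|c|.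
Proof.
have E : \sum_(i < n) c ^+ 2 = n%:R * c ^+ 2 by rewrite sumr_const card_ord mulr_natl.
by rewrite /l2 E sqrtrM ?ler0n// sqrtr_sqr.
Qed.

Lemma l2_sum (R : realType) (n : nat) (v : 'I_n -> R) :
  `|\sum_i v i| <= Num.sqrt n%:R * l2 v.
Proof.
have := l2_CS (fun _ : 'I_n => 1) v; rewrite l2_cst normr1 mulr1.
by under eq_bigr do rewrite mul1r.
Qed.

(** Divided by [n] times their mean, the entries fluctuate around [1 / n] off the diagonal;
    [E] is the fluctuation. *)
Definition noisy (R : realType) (n : nat) (E : 'I_n -> 'I_n -> R) (i j : 'I_n) : R :=
  (i != j)%:R / n%:R + E i j.

Definition mulfv (R : realType) (n : nat) (A : 'I_n -> 'I_n -> R) (v : 'I_n -> R)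
  (i : 'I_n) : R := \sum_j A i j * v j.

Definition rowsum (R : realType) (n : nat) (A : 'I_n -> 'I_n -> R) (i : 'I_n) : R :=
  \sum_j A i j.

(** At noise level [t] the row sums have size [t], and all second-order quantities built
    from the noise have the size [t ^+ 2] that independence gives them; [th] bounds the
    operator norm of the noise and the largest row sum. *)
Definition small_noise (R : realType) (n : nat) (E : 'I_n -> 'I_n -> R) (t th : R) : Prop :=
  [/\ [/\ forall i j, E i j = E j i, forall i, E i i = 0 & forall i j, 0 <= noisy E i j],
      [/\ \sum_i rowsum E i ^+ 4 <= n%:R * t ^+ 4,
          \sum_i \sum_k (\sum_j E i j * E j k) ^+ 2 <= n%:R * t ^+ 4 &
          \sum_i mulfv E (rowsum E) i ^+ 2 <= n%:R * t ^+ 4],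
      `|\sum_i rowsum E i| <= n%:R * t ^+ 2 &
      [/\ (0 < n)%N, 0 < t <= 1, 1 <= n%:R * t ^+ 2, Num.sqrt n%:R * t ^+ 2 <= th ^+ 2 &
          0 < th <= 1 / 8]].

Lemma mulfv_noisy (R : realType) (n : nat) (E : 'I_n -> 'I_n -> R) (v : 'I_n -> R)
    (i : 'I_n) :
  mulfv (noisy E) v i = (\sum_j v j) / n%:R - v i / n%:R + mulfv E v i.
Proof.
rewrite /mulfv /noisy.
under eq_bigr do rewrite mulrDl; rewrite big_split /=; congr (_ + _).
rewrite (bigD1 i)//= eqxx !mul0r add0r [\sum_j v j](bigD1 i)//= mulrDl addrAC subrr add0r.
rewrite mulr_suml; apply: eq_bigr => j ji; rewrite eq_sym ji /=.
by rewrite mul1r mulrC.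
Qed.

Lemma mulfvD (R : realType) (n : nat) (A : 'I_n -> 'I_n -> R) (u v : 'I_n -> R) i :
  mulfv A (fun j => u j + v j) i = mulfv A u i + mulfv A v i.
Proof. by rewrite /mulfv -big_split /=; apply: eq_bigr => j _; rewrite mulrDr. Qed.

Lemma mulfvZ (R : realType) (n : nat) (A : 'I_n -> 'I_n -> R) (c : R) (v : 'I_n -> R) i :
  mulfv A (fun j => c * v j) i = c * mulfv A v i.
Proof. by rewrite /mulfv mulr_sumr; apply: eq_bigr => j _; rewrite mulrCA. Qed.

Lemma mulfv1 (R : realType) (n : nat) (A : 'I_n -> 'I_n -> R) i :
  mulfv A (fun=> 1) i = rowsum A i.
Proof. by apply: eq_bigr => j _; rewrite mulr1. Qed.

Lemma mulfv_sym (R : realType) (n : nat) (A : 'I_n -> 'I_n -> R) (u v : 'I_n -> R) :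
  (forall i j, A i j = A j i) ->
  \sum_i u i * mulfv A v i = \sum_i mulfv A u i * v i.
Proof.
move=> sA; under eq_bigr do rewrite /mulfv mulr_sumr.
rewrite exchange_big /=; apply: eq_bigr => j _; rewrite /mulfv mulr_suml.
by apply: eq_bigr => i _; rewrite (sA j i); ring.
Qed.

(** The operator norm is bounded through the Frobenius norm of the square, which is
    smaller than the square of the Frobenius norm thanks to cancellations. *)
Lemma l2_mulfv_square (R : realType) (n : nat) (A : 'I_n -> 'I_n -> R) (v : 'I_n -> R) :
  (forall i j, A i j = A j i) ->
  l2 (mulfv A v) ^+ 2 <=
    l2 (fun z : 'I_n * 'I_n => \sum_j A z.1 j * A j z.2) * l2 v ^+ 2.
Proof.
move=> sA; rewrite l2_sqr.
have -> : \sum_i mulfv A v i ^+ 2 =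
    \sum_(z : 'I_n * 'I_n) (\sum_j A z.1 j * A j z.2) * (v z.1 * v z.2).
  rewrite -(pair_bigA _ (fun i k => (\sum_j A i j * A j k) * (v i * v k))) /=.
  under eq_bigr do rewrite expr2.
  rewrite (mulfv_sym _ _ sA); apply: eq_bigr => i _.
  rewrite /mulfv mulrC mulr_sumr.
  have -> : \sum_j v i * (A i j * (\sum_k A j k * v k)) =
      \sum_j \sum_k A i j * A j k * (v i * v k).
    apply: eq_bigr => j _; rewrite mulrA mulr_sumr.
    by apply: eq_bigr => k _; ring.
  rewrite exchange_big /=; apply: eq_bigr => k _.
  by rewrite mulr_suml.
apply: (le_trans (ler_norm _)); apply: (le_trans (l2_CS _ _)).
rewrite ler_wpM2l ?l2_ge0//; apply: l2_le_sqr; first exact: sqr_ge0.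
rewrite -(pair_bigA _ (fun i k => (v i * v k) ^+ 2)) /=.
under eq_bigr do under eq_bigr do rewrite exprMn.
under eq_bigr do rewrite -mulr_sumr.
by rewrite -mulr_suml -l2_sqr expr2.
Qed.

(** * Schur's test with a gain *)

(** A refinement of Young's inequality: the arithmetic mean absorbs [ka] times the squared
    distance of the square roots.  It is the convexity of the exponential at the
    three points [p ln u], [p ln v] and their midpoint. *)
Lemma young_gain (R : realType) (p ka u v : R) : 1 < p -> 0 <= ka ->
  ka <= p^-1 -> ka <= 1 - p^-1 -> 0 <= u -> 0 <= v ->
  u `^ (p - 1) * v <= (1 - p^-1) * u `^ p + p^-1 * v `^ p
                      - ka * (u `^ (p / 2) - v `^ (p / 2)) ^+ 2.
Proof.
move=> p1 k0 k1 k2; have p0 : 0 < p by lra.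
have pn : p != 0 by rewrite gt_eqF.
have pi0 : 0 < p^-1 by rewrite invr_gt0.
have pm : p - 1 != 0 by rewrite gt_eqF//; lra.
have ph : p / 2 != 0 by rewrite gt_eqF// divr_gt0.
rewrite le_eqVlt => /predU1P[<- v0|u0].
  rewrite !powR0// mul0r mulr0 add0r sub0r sqrrN -powR_mulrn ?powR_ge0// -powRrM.
  have -> : p / 2 * 2%:R = p by rewrite divfK.
  by rewrite -mulrBl mulr_ge0 ?powR_ge0//; lra.
rewrite le_eqVlt => /predU1P[<-|v0].
  rewrite !powR0// !mulr0 addr0 subr0 -powR_mulrn ?powR_ge0// -powRrM.
  have -> : p / 2 * 2%:R = p by rewrite divfK.
  by rewrite -mulrBl mulr_ge0 ?powR_ge0//; lra.
rewrite /powR !gt_eqF//.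
set A := ln u; set B := ln v.
have vE : v = expR B by rewrite /B lnK.
set m := (p - 1) * A + B.
have -> : expR ((p - 1) * A) * v = expR m by rewrite vE -expRD.
set z3 := p / 2 * A + p / 2 * B.
have -> : (expR (p / 2 * A) - expR (p / 2 * B)) ^+ 2 =
    expR (p * A) + expR (p * B) - 2 * expR z3.
  have e1 : expR (p * A) = expR (p / 2 * A) ^+ 2 by rewrite expr2 -expRD; congr expR; field.
  have e2 : expR (p * B) = expR (p / 2 * B) ^+ 2 by rewrite expr2 -expRD; congr expR; field.
  by rewrite e1 e2 /z3 expRD; ring.
have tangent z : expR m * (1 + (z - m)) <= expR z.
  have -> : expR z = expR m * expR (z - m) by rewrite -expRD; congr expR; ring.
  by rewrite ler_wpM2l ?expR_ge0// expR_ge1Dx.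
have c1 : 0 <= 1 - p^-1 - ka by lra.
have c2 : 0 <= p^-1 - ka by lra.
have t1 := ler_wpM2l c1 (tangent (p * A)).
have t2 := ler_wpM2l c2 (tangent (p * B)).
have t3 := ler_wpM2l (mulr_ge0 (ler0n _ 2) k0) (tangent z3).
have key : (1 - p^-1 - ka) * (expR m * (1 + (p * A - m))) +
   (p^-1 - ka) * (expR m * (1 + (p * B - m))) +
   2 * ka * (expR m * (1 + (z3 - m))) = expR m.
  by rewrite /z3 /m; field.
have E : (1 - p^-1) * expR (p * A) + p^-1 * expR (p * B) -
   ka * (expR (p * A) + expR (p * B) - 2 * expR z3) =
   (1 - p^-1 - ka) * expR (p * A) + (p^-1 - ka) * expR (p * B) + 2 * ka * expR z3.
  by ring.
rewrite E -[leLHS]key; apply: lerD; [exact: lerD|exact: t3].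
Qed.

(** Schur's test with a positive test vector [x], keeping the gain of Young's
    inequality.  With [Phi] and [Psi] the powers [p / 2] of the ratios of [A y] to [A x]
    and of [y] to [x], the loss is a quadratic form in [Phi i - Psi j]. *)
Lemma schur_gain (R : realType) (n : nat) (A : 'I_n -> 'I_n -> R) (p ka : R)
    (x y w Phi Psi : 'I_n -> R) :
  1 < p -> 0 <= ka -> ka <= p^-1 -> ka <= 1 - p^-1 ->
  (forall i j, 0 <= A i j) -> (forall i, 0 < x i) -> (forall i, 0 < mulfv A x i) ->
  (forall i, 0 <= y i) ->
  (forall i, w i = mulfv A x i `^ (p - 1)) ->
  (forall i, Phi i = (mulfv A y i / mulfv A x i) `^ (p / 2)) ->
  (forall i, Psi i = (y i / x i) `^ (p / 2)) ->
  \sum_i mulfv A y i `^ p <=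
    \sum_j x j * (\sum_i A i j * w i) * Psi j ^+ 2
    - p * ka * \sum_i \sum_j A i j * (w i * x j) * (Phi i - Psi j) ^+ 2.
Proof.
move=> p1 k0 k1 k2 A0 x0 D0 y0 wE PhiE PsiE.
have p0 : 0 < p by lra.
have pn : p != 0 by rewrite gt_eqF.
have Ay0 i : 0 <= mulfv A y i by apply: sumr_ge0 => j _; rewrite mulr_ge0.
have sq (z : R) : (z `^ (p / 2)) ^+ 2 = z `^ p.
  by rewrite -powR_mulrn ?powR_ge0// -powRrM divfK.
pose u i := mulfv A y i / mulfv A x i; pose v j := y j / x j.
have u0 i : 0 <= u i by rewrite divr_ge0 ?Ay0 ?(ltW (D0 i)).
have v0 j : 0 <= v j by rewrite divr_ge0 ?y0 ?(ltW (x0 j)).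
have w0 i : 0 <= w i by rewrite wE powR_ge0.
have AyE i : mulfv A y i = mulfv A x i * u i by rewrite /u mulrC divfK// gt_eqF.
have yE j : y j = x j * v j by rewrite /v mulrC divfK// gt_eqF.
pose N := \sum_i mulfv A y i `^ p.
have wD i : w i * mulfv A x i = mulfv A x i `^ p.
  by rewrite mulrC wE mulr_powRB1// ltW.
have N1 : N = \sum_i \sum_j A i j * (w i * x j) * (u i `^ (p - 1) * v j).
  apply: eq_bigr => i _.
  rewrite -[LHS]mulr_powRB1// {1}/mulfv mulr_suml; apply: eq_bigr => j _.
  rewrite yE AyE powRM ?u0 ?(ltW (D0 i))//; rewrite wE; ring.
have N2 : N = \sum_i \sum_j A i j * (w i * x j) * u i `^ p.
  apply: eq_bigr => i _; rewrite AyE powRM ?u0 ?(ltW (D0 i))// -wD.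
  rewrite {1}/mulfv mulr_sumr mulr_suml.
  by apply: eq_bigr => j _; ring.
have N3 : \sum_j x j * (\sum_i A i j * w i) * Psi j ^+ 2 =
    \sum_i \sum_j A i j * (w i * x j) * v j `^ p.
  rewrite [RHS]exchange_big /=; apply: eq_bigr => j _.
  rewrite PsiE sq -/(v j) mulr_sumr mulr_suml.
  by apply: eq_bigr => i _; ring.
set G := \sum_i \sum_j A i j * (w i * x j) * (Phi i - Psi j) ^+ 2.
rewrite N3 -/N; set V := \sum_i \sum_j A i j * (w i * x j) * v j `^ p.
have main : N <= (1 - p^-1) * N + p^-1 * V - ka * G.
  rewrite {1}N1 {1}N2 /V /G !mulr_sumr -big_split -sumrB /=.
  apply: ler_sum => i _; rewrite !mulr_sumr -big_split -sumrB /=.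
  apply: ler_sum => j _.
  have c0 : 0 <= A i j * (w i * x j).
    by apply: mulr_ge0 => //; apply: mulr_ge0 => //; exact: ltW.
  have := ler_wpM2l c0 (young_gain p1 k0 k1 k2 (u0 i) (v0 j)).
  rewrite -[u i `^ (p / 2)]PhiE -[v j `^ (p / 2)]PsiE; move: (A i j * (w i * x j)) => c; clear => h.
  apply: (le_trans h); rewrite le_eqVlt; apply/orP; left; apply/eqP; ring.
have {}main : p^-1 * N <= p^-1 * V - ka * G.
  move: main; clear; move: (p^-1) => q; lra.
rewrite -(ler_pM2l (_ : 0 < p^-1)) ?invr_gt0// (le_trans main)//.
by rewrite le_eqVlt; apply/orP; left; apply/eqP; field.
Qed.

(** * Perturbation of the optimal vector *)

(** The Euclidean size of a vector of [n] entries of size [t ^+ 2]: the second order in [l2]. *)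
Definition tau (R : realType) (n : nat) (t : R) : R := Num.sqrt n%:R * t ^+ 2.

Lemma small_noise_scales (R : realType) (n : nat) (E : 'I_n -> 'I_n -> R) (t th : R) :
  small_noise E t th ->
  [/\ [/\ 0 < (n%:R : R), 0 < Num.sqrt (n%:R : R), 0 < t <= 1 & 0 < th <= 1 / 8],
      [/\ 0 < tau n t, tau n t <= th ^+ 2, tau n t <= th & tau n t ^+ 2 = n%:R * t ^+ 4],
      [/\ Num.sqrt n%:R / n%:R <= tau n t, n%:R^-1 <= t ^+ 2, n%:R^-1 <= th & t ^+ 2 <= tau n t] &
      Num.sqrt n%:R * Num.sqrt n%:R = (n%:R : R) ].
Proof.
move=> [_ _ _ [n0 /andP[t0 t1] nt ts /andP[th0 th1]]].
have N0 : 0 < (n%:R : R) by rewrite ltr0n.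
have s0 : 0 < Num.sqrt (n%:R : R) by rewrite sqrtr_gt0.
have ss : Num.sqrt n%:R * Num.sqrt n%:R = (n%:R : R) by rewrite -expr2 sqr_sqrtr// ltW.
have s1 : 1 <= Num.sqrt (n%:R : R) by rewrite -[leLHS]sqrtr1 ler_sqrt ?ler1n ?ler0n ?ltr0n.
have t20 : 0 < t ^+ 2 by rewrite exprn_gt0.
have thth : th ^+ 2 <= th by rewrite expr2 ler_piMr ?(ltW th0)//; lra.
have ni : n%:R^-1 <= t ^+ 2 by rewrite -[leLHS]mul1r ler_pdivrMr// mulrC.
have tt : t ^+ 2 <= tau n t by rewrite /tau ler_peMl// ltW.
split => //.
- by split => //; rewrite ?t0 ?th0.
- split => //; [by rewrite mulr_gt0|exact: le_trans ts thth|].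
  by rewrite /tau exprMn expr2 ss -exprM.
- split => //; last by rewrite (le_trans ni)// (le_trans tt)// (le_trans ts).
  rewrite /tau ler_wpM2l ?(ltW s0)//.
Qed.

Lemma rowsum_noisy (R : realType) (n : nat) (E : 'I_n -> 'I_n -> R) (i : 'I_n) :
  (0 < n)%N -> rowsum (noisy E) i = 1 - n%:R^-1 + rowsum E i.
Proof.
move=> n0; rewrite -mulfv1 mulfv_noisy mulfv1 sumr_const card_ord mul1r; congr (_ - _ + _).
by rewrite divff// pnatr_eq0 -lt0n.
Qed.

Lemma noisy_sym (R : realType) (n : nat) (E : 'I_n -> 'I_n -> R) :
  (forall i j, E i j = E j i) -> forall i j, noisy E i j = noisy E j i.
Proof. by move=> sE i j; rewrite /noisy sE eq_sym. Qed.

(** The Frobenius norm of the square of [E] is at most [tau n t], hence at most [th ^+ 2]. *)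
Lemma small_noise_op (R : realType) (n : nat) (E : 'I_n -> 'I_n -> R) (t th : R)
    (v : 'I_n -> R) : small_noise E t th -> l2 (mulfv E v) <= th * l2 v.
Proof.
move=> sn; have [[N0 s0 /andP[t0 t1] /andP[th0 th1]] [u0 u2 u1 uE] _ _] := small_noise_scales sn.
case: sn => [[sE _ _] [_ H2 _] _ _].
rewrite -ler_sqr ?nnegrE ?l2_ge0 ?mulr_ge0 ?l2_ge0 ?(ltW th0)// exprMn.
apply: (le_trans (l2_mulfv_square v sE)); rewrite ler_wpM2r ?sqr_ge0//.
apply: (le_trans _ u2); apply: l2_le_sqr; first exact: ltW.
by rewrite uE; move: H2; rewrite pair_bigA.
Qed.

Lemma small_noise_rowsum (R : realType) (n : nat) (E : 'I_n -> 'I_n -> R) (t th : R) :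
  small_noise E t th ->
  [/\ l2 (fun i => rowsum E i ^+ 2) <= tau n t, forall i, `|rowsum E i| <= th,
      l2 (rowsum E) <= Num.sqrt n%:R * t & l2 (mulfv (noisy E) (rowsum E)) <= 3 * tau n t].
Proof.
move=> sn; have [[N0 s0 /andP[t0 t1] /andP[th0 th1]] [u0 u2 u1 uE] [r1 r2 r3 r4] ss] := small_noise_scales sn.
case: sn => [[sE _ _] [H1 _ H3] H4 _].
have q4 : l2 (fun i => rowsum E i ^+ 2) <= tau n t.
  apply: l2_le_sqr; [exact: ltW|]; rewrite uE (le_trans _ H1)//.
  by rewrite le_eqVlt (eq_bigr (fun i => rowsum E i ^+ 4)) ?eqxx// => i _; rewrite -exprM.
have q2 : l2 (rowsum E) <= Num.sqrt n%:R * t.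
  apply: l2_le_sqr; first by rewrite mulr_ge0 ?ltW.
  have := l2_sum (fun i => rowsum E i ^+ 2); rewrite ger0_norm; last first.
    by rewrite sumr_ge0// => i _; exact: sqr_ge0.
  move=> h; apply: (le_trans h); rewrite exprMn expr2 -mulrA; apply: ler_wpM2l; first exact: ltW.
  exact: q4.
split => //.
  move=> i; rewrite -ler_sqr ?nnegrE// ?(ltW th0)// -normrX.
  by apply: (le_trans (l2_coord (fun i => rowsum E i ^+ 2) i)); exact: le_trans q4 u2.
have -> : mulfv (noisy E) (rowsum E) = (fun i => ((\sum_j rowsum E j) / n%:R +
    (- n%:R^-1) * rowsum E i) + mulfv E (rowsum E) i).
  by apply/funext => i; rewrite mulfv_noisy; congr (_ + _ + _); rewrite mulNr mulrC.
apply: (le_trans (l2D _ _)); have -> : 3 * tau n t = (tau n t + tau n t) + tau n t by ring.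
apply: lerD; last first.
  by apply: l2_le_sqr; [exact: ltW|rewrite uE].
apply: (le_trans (l2D _ _)); apply: lerD.
  rewrite l2_cst normrM /tau (ger0_norm (_ : 0 <= n%:R^-1)) ?invr_ge0 ?ler0n//.
  by apply: ler_wpM2l; [exact: ltW|rewrite ler_pdivrMr// mulrC].
rewrite l2Z normrN (ger0_norm (_ : 0 <= n%:R^-1)) ?invr_ge0 ?ler0n//.
apply: (@le_trans _ _ (n%:R^-1 * (Num.sqrt n%:R * t))).
  by rewrite ler_wpM2l ?invr_ge0 ?ler0n.
apply: (le_trans _ r1); rewrite mulrA [n%:R^-1 * _]mulrC.
by rewrite ler_piMr// divr_ge0 ?ltW.
Qed.

Lemma small_noise_noisy_op (R : realType) (n : nat) (E : 'I_n -> 'I_n -> R) (t th : R)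
    (v : 'I_n -> R) : small_noise E t th -> l2 (mulfv (noisy E) v) <= 3 * l2 v.
Proof.
move=> sn; have [[N0 s0 /andP[t0 t1] /andP[th0 th1]] [u0 u2 u1 uE] [r1 r2 r3 r4] ss] := small_noise_scales sn.
have -> : mulfv (noisy E) v = (fun i => ((\sum_j v j) / n%:R + (- n%:R^-1) * v i) + mulfv E v i).
  by apply/funext => i; rewrite mulfv_noisy; congr (_ + _ + _); rewrite mulNr mulrC.
have n1 : 0 <= (n%:R : R)^-1 by rewrite invr_ge0 ler0n.
apply: (le_trans (l2D _ _)); have -> : 3 * l2 v = (l2 v + l2 v) + l2 v by ring.
apply: lerD; last first.
  by apply: (le_trans (small_noise_op v sn)); rewrite ler_piMl ?l2_ge0//; lra.
apply: (le_trans (l2D _ _)); apply: lerD.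
  rewrite l2_cst normrM (ger0_norm n1) mulrA ler_pdivrMr//.
  have := ler_wpM2l (ltW s0) (l2_sum v); rewrite mulrA ss.
  by rewrite [l2 v * _]mulrC.
by rewrite l2Z normrN (ger0_norm n1) ler_piMl ?l2_ge0//; lra.
Qed.

Lemma noise_sup (R : realType) (n : nat) (E : 'I_n -> 'I_n -> R) (t th c L : R)
    (v : 'I_n -> R) : 0 <= L -> small_noise E t th ->
  l2 (fun i => v i - c * rowsum E i) <= L * tau n t ->
  forall i, `|v i| <= (`|c| + L) * th.
Proof.
move=> L0 sn vL i.
have [_ [_ _ u1 _] _ _] := small_noise_scales sn.
have [_ e1 _ _] := small_noise_rowsum sn.
have -> : v i = c * rowsum E i + (v i - c * rowsum E i) by ring.
apply: (le_trans (ler_normD _ _)); rewrite mulrDl; apply: lerD.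
  by rewrite normrM ler_wpM2l.
apply: (le_trans (l2_coord (fun i => v i - c * rowsum E i) i)).
by apply: (le_trans vL); rewrite ler_wpM2l.
Qed.

Lemma l2_sqr_noise (R : realType) (n : nat) (E : 'I_n -> 'I_n -> R) (t th c L : R)
    (v : 'I_n -> R) : 0 <= L -> small_noise E t th ->
  l2 (fun i => v i - c * rowsum E i) <= L * tau n t ->
  l2 (fun i => v i ^+ 2) <= (2 * c ^+ 2 + 2 * L ^+ 2) * tau n t.
Proof.
move=> L0 sn vL.
have [[_ _ _ /andP[th0 th1]] [u0 _ u1 _] _ _] := small_noise_scales sn.
have [e2 _ _ _] := small_noise_rowsum sn.
pose rho i := v i - c * rowsum E i; rewrite -/rho in vL.
have c0 : 0 <= 2 * c ^+ 2 by rewrite mulr_ge0 ?sqr_ge0.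
apply: (@le_trans _ _ (l2 (fun i => 2 * c ^+ 2 * rowsum E i ^+ 2 + 2 * rho i ^+ 2))).
  have q2 z : 0 <= 2 * z ^+ 2 :> R by apply: mulr_ge0 => //; exact: sqr_ge0.
  apply: le_l2 => i; rewrite [leLHS]ger0_norm ?sqr_ge0// [leRHS]ger0_norm; last first.
    by apply: addr_ge0 => //; apply: mulr_ge0 => //; exact: sqr_ge0.
  have -> : v i = c * rowsum E i + rho i by rewrite /rho; ring.
  rewrite -subr_ge0.
  have -> : 2 * c ^+ 2 * rowsum E i ^+ 2 + 2 * rho i ^+ 2 - (c * rowsum E i + rho i) ^+ 2
    = (c * rowsum E i - rho i) ^+ 2 by ring.
  exact: sqr_ge0.
apply: (le_trans (l2D _ _)).
have -> : (2 * c ^+ 2 + 2 * L ^+ 2) * tau n t =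
  2 * c ^+ 2 * tau n t + 2 * (L ^+ 2 * tau n t) by ring.
apply: lerD; first by rewrite l2Z ger0_norm// ler_wpM2l.
rewrite l2Z (ger0_norm (ler0n _ 2)); apply: ler_wpM2l => //.
have Lt0 : 0 <= L * tau n t by rewrite mulr_ge0// ltW.
apply: (@le_trans _ _ (l2 (fun i => L * tau n t * rho i))).
  apply: le_l2 => i; rewrite expr2 normrM (normrM (L * tau n t)) (ger0_norm Lt0) ler_wpM2r//.
  by apply: (le_trans (l2_coord rho i)).
rewrite l2Z (ger0_norm Lt0).
apply: (le_trans (ler_wpM2l Lt0 vL)).
rewrite mulrACA -expr2 ler_wpM2l ?sqr_ge0// ler_piMr ?(ltW u0)//; lra.
Qed.

(** To first order a power multiplies the noise by its exponent. *)
Lemma powR_noise (R : realType) (s c L : R) : 0 <= L -> exists2 K : R, 0 <= K &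
  forall n (E : 'I_n -> 'I_n -> R) (t th : R) (v : 'I_n -> R),
  small_noise E t th -> l2 (fun i => v i - c * rowsum E i) <= L * tau n t ->
  (forall i, `|v i| <= 1 / 2) ->
  l2 (fun i => (1 + v i) `^ s - (1 + s * c * rowsum E i)) <= K * tau n t.
Proof.
move=> L0; have [Ks Ks0 HK] := powR_taylor s.
exists (Ks * (2 * c ^+ 2 + 2 * L ^+ 2) + `|s| * L).
  have q1 := sqr_ge0 c; have q2 := sqr_ge0 L.
  by apply: addr_ge0; apply: mulr_ge0 => //; lra.
move=> n E t th v sn vL v2.
have vsq := l2_sqr_noise L0 sn vL.
have -> : (fun i => (1 + v i) `^ s - (1 + s * c * rowsum E i)) =
   (fun i => ((1 + v i) `^ s - 1 - s * v i) + s * (v i - c * rowsum E i)).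
  by apply/funext => i; ring.
apply: (le_trans (l2D _ _)); rewrite mulrDl; apply: lerD; last first.
  by rewrite l2Z -mulrA ler_wpM2l.
apply: (@le_trans _ _ (l2 (fun i => Ks * v i ^+ 2))).
  apply: le_l2 => i; rewrite [leRHS]ger0_norm; last first.
    by apply: mulr_ge0 => //; exact: sqr_ge0.
  by have [_ ] := HK _ (v2 i).
by rewrite l2Z (ger0_norm Ks0) -mulrA ler_wpM2l.
Qed.

(** The first-order approximation of the vector that attains the norm. *)
Definition test_vec (R : realType) (n : nat) (r : R) (E : 'I_n -> 'I_n -> R) (i : 'I_n) : R :=
  1 + (r - 1)^-1 * rowsum E i.

(** One step of the nonlinear power iteration moves [test_vec] only by a
    second-order amount: [b = B ((B x) `^ (p - 1))] agrees with [x `^ (r - 1)], both being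
    [1 + eps] to first order. *)
Lemma test_vec_expansion (R : realType) (p r : R) : 1 < p -> 1 < r ->
  exists K th0 : R, [/\ 0 <= K, 0 < th0 &
  forall n (E : 'I_n -> 'I_n -> R) (t th : R), small_noise E t th -> th <= th0 ->
  let x := test_vec r E in let D := mulfv (noisy E) x in
  [/\ forall i, 1 / 2 <= x i <= 3 / 2, forall i, 1 / 2 <= D i <= 3 / 2,
      l2 (fun i => D i - (1 + rowsum E i)) <= K * tau n t &
      l2 (fun i => mulfv (noisy E) (fun j => D j `^ (p - 1)) i - x i `^ (r - 1))
        <= K * tau n t]].
Proof.
move=> p1 r1; pose a := (r - 1)^-1.
have a0 : 0 < a by rewrite invr_gt0; lra.
have ra : (r - 1) * a = 1 by rewrite /a mulfV// gt_eqF//; lra.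
pose L1 := 1 + a * 3.
have L10 : 0 <= L1 by rewrite /L1; lra.
have [K2 K20 HK2] := powR_noise (p - 1) 1 L10.
have [K4 K40 HK4] := powR_noise (r - 1) a (lexx 0).
pose K3 := 1 + (p - 1) * 3 + 3 * K2.
have K30 : 0 <= K3 by rewrite /K3; lra.
pose th0 := (2 * (1 + L1 + a))^-1.
have d0 : 0 < 2 * (1 + L1 + a) by lra.
exists (L1 + K3 + K4), th0; split; [lra|by rewrite invr_gt0|].
move=> n E t th sn thth x D.
have [[N0 s0 /andP[t0 t1] /andP[th0' th1]] [u0 u2 u1 uE] [r1' r2 r3 r4] ss] := small_noise_scales sn.
have [e2 esup e1 Be] := small_noise_rowsum sn.
have n0 : (0 < n)%N by case: sn => _ _ _ [].
have thb c : 0 <= c -> c <= 1 + L1 + a -> c * th <= 1 / 2.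
  move=> c0 cL; apply: (@le_trans _ _ ((1 + L1 + a) * th0)).
    by rewrite ler_pM// ltW.
  rewrite /th0 invfM mulrC -mulrA mulVf ?mulr1 ?div1r// gt_eqF//; lra.
have cst_n : l2 (fun _ : 'I_n => - (n%:R : R)^-1) <= tau n t.
  by rewrite l2_cst normrN ger0_norm ?invr_ge0 ?ler0n.
have DE i : D i = 1 + rowsum E i + (- n%:R^-1 + a * mulfv (noisy E) (rowsum E) i).
  rewrite /D /x /test_vec mulfvD mulfv1 rowsum_noisy// mulfvZ -/a; ring.
have l2D1 : l2 (fun i => D i - (1 + rowsum E i)) <= L1 * tau n t.
  have -> : (fun i => D i - (1 + rowsum E i)) =
    (fun i => - n%:R^-1 + a * mulfv (noisy E) (rowsum E) i).
    by apply/funext => i; rewrite DE; ring.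
  apply: (le_trans (l2D _ _)); rewrite /L1 mulrDl mul1r; apply: lerD => //.
  by rewrite l2Z (gtr0_norm a0) -mulrA ler_wpM2l// ltW.
pose g i := D i - 1.
have gL : l2 (fun i => g i - 1 * rowsum E i) <= L1 * tau n t.
  apply: le_trans l2D1; apply: le_l2 => i; rewrite le_eqVlt; apply/orP; left.
  by apply/eqP; congr (`|_|); rewrite /g; ring.
have g2 i : `|g i| <= 1 / 2.
  apply: (le_trans (noise_sup L10 sn gL i)); rewrite normr1; apply: thb; lra.
have xL : l2 (fun i => a * rowsum E i - a * rowsum E i) <= 0 * tau n t.
  rewrite mul0r; apply: l2_le_sqr => //; rewrite big1 ?expr0n//.
  by move=> i _; rewrite subrr expr0n.
have x2 i : `|a * rowsum E i| <= 1 / 2.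
  apply: (le_trans (noise_sup (lexx 0) sn xL i)); rewrite (gtr0_norm a0); apply: thb; lra.
split.
- by move=> i; have := x2 i; rewrite /x /test_vec -/a ler_norml; lra.
- by move=> i; have := g2 i; rewrite /g ler_norml; lra.
- by apply: (le_trans l2D1); rewrite ler_wpM2r ?(ltW u0)//; lra.
have w2 := HK2 n E t th g sn gL g2.
have x4 := HK4 n E t th _ sn xL x2.
pose rho2 i := (1 + g i) `^ (p - 1) - (1 + (p - 1) * 1 * rowsum E i).
pose rho4 i := (1 + a * rowsum E i) `^ (r - 1) - (1 + (r - 1) * a * rowsum E i).
have bE i : mulfv (noisy E) (fun j => D j `^ (p - 1)) i =
   1 + rowsum E i + ((- n%:R^-1 + (p - 1) * mulfv (noisy E) (rowsum E) i) + mulfv (noisy E) rho2 i).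
  have -> : (fun j => D j `^ (p - 1)) = (fun j => (1 + (p - 1) * rowsum E j) + rho2 j).
    by apply/funext => j; rewrite /rho2 /g [1 + (D j - 1)]addrC subrK; ring.
  by rewrite mulfvD mulfvD mulfv1 mulfvZ rowsum_noisy//; ring.
have -> : (fun i => mulfv (noisy E) (fun j => D j `^ (p - 1)) i - x i `^ (r - 1)) =
  (fun i => ((- n%:R^-1 + (p - 1) * mulfv (noisy E) (rowsum E) i) + mulfv (noisy E) rho2 i)
            + (-1) * rho4 i).
  by apply/funext => i; rewrite bE /rho4 /x /test_vec -/a ra; ring.
apply: (le_trans (l2D _ _)); rewrite l2Z normrN normr1 mul1r.
apply: (@le_trans _ _ (K3 * tau n t + K4 * tau n t)); last first.
  by rewrite -mulrDl ler_wpM2r ?(ltW u0)//; lra.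
apply: lerD => //; apply: (le_trans (l2D _ _)); rewrite /K3 mulrDl; apply: lerD.
  apply: (le_trans (l2D _ _)); rewrite mulrDl mul1r; apply: lerD => //.
  rewrite l2Z (ger0_norm (_ : 0 <= p - 1)); last lra.
  by rewrite -mulrA ler_wpM2l//; lra.
apply: (le_trans (small_noise_noisy_op _ sn)).
by rewrite -mulrA ler_wpM2l.
Qed.

(** Because the off-diagonal weights are nearly uniform, the quadratic loss of
    Schur's test controls the deviation of [Psi] from its mean. *)
Lemma noisy_coercive (R : realType) (n : nat) (E : 'I_n -> 'I_n -> R) (t th : R)
    (Phi Psi : 'I_n -> R) (m : R) : small_noise E t th ->
  m = (\sum_j Psi j) / n%:R ->
  l2 (fun j => Psi j - m) ^+ 2 / 2 <=
  \sum_i \sum_j noisy E i j * (Phi i - Psi j) ^+ 2.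
Proof.
move=> sn mE.
have [[N0 s0 /andP[t0 t1] /andP[th0' th1]] [u0 u2 u1 uE] [r1' r2 r3 r4] ss] := small_noise_scales sn.
have [e2 esup e1 Be] := small_noise_rowsum sn.
have n0 : (0 < n)%N by case: sn => _ _ _ [].
have sE : forall i j, E i j = E j i by case: sn => [[]].
pose u i := Phi i - m; pose v j := Psi j - m.
have v0 : \sum_j v j = 0.
  rewrite sumrB sumr_const card_ord mE -[_ *+ n]mulr_natr divfK ?subrr// gt_eqF//.
have -> : \sum_i \sum_j noisy E i j * (Phi i - Psi j) ^+ 2 =
   \sum_i rowsum (noisy E) i * u i ^+ 2 + \sum_j rowsum (noisy E) j * v j ^+ 2
   - 2 * \sum_i u i * mulfv (noisy E) v i.
  have -> : \sum_j rowsum (noisy E) j * v j ^+ 2 = \sum_i \sum_j noisy E i j * v j ^+ 2.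
    rewrite exchange_big /=; apply: eq_bigr => j _; rewrite /rowsum mulr_suml.
    by apply: eq_bigr => i _; rewrite (noisy_sym sE).
  rewrite mulr_sumr -big_split -sumrB /=; apply: eq_bigr => i _.
  rewrite /rowsum /mulfv mulr_suml !mulr_sumr -big_split -sumrB /=.
  by apply: eq_bigr => j _; rewrite /u /v; ring.
have rs i : 1 - 2 * th <= rowsum (noisy E) i.
  by rewrite rowsum_noisy//; have := esup i; rewrite ler_norml; lra.
have sq (z : 'I_n -> R) : (1 - 2 * th) * l2 z ^+ 2 <= \sum_i rowsum (noisy E) i * z i ^+ 2.
  by rewrite l2_sqr mulr_sumr; apply: ler_sum => i _; rewrite ler_wpM2r ?sqr_ge0.
have Bv : l2 (mulfv (noisy E) v) <= 2 * th * l2 v.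
  have -> : mulfv (noisy E) v = (fun i => (- n%:R^-1) * v i + mulfv E v i).
    by apply/funext => i; rewrite mulfv_noisy v0 mul0r sub0r mulNr mulrC.
  apply: (le_trans (l2D _ _)); rewrite [2 * th]mulr_natl mulr2n mulrDl; apply: lerD; last first.
    exact: small_noise_op sn.
  rewrite l2Z normrN (ger0_norm (_ : 0 <= n%:R^-1)) ?invr_ge0 ?ler0n//.
  by rewrite ler_wpM2r ?l2_ge0.
have cross : \sum_i u i * mulfv (noisy E) v i <= l2 u * (2 * th * l2 v).
  have := l2_CS u (mulfv (noisy E) v); rewrite ler_norml => /andP[_ h].
  by apply: (le_trans h); rewrite ler_wpM2l ?l2_ge0.
have := sq u; have := sq v; rewrite -/v; move: cross (l2_ge0 u) (l2_ge0 v).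
move: (l2 u) (l2 v) (\sum_i u i * _) (\sum_i _ * u i ^+ 2) (\sum_i _ * v i ^+ 2).
clear -th0' th1 => U V c SU SV hc U0 V0 hV hU.
have h1 : 0 <= th * (U - V) ^+ 2 by rewrite mulr_ge0 ?sqr_ge0 ?ltW.
have h2 : 0 <= (1 - 8 * th) * V ^+ 2 by rewrite mulr_ge0 ?sqr_ge0//; lra.
have h3 : 0 <= (1 - 8 * th) * U ^+ 2 by rewrite mulr_ge0 ?sqr_ge0//; lra.
have h4 : 0 <= U ^+ 2 by exact: sqr_ge0.
nra.
Qed.

(** Weighted arithmetic-geometric inequality; in sums it is Hoelder's inequality, and the
    place where [p <= r] is needed. *)
Lemma young_powers (R : realType) (p r x y : R) : 1 < p -> p <= r -> 0 < x -> 0 <= y ->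
  x `^ r * (y / x) `^ p <= (1 - p / r) * x `^ r + p / r * y `^ r.
Proof.
move=> p1 pr x0 y0; have p0 : 0 < p by lra.
have r0 : 0 < r by lra.
have pn : p != 0 by rewrite gt_eqF.
have rn : r != 0 by rewrite gt_eqF.
have E : x `^ r * (y / x) `^ p = x `^ (r - p) * y `^ p.
  rewrite [(y / x) `^ p]powRM ?invr_ge0 ?(ltW x0)// -[x^-1]powR_inv1 ?(ltW x0)// -powRrM.
  rewrite mulrCA [RHS]mulrC; congr (_ * _); rewrite -powRD; last first.
    by apply/implyP => _; rewrite gt_eqF.
  by congr (_ `^ _); ring.
rewrite E; move: pr; rewrite le_eqVlt => /predU1P[<-|pr].
  by rewrite subrr powRr0 divff// subrr mul0r add0r mul1r.
pose P := r / p.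
have P1 : 1 < P by rewrite ltr_pdivlMr// mul1r.
have Pi : P^-1 = p / r by rewrite /P invf_div.
have q0 : 0 <= p / r by rewrite divr_ge0 ?ltW.
have q1 : 0 <= 1 - p / r by rewrite subr_ge0 ler_pdivrMr// mul1r ltW.
have := @young_gain _ P 0 (x `^ p) (y `^ p) P1 (lexx 0).
rewrite Pi => /(_ q0 q1 (powR_ge0 _ _) (powR_ge0 _ _)).
rewrite mul0r subr0 -!powRrM.
have -> : p * P = r by rewrite /P mulrC divfK.
by have -> : p * (P - 1) = r - p by rewrite /P; field.
Qed.

(** Schur's test with the weight [D `^ (p - 1)] would be exact if [test_vec] were a critical
    point. Its residual [e] has mean zero, so it only sees the deviation [v] of [Psi] from its
    mean, and the quadratic loss in [v] absorbs the linear term at the price [tau n t ^+ 2]. *)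
Lemma noisy_upper (R : realType) (p r : R) : 1 < p -> p <= r ->
  exists K th0 : R, [/\ 0 <= K, 0 < th0 &
  forall n (E : 'I_n -> 'I_n -> R) (t th : R), small_noise E t th -> th <= th0 ->
  forall y : 'I_n -> R, (forall i, 0 <= y i) ->
  \sum_i y i `^ r <= \sum_i test_vec r E i `^ r ->
  \sum_i mulfv (noisy E) y i `^ p <=
    \sum_i mulfv (noisy E) (test_vec r E) i `^ p + K * tau n t ^+ 2].
Proof.
move=> p1 pr; have p0 : 0 < p by lra.
have r1 : 1 < r by lra.
have r0 : 0 < r by lra.
have [K1 [thA [K10 thA0 HA]]] := test_vec_expansion p1 r1.
pose ka := Num.min p^-1 (1 - p^-1).
have pi0 : 0 < p^-1 by rewrite invr_gt0.
have pi1 : p^-1 < 1 by rewrite invf_lt1.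
have ka0 : 0 < ka by rewrite lt_min pi0 subr_gt0.
pose c0 := (1 / 2) `^ (p - 1) * (1 / 2) : R.
have c00 : 0 < c0 by rewrite mulr_gt0 ?powR_gt0.
pose c1 := p * ka * (c0 / 2).
have c10 : 0 < c1 by rewrite !mulr_gt0// invr_gt0.
pose H := (3 / 2) `^ r : R; pose h := (1 / 2) `^ r : R.
have H0 : 0 < H by rewrite powR_gt0// divr_gt0.
have h0 : 0 < h by rewrite powR_gt0// divr_gt0.
have hH : h <= H by rewrite ge0_ler_powR// ?nnegrE; lra.
pose G := H / h.
have G1 : 1 <= G by rewrite ler_pdivlMr// mul1r.
have G0 : 0 < G by apply: lt_le_trans G1.
pose K6 := 3 / 2 * K1 * (1 + G).
have K60 : 0 <= K6.
  by rewrite /K6; apply: mulr_ge0; [apply: mulr_ge0 => //; rewrite divr_ge0|rewrite addr_ge0// ltW].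
pose thB := c1 / (2 * (K6 + 1)).
have K61 : 0 < K6 + 1 by rewrite ltr_wpDl.
have thB0 : 0 < thB by rewrite divr_gt0// mulr_gt0.
have thBE : (K6 + 1) * thB = c1 / 2 by rewrite /thB; field; rewrite gt_eqF.
exists ((2 * G * K6) ^+ 2 / (2 * c1)), (Num.min thA thB); split.
- by rewrite divr_ge0 ?sqr_ge0// mulr_ge0// ltW.
- by rewrite lt_min thA0.
move=> n E t th sn; rewrite le_min => /andP[tA tB] y y0 yX.
have [x2 D2 _ fK] := HA n E t th sn tA.
have [[N0 s0 /andP[t0 t1] /andP[th0' th1]] [u0 u2 u1 uE] [r1' r2 r3 r4] ss] := small_noise_scales sn.
have sE : forall i j, E i j = E j i by case: sn => [[]].
have B0 : forall i j, 0 <= noisy E i j by case: sn => [[]].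
move: x2 D2 fK yX; set x := test_vec r E; set D := mulfv (noisy E) x => x2 D2 fK yX.
have x0 i : 0 < x i by have /andP[h1 _] := x2 i; apply: lt_le_trans h1; rewrite divr_gt0.
have D0 i : 0 < D i by have /andP[h1 _] := D2 i; apply: lt_le_trans h1; rewrite divr_gt0.
pose w i := D i `^ (p - 1).
pose Phi i := (mulfv (noisy E) y i / D i) `^ (p / 2).
pose Psi i := (y i / x i) `^ (p / 2).
pose b j := mulfv (noisy E) w j.
have bE j : \sum_i noisy E i j * w i = b j.
  by apply: eq_bigr => i _; rewrite (noisy_sym sE).
have ka1 : ka <= p^-1 by rewrite ge_min lexx.
have ka2 : ka <= 1 - p^-1 by rewrite ge_min lexx orbT.
have := @schur_gain _ n (noisy E) p ka x y w Phi Psi p1 (ltW ka0) ka1 ka2 B0 x0 D0 y0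
  (fun _ => erefl) (fun _ => erefl) (fun _ => erefl).
rewrite [X in _ <= X - _](eq_bigr (fun j => x j * b j * Psi j ^+ 2)); last first.
  by move=> j _; rewrite bE.
move=> schur; apply: (le_trans schur) => {schur}.
pose m := (\sum_j Psi j) / n%:R.
pose v j := Psi j - m.
have gain : c1 * l2 v ^+ 2 <=
    p * ka * \sum_i \sum_j noisy E i j * (w i * x j) * (Phi i - Psi j) ^+ 2.
  have := @noisy_coercive _ n E t th Phi Psi m sn erefl; rewrite -/v => coe.
  rewrite /c1 -[p * ka * _ * _]mulrA; apply: ler_wpM2l; first by rewrite mulr_ge0// ltW.
  have -> : c0 / 2 * l2 v ^+ 2 = c0 * (l2 v ^+ 2 / 2) by ring.
  apply: (le_trans (ler_wpM2l (ltW c00) coe)).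
  rewrite mulr_sumr; apply: ler_sum => i _; rewrite mulr_sumr; apply: ler_sum => j _.
  rewrite mulrCA -mulrA; apply: ler_wpM2l => //; apply: ler_wpM2r; first exact: sqr_ge0.
  have /andP[Dh _] := D2 i; have /andP[xh _] := x2 j.
  have pm0 : 0 <= p - 1 by rewrite subr_ge0 ltW.
  apply: ler_pM; rewrite ?powR_ge0//.
  by apply: ge0_ler_powR; rewrite ?nnegrE ?(ltW (D0 i)) ?divr_ge0.
pose X := \sum_i x i `^ r; pose S := \sum_i D i `^ p.
rewrite -/S.
have xh i : h <= x i `^ r.
  have /andP[h1 _] := x2 i.
  by apply: ge0_ler_powR; rewrite ?nnegrE ?(ltW (x0 i)) ?(ltW r0) ?divr_ge0.
have xH i : x i `^ r <= H.
  have /andP[_ h1] := x2 i.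
  by apply: ge0_ler_powR; rewrite ?nnegrE ?(ltW (x0 i)) ?(ltW r0) ?divr_ge0.
have Xh : h * n%:R <= X.
  rewrite /X mulrC -[leLHS]mulr1 -mulrA mulr1.
  have -> : n%:R * h = \sum_(i < n) h by rewrite sumr_const card_ord mulr_natl.
  by apply: ler_sum.
have XH : X <= H * n%:R.
  have -> : H * n%:R = \sum_(i < n) H by rewrite sumr_const card_ord mulr_natr.
  by apply: ler_sum.
have X0 : 0 < X by apply: lt_le_trans Xh; rewrite mulr_gt0.
have SE : S = \sum_j x j * b j.
  rewrite /b mulfv_sym; last exact: noisy_sym.
  apply: eq_bigr => i _; rewrite -/(D i) /w mulr_powRB1//; exact: ltW.
pose f j := b j - x j `^ (r - 1).
have fK' : l2 f <= K1 * tau n t by [].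
have xr j : x j * x j `^ (r - 1) = x j `^ r by rewrite mulr_powRB1// ltW.
(* the multiplier for which the residual [e] sums to zero *)
pose La := S / X.
have La0 : 0 <= La by rewrite divr_ge0 ?(ltW X0)//; apply: sumr_ge0 => i _; exact: powR_ge0.
have LaX : La * X = S by rewrite /La divfK// gt_eqF.
pose e j := x j * b j - La * x j `^ r.
have e0 : \sum_j e j = 0 by rewrite sumrB -SE -mulr_sumr -/X LaX subrr.
have eE : e = fun j => x j * f j + (1 - La) * x j `^ r.
  by apply/funext => j; rewrite /e /f mulrBr xr; ring.
have xfK : l2 (fun j => x j * f j) <= 3 / 2 * (K1 * tau n t).
  apply: (@le_trans _ _ (l2 (fun j => 3 / 2 * f j))).
    have n32 : `|3 / 2| = 3 / 2 :> R by rewrite ger0_norm ?divr_ge0.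
    apply: le_l2 => j; rewrite (normrM (x j)) (normrM (3 / 2)) n32 ler_wpM2r//.
    by rewrite (gtr0_norm (x0 j)); have /andP[] := x2 j.
  by rewrite l2Z ger0_norm ?divr_ge0//; apply: ler_wpM2l => //; rewrite divr_ge0.
have LaK : `|1 - La| <= 3 / 2 * (K1 * tau n t) / (h * Num.sqrt n%:R).
  have -> : 1 - La = - (\sum_j x j * f j) / X.
    have -> : \sum_j x j * f j = S - X.
      by rewrite SE /X -sumrB; apply: eq_bigr => j _; rewrite /f mulrBr xr.
    by rewrite /La; field; rewrite gt_eqF.
  rewrite mulNr normrN normrM (ger0_norm (_ : 0 <= X^-1)); last by rewrite invr_ge0 ltW.
  rewrite ler_pdivrMr//.
  apply: (le_trans (l2_sum _)); apply: (le_trans (ler_wpM2l (ltW s0) xfK)).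
  apply: (@le_trans _ _ (3 / 2 * (K1 * tau n t) / (h * Num.sqrt n%:R) * (h * n%:R))).
    rewrite -[X in _ <= _ * (h * X)]ss le_eqVlt; apply/orP; left; apply/eqP; field.
    by rewrite !gt_eqF.
  apply: ler_wpM2l => //; apply: divr_ge0; last by rewrite mulr_ge0// ltW.
  by rewrite mulr_ge0 ?divr_ge0// mulr_ge0// ltW.
have xrl2 : l2 (fun j => x j `^ r) <= H * Num.sqrt n%:R.
  apply: (@le_trans _ _ (l2 (fun _ : 'I_n => H))).
    by apply: le_l2 => j; rewrite ger0_norm ?powR_ge0// gtr0_norm.
  by rewrite l2_cst gtr0_norm// mulrC.
have eK : l2 e <= K6 * tau n t.
  rewrite eE; apply: (le_trans (l2D _ _)).
  have -> : K6 * tau n t = 3 / 2 * (K1 * tau n t) +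
      3 / 2 * (K1 * tau n t) / (h * Num.sqrt n%:R) * (H * Num.sqrt n%:R).
    by rewrite /K6 /G; field; rewrite !gt_eqF.
  apply: lerD => //; rewrite l2Z; apply: ler_pM; rewrite ?l2_ge0//.
have PsiE j : x j `^ r * Psi j ^+ 2 = x j `^ r * (y j / x j) `^ p.
  by rewrite /Psi -powR_mulrn ?powR_ge0// -powRrM divfK.
have PsiX : \sum_j x j `^ r * Psi j ^+ 2 <= X.
  apply: (@le_trans _ _ ((1 - p / r) * X + p / r * \sum_i y i `^ r)).
    rewrite /X !mulr_sumr -big_split /=; apply: ler_sum => j _; rewrite PsiE.
    exact: young_powers.
  have q0 : 0 <= p / r by rewrite divr_ge0 ?ltW.
  have := ler_wpM2l q0 yX; rewrite -/X.
  by move: (p / r) (\sum_i _) => q Y; clear; lra.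
have PsiN : \sum_j Psi j ^+ 2 <= G * n%:R.
  rewrite /G mulrAC ler_pdivlMr// mulrC mulr_sumr; apply: le_trans XH.
  apply: le_trans PsiX; apply: ler_sum => j _; apply: ler_wpM2r => //; exact: sqr_ge0.
have mG : `|m| <= G.
  rewrite /m normrM (ger0_norm (_ : 0 <= n%:R^-1)) ?invr_ge0 ?ler0n// ler_pdivrMr//.
  apply: (le_trans (l2_sum _)); rewrite -[X in _ <= G * X]ss mulrA [G * _]mulrC -mulrA; apply: ler_wpM2l; first exact: ltW.
  apply: l2_le_sqr; first by rewrite mulr_ge0// ltW.
  apply: (le_trans PsiN); rewrite exprMn expr2 [Num.sqrt _ ^+ 2]expr2 ss -mulrA; apply: ler_wpM2l; first exact: ltW.
  by rewrite ler_peMl// ltW.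
have sumE : \sum_j x j * b j * Psi j ^+ 2 = La * (\sum_j x j `^ r * Psi j ^+ 2)
   + (2 * m * \sum_j e j * v j + \sum_j e j * v j ^+ 2).
  have z : m ^+ 2 * \sum_j e j = 0 by rewrite e0 mulr0.
  transitivity (La * (\sum_j x j `^ r * Psi j ^+ 2)
     + (2 * m * \sum_j e j * v j + \sum_j e j * v j ^+ 2) + m ^+ 2 * \sum_j e j).
    rewrite !mulr_sumr -!big_split /=; apply: eq_bigr => j _.
    by rewrite /e /v; ring.
  by rewrite z addr0.
have V0 := l2_ge0 v.
have ev1 : 2 * m * \sum_j e j * v j <= 2 * G * (K6 * tau n t * l2 v).
  apply: (le_trans (ler_norm _)); rewrite normrM normrM (ger0_norm (ler0n _ 2)).
  have m2 : 0 <= 2 * `|m| by rewrite mulr_ge0.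
  apply: ler_pM => //; first by apply: ler_wpM2l.
  by apply: (le_trans (l2_CS _ _)); apply: ler_wpM2r.
have ev2 : \sum_j e j * v j ^+ 2 <= c1 / 2 * l2 v ^+ 2.
  rewrite l2_sqr mulr_sumr; apply: ler_sum => j _; apply: ler_wpM2r; first exact: sqr_ge0.
  apply: (le_trans (ler_norm _)); apply: (le_trans (l2_coord e j)); apply: (le_trans eK).
  apply: (@le_trans _ _ (K6 * thB)).
    by apply: ler_wpM2l => //; exact: le_trans tB.
  by rewrite -thBE; apply: ler_wpM2r; [exact: ltW|rewrite lerDl].
rewrite sumE.
have LS : La * (\sum_j x j `^ r * Psi j ^+ 2) <= S by rewrite -LaX; apply: ler_wpM2l.
have quad : 2 * G * (K6 * tau n t * l2 v) - c1 / 2 * l2 v ^+ 2 <=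
    (2 * G * K6) ^+ 2 / (2 * c1) * tau n t ^+ 2.
  rewrite -subr_ge0.
  have -> : (2 * G * K6) ^+ 2 / (2 * c1) * tau n t ^+ 2 -
      (2 * G * (K6 * tau n t * l2 v) - c1 / 2 * l2 v ^+ 2) =
    (2 * c1)^-1 * (2 * G * K6 * tau n t - c1 * l2 v) ^+ 2.
    by field; rewrite gt_eqF.
  by apply: mulr_ge0; [rewrite invr_ge0 mulr_ge0// ltW|exact: sqr_ge0].
have arith (a1 a2 a3 a4 a5 a6 V k s0' : R) : a1 <= s0' -> a2 <= a5 -> a3 <= k / 2 * V ->
    k * V <= a4 -> a5 - k / 2 * V <= a6 -> a1 + (a2 + a3) - a4 <= s0' + a6.
  by clear; lra.
exact: arith LS ev1 ev2 gain quad.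
Qed.

(** * Second-order expansion of the operator norm *)

(** In the quadratic term [v] may be replaced by [c * rowsum E]: the difference of the squares
    is the product of a first-order and of a second-order vector. *)
Lemma avg_powR_noise (R : realType) (s c L : R) : 0 <= L -> exists2 K : R, 0 <= K &
  forall n (E : 'I_n -> 'I_n -> R) (t th : R) (v : 'I_n -> R),
  small_noise E t th -> l2 (fun i => v i - c * rowsum E i) <= L * tau n t ->
  (forall i, `|v i| <= 1 / 2) ->
  `|(\sum_i (1 + v i) `^ s) / n%:R -
    (1 + s * ((\sum_i v i) / n%:R) +
     s * (s - 1) / 2 * c ^+ 2 * ((\sum_i rowsum E i ^+ 2) / n%:R))| <= K * t ^+ 3.
Proof.
move=> L0; have [Ks Ks0 HK] := powR_taylor s.
pose K' := 2 * c ^+ 2 + 2 * L ^+ 2.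
have K'0 : 0 <= K' by have := sqr_ge0 c; have := sqr_ge0 L; rewrite /K'; lra.
pose c2 := s * (s - 1) / 2.
exists (Ks * ((`|c| + L) * K') + `|c2| * (L * (2 * `|c| + L))).
  by apply: addr_ge0; apply: mulr_ge0 => //; apply: mulr_ge0 => //; apply: addr_ge0 => //; rewrite mulr_ge0.
move=> n E t th v sn vL v2.
have [[N0 s0 /andP[t0 t1] _] [u0 u2 u1 uE] _ ss] := small_noise_scales sn.
have [e2 esup e1 Be] := small_noise_rowsum sn.
have vsq := l2_sqr_noise L0 sn vL.
have ni : 0 <= (n%:R : R)^-1 by rewrite invr_ge0 ler0n.
have tt : t ^+ 2 <= t by rewrite expr2 ler_piMr// ltW.
have lv : l2 v <= Num.sqrt n%:R * ((`|c| + L) * t).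
  have -> : v = fun i => (v i - c * rowsum E i) + c * rowsum E i.
    by apply/funext => i; ring.
  apply: (le_trans (l2D _ _)); rewrite l2Z.
  have h1 : `|c| * l2 (rowsum E) <= `|c| * (Num.sqrt n%:R * t) by apply: ler_wpM2l.
  have h2 : L * tau n t <= L * (Num.sqrt n%:R * t).
    by apply: ler_wpM2l => //; apply: ler_wpM2l; [exact: ltW|].
  apply: (le_trans (lerD vL h1)); apply: (le_trans (lerD h2 (lexx _))).
  by rewrite le_eqVlt; apply/orP; left; apply/eqP; ring.
have NsE : n%:R = \sum_(i < n) (1 : R) by rewrite sumr_const card_ord.
pose r3 i := (1 + v i) `^ s - 1 - s * v i - c2 * v i ^+ 2.
have split_sum : (\sum_i (1 + v i) `^ s) / n%:R -
    (1 + s * ((\sum_i v i) / n%:R) + c2 * c ^+ 2 * ((\sum_i rowsum E i ^+ 2) / n%:R)) =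
    (\sum_i r3 i) / n%:R +
    c2 * ((\sum_i (v i - c * rowsum E i) * (v i + c * rowsum E i)) / n%:R).
  have -> : \sum_i r3 i = \sum_i (1 + v i) `^ s - n%:R - s * (\sum_i v i) -
      c2 * (\sum_i v i ^+ 2).
    by rewrite NsE !mulr_sumr -!sumrB.
  have -> : \sum_i (v i - c * rowsum E i) * (v i + c * rowsum E i) =
      \sum_i v i ^+ 2 - c ^+ 2 * (\sum_i rowsum E i ^+ 2).
    by rewrite mulr_sumr -sumrB; apply: eq_bigr => i _; ring.
  by field; rewrite gt_eqF.
rewrite -/c2 split_sum; apply: (le_trans (ler_normD _ _)); rewrite mulrDl; apply: lerD.
  rewrite normrM (ger0_norm ni) ler_pdivrMr//.
  apply: (le_trans (ler_norm_sum _ _ _)).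
  apply: (@le_trans _ _ (\sum_i Ks * (`|v i| * v i ^+ 2))).
    apply: ler_sum => i _; have [_ _ h] := HK _ (v2 i).
    by apply: (le_trans h); rewrite exprS real_normK ?num_real.
  rewrite -mulr_sumr -!mulrA; apply: ler_wpM2l => //.
  have := l2_CS (fun i => `|v i|) (fun i => v i ^+ 2).
  rewrite ler_norml => /andP[_ h]; apply: (le_trans h).
  have -> : l2 (fun i => `|v i|) = l2 v.
    by congr Num.sqrt; apply: eq_bigr => i _; rewrite real_normK ?num_real.
  apply: (@le_trans _ _ (Num.sqrt n%:R * ((`|c| + L) * t) * (K' * tau n t))).
    by apply: ler_pM; rewrite ?l2_ge0.
  rewrite le_eqVlt; apply/orP; left; apply/eqP.
  transitivity ((`|c| + L) * K' * t ^+ 3 * (Num.sqrt n%:R * Num.sqrt n%:R)).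
    by rewrite /tau; ring.
  by rewrite ss; ring.
rewrite normrM -mulrA; apply: ler_wpM2l => //.
rewrite normrM (ger0_norm ni) ler_pdivrMr//.
apply: (le_trans (l2_CS _ _)).
apply: (@le_trans _ _ (L * tau n t * (Num.sqrt n%:R * ((2 * `|c| + L) * t)))).
  apply: ler_pM; rewrite ?l2_ge0//.
  apply: (le_trans (l2D _ _)); rewrite l2Z.
  have h1 : `|c| * l2 (rowsum E) <= `|c| * (Num.sqrt n%:R * t) by apply: ler_wpM2l.
  apply: (le_trans (lerD lv h1)).
  by rewrite le_eqVlt; apply/orP; left; apply/eqP; ring.
rewrite le_eqVlt; apply/orP; left; apply/eqP.
transitivity (L * (2 * `|c| + L) * t ^+ 3 * (Num.sqrt n%:R * Num.sqrt n%:R)).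
  by rewrite /tau; ring.
by rewrite ss; ring.
Qed.

(** The bases differ from [1] by [t ^+ 2], so quadratic terms have size [t ^+ 4] and only the
    linear ones are kept. *)
Lemma powR_prod_expand (R : realType) (al be C1 : R) : 0 <= C1 ->
  exists C q0 : R, [/\ 0 <= C, 0 < q0 &
  forall t u v A B : R, 0 < t <= 1 -> t ^+ 2 <= q0 ->
  `|A| <= C1 * t ^+ 2 -> `|B| <= C1 * t ^+ 2 ->
  `|u - A| <= C1 * t ^+ 3 -> `|v - B| <= C1 * t ^+ 3 ->
  [/\ `|u| <= 1 / 2, `|v| <= 1 / 2 &
  `|(1 + u) `^ al * (1 + v) `^ be - (1 + al * A + be * B)| <= C * t ^+ 3]].
Proof.
move=> C10.
have [Ka Ka0 Ha] := powR_taylor al; have [Kb Kb0 Hb] := powR_taylor be.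
pose ca := `|al| * C1 + Ka * (2 * C1) ^+ 2.
pose cb := `|be| * C1 + Kb * (2 * C1) ^+ 2.
have sq0 : 0 <= (2 * C1) ^+ 2 by exact: sqr_ge0.
have ca0 : 0 <= ca by apply: addr_ge0; apply: mulr_ge0.
have cb0 : 0 <= cb by apply: addr_ge0; apply: mulr_ge0.
pose Ma := `|al| * C1; pose Mb := `|be| * C1.
have Ma0 : 0 <= Ma by rewrite mulr_ge0.
have Mb0 : 0 <= Mb by rewrite mulr_ge0.
exists (Ma * Mb + ca * (1 + Mb + cb) + cb * (1 + Ma)), (4 * C1 + 4)^-1; split.
- have h1 : 0 <= Ma * Mb by exact: mulr_ge0.
  have h2 : 0 <= ca * (1 + Mb + cb) by apply: mulr_ge0 => //; lra.
  have h3 : 0 <= cb * (1 + Ma) by apply: mulr_ge0 => //; lra.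
  lra.
- by rewrite invr_gt0; lra.
move=> t u v A B /andP[t0 t1] tq A2 B2 uA vB.
have t20 : 0 <= t ^+ 2 by exact: sqr_ge0.
have t30 : 0 <= t ^+ 3 by rewrite exprn_ge0// ltW.
have t32 : t ^+ 3 <= t ^+ 2 by rewrite exprS ler_piMl.
have t43 : t ^+ 4 <= t ^+ 3 by rewrite exprS ler_piMl.
have t21 : t ^+ 2 <= 1 by rewrite exprn_ile1// ltW.
have t31 : t ^+ 3 <= 1 by exact: le_trans t32 t21.
have small (z Z : R) : `|Z| <= C1 * t ^+ 2 -> `|z - Z| <= C1 * t ^+ 3 -> `|z| <= 2 * C1 * t ^+ 2.
  move=> hZ hz; have -> : z = Z + (z - Z) by ring.
  apply: (le_trans (ler_normD _ _)); apply: (le_trans (lerD hZ hz)).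
  have := ler_wpM2l C10 t32; clear; lra.
have half : 2 * C1 * t ^+ 2 <= 1 / 2.
  have d0 : 0 < 4 * C1 + 4 by clear -C10; lra.
  have h : (4 * C1 + 4) * t ^+ 2 <= 1.
    by rewrite mulrC -ler_pdivlMr// mul1r.
  have := mulr_ge0 C10 t20; move: h t20; clear; lra.
have u1 := le_trans (small _ _ A2 uA) half; have v1 := le_trans (small _ _ B2 vB) half.
split => //.
have expand (K g z Z : R) : 0 <= K -> `|Z| <= C1 * t ^+ 2 -> `|z - Z| <= C1 * t ^+ 3 ->
   `|(1 + z) `^ g - 1 - g * z| <= K * z ^+ 2 ->
   `|(1 + z) `^ g - (1 + g * Z)| <= (`|g| * C1 + K * (2 * C1) ^+ 2) * t ^+ 3.
  move=> K0 hZ hz hK.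
  have -> : (1 + z) `^ g - (1 + g * Z) = ((1 + z) `^ g - 1 - g * z) + g * (z - Z) by ring.
  apply: (le_trans (ler_normD _ _)); rewrite mulrDl addrC; apply: lerD.
    by rewrite normrM -mulrA; apply: ler_wpM2l.
  apply: (le_trans hK); rewrite -mulrA; apply: ler_wpM2l => //.
  apply: (@le_trans _ _ ((2 * C1 * t ^+ 2) ^+ 2)).
    rewrite -[z ^+ 2]real_normK ?num_real// ler_sqr ?nnegrE//; first exact: small hZ hz.
    by rewrite mulr_ge0// mulr_ge0.
  by rewrite exprMn -exprM; apply: ler_wpM2l.
have [_ ha _] := Ha u u1; have [_ hb _] := Hb v v1.
have ea := expand Ka al u A Ka0 A2 uA ha; have eb := expand Kb be v B Kb0 B2 vB hb.
rewrite -/ca in ea; rewrite -/cb in eb.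
have MA : `|al * A| <= Ma * t ^+ 2 by rewrite normrM -mulrA ler_wpM2l.
have MB : `|be * B| <= Mb * t ^+ 2 by rewrite normrM -mulrA ler_wpM2l.
move: ea eb MA MB; set P := (1 + u) `^ al; set Q := (1 + v) `^ be.
move: (al * A) (be * B) => aA bB ea eb MA MB.
have -> : P * Q - (1 + aA + bB) =
    aA * bB + (P - (1 + aA)) * (1 + bB + (Q - (1 + bB))) + (Q - (1 + bB)) * (1 + aA) by ring.
apply: (le_trans (ler_normD _ _)); apply: (le_trans (lerD (ler_normD _ _) (lexx _))).
rewrite !normrM [(_ + _ + _) * t ^+ 3]mulrDl [(_ + _) * t ^+ 3 in X in _ <= X + _]mulrDl.
have MA1 : `|aA| <= Ma by apply: (le_trans MA); rewrite ler_piMr.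
have MB1 : `|bB| <= Mb by apply: (le_trans MB); rewrite ler_piMr.
have eb1 : `|Q - (1 + bB)| <= cb by apply: (le_trans eb); rewrite ler_piMr.
apply: lerD; last first.
  rewrite [cb * _ * _]mulrAC; apply: ler_pM => //.
  by apply: (le_trans (ler_normD _ _)); rewrite normr1 lerD2l.
apply: lerD.
  apply: (@le_trans _ _ (Ma * t ^+ 2 * (Mb * t ^+ 2))); first exact: ler_pM.
  rewrite mulrACA -exprD; apply: ler_wpM2l => //.
  by rewrite mulr_ge0.
rewrite [ca * _ * _]mulrAC; apply: ler_pM => //.
apply: (le_trans (ler_normD _ _)); apply: lerD => //.
by apply: (le_trans (ler_normD _ _)); rewrite normr1 lerD2l.
Qed.

Lemma le_lpnorm (R : realType) (n : nat) (q c : R) (x : 'cV[R]_n) : 0 < q -> 0 <= c ->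
  lpnorm q x <= c <-> (\sum_(i < n) `|x i ord0| `^ q <= c `^ q).
Proof.
move=> q0 c0; have s0 : 0 <= \sum_(i < n) `|x i ord0| `^ q.
  by apply: sumr_ge0 => i _; exact: powR_ge0.
split => h.
  have := ge0_ler_powR (ltW q0) (powR_ge0 _ _ : lpnorm q x \in Num.nneg) c0 h.
  by rewrite -powRrM mulVf ?gt_eqF// powRr1.
have qi : 0 <= q^-1 by rewrite invr_ge0 ltW.
have := ge0_ler_powR qi s0 (powR_ge0 _ _ : c `^ q \in Num.nneg) h.
by rewrite -powRrM mulfV ?gt_eqF// powRr1.
Qed.

(** For nonnegative entries it is enough to consider nonnegative vectors. The test vector
    bounds the norm from below, a bound on the level set of [x] bounds it from above. *)
Lemma opnorm_test_vec (R : realType) (n : nat) (r p : R) (A : 'I_n -> 'I_n -> R)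
    (x : 'I_n -> R) (X S U : R) : 0 < r -> 0 < p ->
  (forall i j, 0 <= A i j) -> (forall i, 0 <= x i) ->
  X = \sum_i x i `^ r -> 0 < X -> S = \sum_i mulfv A x i `^ p ->
  (forall y : 'I_n -> R, (forall i, 0 <= y i) -> \sum_i y i `^ r <= X ->
     \sum_i mulfv A y i `^ p <= U) ->
  X `^ (- r^-1) * S `^ p^-1 <= opnorm r p (\matrix_(i, j) A i j) <=
  X `^ (- r^-1) * U `^ p^-1.
Proof.
move=> r0 p0 A0 x0 XE X0 SE HU.
have Ay0 (y : 'I_n -> R) i : (forall j, 0 <= y j) -> 0 <= mulfv A y i.
  by move=> y0; apply: sumr_ge0 => j _; apply: mulr_ge0.
have S0 : 0 <= S by rewrite SE; apply: sumr_ge0 => i _; exact: powR_ge0.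
have U0 : 0 <= U by apply: (le_trans S0); rewrite SE; apply: HU => //; rewrite -XE.
pose k := X `^ (- r^-1).
have k0 : 0 < k by exact: powR_gt0.
have kr : k `^ r = X^-1 by rewrite -powRrM mulNr mulVf ?gt_eqF// powRN powRr1// ltW.
have mulE (z : 'cV[R]_n) i :
    (\matrix_(i, j) A i j *m z) i ord0 = mulfv A (fun j => z j ord0) i.
  by rewrite mxE; apply: eq_bigr => j _; rewrite mxE.
have ub (z : 'cV[R]_n) : lpnorm r z <= 1 -> lpnorm p (\matrix_(i, j) A i j *m z) <= k * U `^ p^-1.
  move=> /(le_lpnorm z r0 ler01); rewrite powR1 => hz.
  have kU : 0 <= k * U `^ p^-1 by apply: mulr_ge0; exact: powR_ge0.
  apply/(le_lpnorm _ p0 kU).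
  rewrite powRM ?powR_ge0 ?(ltW k0)// -powRrM mulVf ?gt_eqF// powRr1//.
  pose y j := k^-1 * `|z j ord0|.
  have y0 j : 0 <= y j by apply: mulr_ge0 => //; rewrite invr_ge0 ltW.
  have yX : \sum_i y i `^ r <= X.
    rewrite (eq_bigr (fun i => X * `|z i ord0| `^ r)); last first.
      move=> i _; rewrite /y powRM ?invr_ge0 ?(ltW k0)//; congr (_ * _).
      by rewrite -powR_inv1 ?(ltW k0)// -powRrM mulN1r powRN kr invrK.
    by rewrite -mulr_sumr -[leRHS]mulr1; apply: ler_wpM2l => //; exact: ltW.
  apply: (le_trans _ (ler_wpM2l (powR_ge0 _ _) (HU y y0 yX))).
  rewrite mulr_sumr; apply: ler_sum => i _; rewrite -powRM ?(ltW k0)//; last exact: Ay0.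
  apply: ge0_ler_powR; rewrite ?nnegrE//; first exact: ltW.
    by apply: mulr_ge0; [exact: ltW|exact: Ay0].
  rewrite mulE -mulfvZ; apply: (le_trans (ler_norm_sum _ _ _)); apply: ler_sum => j _.
  by rewrite normrM (ger0_norm (A0 _ _)) /y [k * _]mulrA mulfV ?gt_eqF// mul1r.
have lr : exists2 z : 'cV[R]_n, lpnorm r z <= 1 &
    lpnorm p (\matrix_(i, j) A i j *m z) = k * S `^ p^-1.
  exists (\col_i (k * x i)).
    apply/(le_lpnorm _ r0 ler01); rewrite powR1 (eq_bigr (fun i => X^-1 * x i `^ r)); last first.
      move=> i _; rewrite mxE ger0_norm; last by apply: mulr_ge0 => //; exact: ltW.
      by rewrite powRM ?(ltW k0)// kr.
    by rewrite -mulr_sumr -XE mulVf ?gt_eqF.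
  rewrite /lpnorm (eq_bigr (fun i => k `^ p * mulfv A x i `^ p)); last first.
    move=> i _; rewrite mulE (_ : (fun j => _) = (fun j => k * x j)); last first.
      by apply/funext => j; rewrite mxE.
    rewrite mulfvZ ger0_norm; last by apply: mulr_ge0; [exact: ltW|exact: Ay0].
    by rewrite powRM ?(ltW k0)//; exact: Ay0.
  rewrite -mulr_sumr -SE powRM ?powR_ge0// -powRrM mulfV ?gt_eqF// powRr1//.
  exact: ltW.
apply/andP; split.
  have [z hz <-] := lr; apply: ub_le_sup; last by exists z.
  by exists (k * U `^ p^-1) => _ [w hw <-]; exact: ub.
apply: ge_sup; last by move=> _ [w hw <-]; exact: ub.
by have [z hz _] := lr; exists (lpnorm p (\matrix_(i, j) A i j *m z)), z.
Qed.

(** Second-order perturbation of the [r -> p] norm of the flat matrix: the row sums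
    enter to first order through their mean and to second order through their mean square.
    By [noisy_upper] the upper and lower bounds differ by a negligible amount. *)
Lemma noisy_opnorm (R : realType) (p r : R) : 1 < p -> p <= r ->
  exists C th0 : R, [/\ 0 <= C, 0 < th0 &
  forall n (E : 'I_n -> 'I_n -> R) (t th : R), small_noise E t th -> th <= th0 ->
  `|n%:R `^ (- (p^-1 - r^-1)) * opnorm r p (\matrix_(i, j) noisy E i j) -
    (1 - n%:R^-1 + (\sum_i rowsum E i) / n%:R +
     (p - 1 + (r - 1)^-1) / 2 * ((\sum_i rowsum E i ^+ 2) / n%:R))| <= C * t ^+ 3].
Proof.
have between (l w h c e : R) : l <= w -> w <= h -> `|l - c| <= e -> `|h - c| <= e ->
    `|w - c| <= e by rewrite !ler_norml; lra.
move=> p1 pr; have p0 : 0 < p by lra.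
have r1 : 1 < r by lra.
have r0 : 0 < r by lra.
pose a := (r - 1)^-1; have a0 : 0 < a by rewrite invr_gt0; lra.
have ra : (r - 1) * a = 1 by rewrite /a mulfV// gt_eqF//; lra.
have [K1 [thA [K10 thA0 HA]]] := test_vec_expansion p1 r1.
have [K [thB [K0 thB0 HB]]] := noisy_upper p1 pr.
have [Kp Kp0 Hp] := avg_powR_noise p 1 K10.
have [Kr Kr0 Hr] := avg_powR_noise r a (lexx 0).
pose cp := p * (p - 1) / 2; pose cr := r * (r - 1) / 2 * a ^+ 2.
have cp0 : 0 <= cp by rewrite divr_ge0// mulr_ge0//; lra.
have cr0 : 0 <= cr by rewrite mulr_ge0 ?sqr_ge0// divr_ge0// mulr_ge0//; lra.
have pa0 : 0 <= p * a by rewrite mulr_ge0 ?ltW.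
have ra0 : 0 <= r * a by rewrite mulr_ge0 ?ltW.
pose C1 := 2 * p + 3 * (p * a) + cp + r * a + cr + Kp + K + Kr.
have C10 : 0 <= C1 by rewrite /C1; lra.
have [C [q0 [C0 q00 HC]]] := powR_prod_expand p^-1 (- r^-1) C10.
exists C, (Num.min (Num.min thA thB) q0); split => //.
  by rewrite !lt_min thA0 thB0 q00.
move=> n E t th sn; rewrite !le_min => /andP[/andP[thA' thB'] thq].
have [x2 D2 Dl _] := HA n E t th sn thA'; have up := HB n E t th sn thB'.
have [[N0 s0 /andP[t0 t1] _] [u0 u2 u1 uE] [_ ni _ tt] ss] := small_noise_scales sn.
have [e2 esup e1 Be] := small_noise_rowsum sn.
have t01 : 0 < t <= 1 by rewrite t0.
have n0 : (0 < n)%N by rewrite -(ltr0n R).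
have eb : `|(\sum_i rowsum E i) / n%:R| <= t ^+ 2.
  case: sn => _ _ h _; rewrite normrM (ger0_norm (_ : 0 <= n%:R^-1)) ?invr_ge0 ?ler0n//.
  by rewrite ler_pdivrMr// mulrC.
have sE : forall i j, E i j = E j i by case: sn => [[]].
have B0 : forall i j, 0 <= noisy E i j by case: sn => [[]].
set eps := (\sum_i rowsum E i) / n%:R in eb *.
set m2 := (\sum_i rowsum E i ^+ 2) / n%:R.
have m20 : 0 <= m2 by rewrite divr_ge0// sumr_ge0// => i _; exact: sqr_ge0.
have m2t : m2 <= t ^+ 2.
  rewrite ler_pdivrMr// -l2_sqr.
  apply: (@le_trans _ _ ((Num.sqrt n%:R * t) ^+ 2)).
    by rewrite ler_sqr ?nnegrE ?l2_ge0// mulr_ge0 ?ltW.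
  by rewrite exprMn expr2 ss mulrC.
set x := test_vec r E in x2 D2 Dl up.
set D := mulfv (noisy E) x in D2 Dl.
(* symmetry moves the matrix onto the constant vector, so the mean of [D] is explicit *)
pose gb := (\sum_i (D i - 1)) / n%:R.
have gbE : gb = - n%:R^-1 + eps + a * eps + a * m2 - a * eps / n%:R.
  rewrite /gb; have -> : \sum_i (D i - 1) =
     \sum_i ((- n%:R^-1 + rowsum E i + a * rowsum E i + a * rowsum E i ^+ 2) -
             a * rowsum E i / n%:R).
    rewrite sumrB (_ : \sum_i D i = \sum_i 1 * D i); last by apply: eq_bigr => i _; rewrite mul1r.
    rewrite (mulfv_sym _ _ (noisy_sym sE)) -sumrB; apply: eq_bigr => i _.
    by rewrite mulfv1 rowsum_noisy// /x /test_vec -/a; ring.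
  rewrite sumrB !big_split /= -mulr_suml -!mulr_sumr sumr_const card_ord -[_ *+ n]mulr_natr.
  by rewrite /eps /m2; field; rewrite gt_eqF.
pose S := \sum_i D i `^ p; pose X := \sum_i x i `^ r.
have SN : `|S / n%:R - (1 + p * gb + cp * m2)| <= Kp * t ^+ 3.
  have := Hp n E t th (fun i => D i - 1) sn.
  rewrite expr1n mulr1 (_ : (fun i => D i - 1 - 1 * rowsum E i) = (fun i => D i - (1 + rowsum E i))); last first.
    by apply/funext => i; ring.
  move=> /(_ Dl) h; rewrite /S (eq_bigr (fun i => (1 + (D i - 1)) `^ p)); last first.
    by move=> i _; rewrite addrC subrK.
  by apply: h => i; have := D2 i; rewrite ler_norml; clear; lra.
have XN : `|X / n%:R - (1 + r * a * eps + cr * m2)| <= Kr * t ^+ 3.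
  have := Hr n E t th (fun i => a * rowsum E i) sn.
  have xl : l2 (fun i => a * rowsum E i - a * rowsum E i) <= 0 * tau n t.
    rewrite mul0r; apply: l2_le_sqr => //; rewrite big1 ?expr0n//.
    by move=> i _; rewrite subrr expr0n.
  move=> /(_ xl) h; have -> : r * a * eps = r * ((\sum_i a * rowsum E i) / n%:R).
    by rewrite -mulr_sumr /eps; ring.
  by apply: h => i; have := x2 i; rewrite /x /test_vec -/a ler_norml; clear; lra.
have x0 i : 0 <= x i by have := x2 i; clear; lra.
have X0 : 0 < X.
  have : 0 < x (Ordinal n0) `^ r by apply: powR_gt0; have := x2 (Ordinal n0); clear; lra.
  move=> /lt_le_trans; apply; rewrite /X (bigD1 (Ordinal n0))//= lerDl.
  by apply: sumr_ge0 => i _; exact: powR_ge0.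
have S0 : 0 <= S by apply: sumr_ge0 => i _; exact: powR_ge0.
have := opnorm_test_vec r0 p0 B0 x0 (erefl X) X0 (erefl S) up.
have U0 : 0 <= S + K * tau n t ^+ 2 by rewrite addr_ge0// mulr_ge0// sqr_ge0.
set om := opnorm _ _ _ => /andP[lo hi].
have scale (Y : R) : 0 <= Y -> n%:R `^ (- (p^-1 - r^-1)) * (X `^ (- r^-1) * Y `^ p^-1) =
    (1 + (Y / n%:R - 1)) `^ p^-1 * (1 + (X / n%:R - 1)) `^ (- r^-1).
  move=> Y0; have dn Z : 1 + (Z / n%:R - 1) = Z * n%:R^-1 :> R by ring.
  rewrite !dn !powRM ?invr_ge0 ?ler0n ?(ltW X0)//.
  have -> : n%:R^-1 = n%:R `^ (-1) :> R by rewrite powR_inv1// ler0n.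
  rewrite -!powRrM !mulN1r opprK opprB addrC powRD; last by apply/implyP => _; rewrite gt_eqF.
  ring.
have t20 : 0 <= t ^+ 2 by exact: sqr_ge0.
have t30 : 0 <= t ^+ 3 by rewrite exprn_ge0// ltW.
have t43 : t ^+ 4 <= t ^+ 3 by rewrite exprS ler_piMl.
have tq : t ^+ 2 <= q0 by apply: (le_trans tt); apply: (le_trans u1).
pose A := p * (- n%:R^-1 + eps + a * eps + a * m2) + cp * m2.
pose B := r * a * eps + cr * m2.
have n10 : 0 <= (n%:R : R)^-1 by rewrite invr_ge0 ler0n.
have At : `|A| <= C1 * t ^+ 2.
  move: eb; rewrite /A /C1 !ler_norml.
  have q1 := ler_wpM2l cp0 m2t; have q2 := mulr_ge0 cp0 m20.
  have q3 := ler_wpM2l pa0 m2t; have q4 := mulr_ge0 pa0 m20.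
  have q5 := ler_wpM2l (ltW p0) ni; have q6 := mulr_ge0 (ltW p0) n10.
  move=> /andP[l1 l2].
  have q7 := ler_wpM2l (ltW p0) l1; have q8 := ler_wpM2l (ltW p0) l2.
  have q9 := ler_wpM2l pa0 l1; have q10 := ler_wpM2l pa0 l2.
  have q11 := mulr_ge0 Kp0 t20; have q12 := mulr_ge0 Kr0 t20; have q13 := mulr_ge0 K0 t20.
  have q14 := mulr_ge0 cr0 t20; have q15 := mulr_ge0 ra0 t20; have q16 := mulr_ge0 cp0 t20.
  have q17 := mulr_ge0 pa0 t20; have q18 := mulr_ge0 (ltW p0) t20.
  clear -q1 q2 q3 q4 q5 q6 q7 q8 q9 q10 q11 q12 q13 q14 q15 q16 q17 q18; nra.
have Bt : `|B| <= C1 * t ^+ 2.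
  move: eb; rewrite /B /C1 !ler_norml.
  have q1 := ler_wpM2l cr0 m2t; have q2 := mulr_ge0 cr0 m20.
  move=> /andP[l1 l2].
  have q9 := ler_wpM2l ra0 l1; have q10 := ler_wpM2l ra0 l2.
  have q11 := mulr_ge0 Kp0 t20; have q12 := mulr_ge0 Kr0 t20; have q13 := mulr_ge0 K0 t20.
  have q14 := mulr_ge0 cr0 t20; have q15 := mulr_ge0 ra0 t20; have q16 := mulr_ge0 cp0 t20.
  have q17 := mulr_ge0 pa0 t20; have q18 := mulr_ge0 (ltW p0) t20.
  clear -q1 q2 q9 q10 q11 q12 q13 q14 q15 q16 q17 q18; nra.
have Bv : `|X / n%:R - 1 - B| <= C1 * t ^+ 3.
  rewrite (_ : X / n%:R - 1 - B = X / n%:R - (1 + r * a * eps + cr * m2)); last first.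
    by rewrite /B; ring.
  apply: (le_trans XN); apply: ler_wpM2r => //; rewrite /C1.
  by clear -p0 pa0 cp0 ra0 cr0 K0 Kp0 Kr0; lra.
have Au (y : R) : 0 <= y <= K * t ^+ 3 -> `|S / n%:R + y - 1 - A| <= C1 * t ^+ 3.
  move=> /andP[y0 y1].
  rewrite (_ : _ - A = (S / n%:R - (1 + p * gb + cp * m2)) + (y - p * a * (eps / n%:R))); last first.
    by rewrite /A gbE; ring.
  have en : `|eps / n%:R| <= t ^+ 3.
    apply: le_trans t43; rewrite normrM (ger0_norm n10) (_ : 4 = 2 + 2)%N// exprD.
    by apply: ler_pM.
  apply: (le_trans (ler_normD _ _)).
  have h1 : `|y - p * a * (eps / n%:R)| <= K * t ^+ 3 + p * a * t ^+ 3.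
    apply: (le_trans (ler_normB _ _)); apply: lerD; first by rewrite ger0_norm.
    by rewrite normrM (ger0_norm pa0); apply: ler_wpM2l.
  apply: (le_trans (lerD SN h1)); rewrite -!mulrDl; apply: ler_wpM2r => //.
  by rewrite /C1; clear -p0 pa0 cp0 ra0 cr0 K0 Kp0 Kr0; lra.
have fin (y : R) : 0 <= y <= K * t ^+ 3 ->
   `|(1 + (S / n%:R + y - 1)) `^ p^-1 * (1 + (X / n%:R - 1)) `^ (- r^-1) -
     (1 - n%:R^-1 + eps + (p - 1 + a) / 2 * m2)| <= C * t ^+ 3.
  move=> hy; have [_ _] := HC t _ _ A B t01 tq At Bt (Au y hy) Bv.
  congr (`|_ - _| <= _); rewrite /A /B /cp /cr.
  have -> : r * (r - 1) / 2 * a ^+ 2 = r * a / 2 * ((r - 1) * a) by ring.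
  rewrite ra mulr1; clear -p0 r0 N0.
  by field; rewrite !gt_eqF.
have k0 : 0 <= n%:R `^ (- (p^-1 - r^-1)) :> R by exact: powR_ge0.
have upS : \sum_i mulfv (noisy E) x i `^ p = S by [].
rewrite upS in hi.
have f1 := fin 0; have f2 := fin (K * tau n t ^+ 2 / n%:R).
have h1 := ler_wpM2l k0 lo; have h2 := ler_wpM2l k0 hi.
rewrite scale// in h1; rewrite scale// in h2.
rewrite (_ : S / n%:R + 0 - 1 = S / n%:R - 1) in f1; last by ring.
rewrite (_ : S / n%:R + _ - 1 = (S + K * tau n t ^+ 2) / n%:R - 1) in f2; last by ring.
have y1 : 0 <= (0 : R) <= K * t ^+ 3 by rewrite lexx mulr_ge0.
have y2 : 0 <= K * tau n t ^+ 2 / n%:R <= K * t ^+ 3.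
  rewrite uE; apply/andP; split.
    apply: mulr_ge0 => //; apply: mulr_ge0 => //; apply: mulr_ge0; first exact: ltW.
    by apply: exprn_ge0; exact: ltW.
  rewrite -mulrA; apply: ler_wpM2l => //; rewrite mulrAC mulfV ?mul1r// gt_eqF//.
exact: between h1 h2 (f1 y1) (f2 y2).
Qed.

(** * Quadratic functionals of a symmetric matrix with independent entries *)

Local Notation upair n := {ij : 'I_n * 'I_n | (ij.1 < ij.2)%N} (only parsing).

(** Almost orthogonal families: a sum whose terms are uncorrelated except with their
    mirror images has a second moment proportional to the number of terms. *)
Lemma ex_sqr_sum_le d (T : measurableType d) (R : realType) (P : probability T R)
    (Q : finType) (S : {pred Q}) (Z : Q -> T -> R) (mir : Q -> Q) (v : R) : 0 <= v ->
  (forall q, Z (mir q) = Z q) ->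
  (forall q q', itg P (fun t => Z q t * Z q' t)) ->
  (forall q q', q \in S -> q' \in S -> q' != q -> q' != mir q ->
     ex P (fun t => Z q t * Z q' t) = 0) ->
  (forall q, q \in S -> ex P (fun t => Z q t * Z q t) <= v) ->
  itg P (fun t => (\sum_(q in S) Z q t) ^+ 2) /\
  ex P (fun t => (\sum_(q in S) Z q t) ^+ 2) <= 2 * v * #|S|%:R.
Proof.
move=> v0 Zm Zi Z0 Zv.
have -> : (fun t => (\sum_(q in S) Z q t) ^+ 2) =
    (fun t => \sum_(q in S) \sum_(q' in S) Z q t * Z q' t).
  apply/funext => t; rewrite expr2 mulr_suml; apply: eq_bigr => q _.
  by rewrite mulr_sumr.
have Zi1 q : q \in S -> itg P (fun t => \sum_(q' in S) Z q t * Z q' t).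
  by move=> _; apply: itg_sum.
split; first exact: itg_sum.
rewrite ex_sum// (_ : _ * #|S|%:R = \sum_(q in S) 2 * v); last first.
  by rewrite sumr_const mulr_natr.
apply: ler_sum => q qS; rewrite ex_sum//.
apply: (@le_trans _ _ (\sum_(q' in S) (v * (q' == q)%:R + v * (q' == mir q)%:R))).
  apply: ler_sum => q' q'S; have [->|qq] := eqVneq q' q.
    by rewrite mulr1 (le_trans (Zv q qS))// lerDl mulr_ge0.
  have [->|qm] := eqVneq q' (mir q); first by rewrite Zm mulr0 add0r mulr1 Zv.
  by rewrite Z0// mulr0 addr0.
have one (q0 : Q) : \sum_(q' in S) v * (q' == q0)%:R <= v.
  rewrite -mulr_sumr -[leRHS]mulr1; apply: ler_wpM2l => //.
  rewrite big_mkcond /= (bigD1 q0)//= eqxx big1 ?addr0.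
    by case: ifP.
  by move=> i /negbTE ->; case: ifP.
by rewrite big_split /= (le_trans (lerD (one q) (one (mir q))))//; lra.
Qed.

(** An unordered pair as the index of an independent entry; the diagonal has none. *)
Definition edge (n : nat) (i j : 'I_n) : option (upair n) :=
  if insub (i, j) is Some e then Some e else insub (j, i).

Lemma edgeP (n : nat) (i j : 'I_n) : i != j ->
  exists2 e, edge i j = Some e & val e = (i, j) \/ val e = (j, i).
Proof.
move=> ij; rewrite /edge; case: insubP => [e _ ve|/=]; first by exists e => //; left.
rewrite -leqNgt leq_eqVlt => /orP[/eqP/ord_inj ji|ji]; first by rewrite ji eqxx in ij.
by rewrite insubT//=; eexists; first reflexivity; right.
Qed.

Lemma edge_diag (n : nat) (i : 'I_n) : edge i i = None.
Proof. by rewrite /edge !insubF//= ltnn. Qed.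

Lemma edge_sym (n : nat) (i j : 'I_n) : edge i j = edge j i.
Proof.
rewrite /edge; case: (ltngtP i j) => ij.
- by rewrite insubT//= insubF//= ltnNge ltnW.
- by rewrite insubF ?insubT//= ltnNge ltnW.
- by rewrite !insubF//= ij ltnn.
Qed.

Lemma edge_inj (n : nat) (i j k l : 'I_n) : i != j -> edge i j = edge k l ->
  (i = k /\ j = l) \/ (i = l /\ j = k).
Proof.
move=> ij; have [e -> ve] := edgeP ij.
have [->|kl] := eqVneq k l; first by rewrite edge_diag.
have [f -> vf] := edgeP kl; move=> [ef]; subst f.
by case: ve vf => -> [] [<- <-]; [left|right|right|left].
Qed.

Definition edge_mx (R : realType) (n : nat)
    (h : upair n -> R) (i j : 'I_n) : R :=
  oapp h 0 (edge i j).

Lemma edge_mx_sym (R : realType) (n : nat) h (i j : 'I_n) :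
  @edge_mx R n h i j = edge_mx h j i.
Proof. by rewrite /edge_mx edge_sym. Qed.

Lemma edge_mx_diag (R : realType) (n : nat) h (i : 'I_n) : @edge_mx R n h i i = 0.
Proof. by rewrite /edge_mx edge_diag. Qed.

Lemma edge_mx_total (R : realType) (n : nat) (h : _ -> R) :
  \sum_(i < n) \sum_(j < n) edge_mx h i j = 2 * \sum_e h e.
Proof.
pose lt (z : 'I_n * 'I_n) := (z.1 < z.2)%N.
rewrite (pair_bigA _ (fun i j => edge_mx h i j)) /= (bigID lt) /=.
have Hlt : \sum_(z | lt z) edge_mx h z.1 z.2 = \sum_e h e.
  rewrite (reindex_omap (fun e : {ij | lt ij} => val e) insub) /=; last first.
    by move=> z hz; rewrite insubT.
  apply: eq_big => [e|e _]; first by rewrite (valP e) /= valK eqxx.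
  by rewrite /edge_mx /edge -surjective_pairing valK.
rewrite Hlt mulr_natl mulr2n; congr (_ + _).
rewrite -Hlt (reindex_inj (inv_inj (_ : involutive (fun z : 'I_n * 'I_n => (z.2, z.1))))) /=; last by case.
rewrite (bigID lt) /= [X in _ + X]big1 ?addr0.
  apply: eq_big => [[i j]|[i j] _]; last by rewrite edge_mx_sym.
  by rewrite /lt /= andbC; case: ltngtP.
move=> [i j]; rewrite /lt /= -!leqNgt => ij.
rewrite (_ : i = j) ?edge_mx_diag//; apply/ord_inj/eqP; rewrite eqn_leq.
by case/andP: ij => -> ->.
Qed.

(** Distinct entries are uncorrelated, and each of them occurs at two positions only. *)
Lemma edge_mx_sqr_sum d (T : measurableType d) (R : realType) (P : probability T R)
    (n : nat) (X : upair n -> {RV P >-> R}) (g : R -> R) (v : R)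
    (S : {pred 'I_n * 'I_n}) :
  mutually_independent X -> measurable_fun setT g ->
  (forall e, itg P (fun t => g (X e t) ^+ 2)) ->
  (forall e, ex P (fun t => g (X e t)) = 0) ->
  (forall e, ex P (fun t => g (X e t) ^+ 2) <= v) -> 0 <= v ->
  itg P (fun t => (\sum_(z in S) edge_mx (fun e => g (X e t)) z.1 z.2) ^+ 2) /\
  ex P (fun t => (\sum_(z in S) edge_mx (fun e => g (X e t)) z.1 z.2) ^+ 2)
    <= 2 * v * #|S|%:R.
Proof.
move=> indep mg i2 e1 ev v0.
have mgX e : measurable_fun setT (fun t => g (X e t)) by exact: measurableT_comp.
have i1 e : itg P (fun t => g (X e t)).
  apply: itg_le (itgD (itg_cst P 1) (i2 e)) => // t.
  by rewrite -[_ ^+ 2]real_normK ?num_real//; have := sqr_ge0 (`|g (X e t)| - 1); have := normr_ge0 (g (X e t)); nra.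
have i0 : itg P (fun _ : T => 0 : R) by exact: itg_cst.
have prod e e' : e' != e -> itg P (fun t => g (X e t) * g (X e' t)) /\
    ex P (fun t => g (X e t) * g (X e' t)) = 0.
  move=> ee; have eJ : e' \notin [set e]%SET by rewrite inE.
  have [h1 h2] := ex_coordM indep eJ
    (depends_on_comp mg (@depends_on_coord _ _ _ _ _ X _ e (set11 e))) mg (i1 e) (i1 e').
  by split => //; rewrite h2 (_ : ex P (g \o X e') = 0) ?mulr0//; exact: e1.
have diag e : (fun t => g (X e t) * g (X e t)) = (fun t => g (X e t) ^+ 2).
  by apply/funext => t; rewrite expr2.
apply: (@ex_sqr_sum_le _ _ _ _ _ _ _ (fun z => (z.2, z.1))) => //.
- by move=> [i j]; apply/funext => t; rewrite edge_mx_sym.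
- move=> [i j] [k l]; rewrite /edge_mx /=.
  case: (edge i j) => [e|] /=; last by under eq_fun do rewrite mul0r.
  case: (edge k l) => [f|] /=; last by under eq_fun do rewrite mulr0.
  have [->|ef] := eqVneq f e; first by rewrite diag.
  by have [] := prod _ _ ef.
- move=> [i j] [k l] _ _ z1 z2; rewrite /edge_mx /=.
  case eij : (edge i j) => [e|] /=; last by under eq_ex do rewrite mul0r; exact: ex_cst.
  case ekl : (edge k l) => [f|] /=; last by under eq_ex do rewrite mulr0; exact: ex_cst.
  have [fe|ef] := eqVneq f e; last by have [] := prod _ _ ef.
  subst f; have ij : i != j by apply/eqP => ij; rewrite ij edge_diag in eij.
  have [[? ?]|[? ?]] := edge_inj ij (etrans eij (esym ekl)); subst k l.
    by rewrite eqxx in z1.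
  by rewrite eqxx in z2.
- move=> [i j] _; rewrite /edge_mx /=; case: (edge i j) => [e|] /=.
    by rewrite diag.
  by under eq_ex do rewrite mul0r; rewrite ex_cst.
Qed.

(** Independence splits off a factor that occurs only once, and its mean is zero. *)
Lemma ex_four_entries d (T : measurableType d) (R : realType) (P : probability T R)
    (I : finType) (X : I -> {RV P >-> R}) (g : R -> R) (a b c e : I) :
  mutually_independent X -> measurable_fun setT g ->
  (forall e, itg P (fun t => g (X e t) ^+ 4)) ->
  (forall e, ex P (fun t => g (X e t)) = 0) ->
  itg P (fun t => g (X a t) * g (X b t) * g (X c t) * g (X e t)) /\
  (e \notin [:: a; b; c] ->
   ex P (fun t => g (X a t) * g (X b t) * g (X c t) * g (X e t)) = 0).
Proof.
move=> indep mg i4 e1.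
have mgX f : measurable_fun setT (fun t => g (X f t)) by exact: measurableT_comp.
have amgm (x y z w : R) : `|x * y * z * w| <= x ^+ 4 + y ^+ 4 + z ^+ 4 + w ^+ 4.
  have sq (u u' : R) : `|u * u'| <= (u ^+ 2 + u' ^+ 2) / 2.
    by rewrite ler_norml; have := sqr_ge0 (u + u'); have := sqr_ge0 (u - u'); nra.
  rewrite -mulrA; have := sq (x * y) (z * w); have := sq (x ^+ 2) (y ^+ 2).
  have := sq (z ^+ 2) (w ^+ 2).
  have e4 (u : R) : (u ^+ 2) ^+ 2 = u ^+ 4 by ring.
  have p4 (u : R) : 0 <= u ^+ 4 by rewrite -e4 sqr_ge0.
  have n2 (u u' : R) : `|u ^+ 2 * u' ^+ 2| = (u * u') ^+ 2.
    by rewrite -exprMn ger0_norm// sqr_ge0.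
  rewrite !e4 !n2.
  have := p4 x; have := p4 y; have := p4 z; have := p4 w; clear; lra.
split.
  apply: itg_le (itgD (itgD (itgD (i4 a) (i4 b)) (i4 c)) (i4 e)).
    by do ! apply: measurable_funM.
  by move=> t; exact: amgm.
move=> eN.
have i1 f : itg P (fun t => g (X f t)).
  apply: itg_le (itgD (itg_cst P 3) (i4 f)) => // t.
  by have := amgm 1 1 1 (g (X f t)); rewrite !mul1r expr1n; lra.
have eJ : e \notin [set a; b; c]%SET by move: eN; rewrite !inE orbA.
have dJ f : f \in [set a; b; c]%SET -> depends_on X [set a; b; c]%SET (fun t => g (X f t)).
  by move=> fJ; exact: depends_on_comp mg (@depends_on_coord _ _ _ _ _ X _ f fJ).
have dep : depends_on X [set a; b; c]%SET (fun t => g (X a t) * g (X b t) * g (X c t)).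
  by apply: depends_onM; [apply: depends_onM|]; apply: dJ; rewrite !inE eqxx ?orbT.
have iabc : itg P (fun t => g (X a t) * g (X b t) * g (X c t)).
  apply: itg_le (itgD (itgD (itgD (i4 a) (i4 b)) (i4 c)) (itg_cst P 1)).
    by do ! apply: measurable_funM.
  by move=> t; have := amgm (g (X a t)) (g (X b t)) (g (X c t)) 1; rewrite mulr1 expr1n.
have [_ ->] := ex_coordM indep eJ dep mg iabc (i1 e).
by rewrite (_ : ex P (g \o X e) = 0) ?mulr0//; exact: e1.
Qed.

(** Bounds that come with integrability add up without side conditions. *)
Definition ex_le d (T : measurableType d) (R : realType) (P : {measure set T -> \bar R})
    (f : T -> R) (c : R) : Prop := itg P f /\ ex P f <= c.

Lemma ex_leD d (T : measurableType d) (R : realType) (P : probability T R)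
    (f g : T -> R) (a b : R) :
  ex_le P f a -> ex_le P g b -> ex_le P (fun t => f t + g t) (a + b).
Proof. by move=> [fi fa] [gi gb]; split; [exact: itgD|rewrite exD// lerD]. Qed.

Lemma ex_leZ d (T : measurableType d) (R : realType) (P : probability T R)
    (f : T -> R) (a k : R) : 0 <= k ->
  ex_le P f a -> ex_le P (fun t => k * f t) (k * a).
Proof. by move=> k0 [fi fa]; split; [exact: itgZ|rewrite exZ// ler_wpM2l]. Qed.

Lemma ex_le_cst d (T : measurableType d) (R : realType) (P : probability T R)
    (k : R) : ex_le P (fun=> k) k.
Proof. by split; [exact: itg_cst|rewrite ex_cst]. Qed.

Lemma ex_le_sum d (T : measurableType d) (R : realType) (P : probability T R)
    (n : nat) (f : 'I_n -> T -> R) (a b : R) : n%:R * a <= b ->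
  (forall i, ex_le P (f i) a) -> ex_le P (fun t => \sum_i f i t) b.
Proof.
move=> ab fa; split; first by apply: itg_sum => i _; case: (fa i).
apply: le_trans ab; rewrite ex_sum; last by move=> i _; case: (fa i).
rewrite mulr_natl -[n in a *+ n]card_ord -sumr_const.
by apply: ler_sum => i _; case: (fa i).
Qed.

Lemma ex_le_dom d (T : measurableType d) (R : realType) (P : probability T R)
    (f g : T -> R) (a b : R) : ex_le P g a -> measurable_fun setT f ->
  (forall t, 0 <= f t <= g t) -> a <= b -> ex_le P f b.
Proof.
move=> [gi ga] mf fg ab.
have fi : itg P f.
  by apply: itg_le gi => // t; have /andP[f0 h] := fg t; rewrite ger0_norm.
split => //; apply: (le_trans _ ab); apply: (le_trans _ ga).
by apply: le_ex => // t; case/andP: (fg t).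
Qed.

(** Distinct open two-step paths [i - j - k] are uncorrelated: unless they use the same
    two edges, one of the edges occurs only once. *)
Lemma two_paths_sqr_sum d (T : measurableType d) (R : realType) (P : probability T R)
    (n : nat) (X : upair n -> {RV P >-> R}) (g : R -> R) (s c : R)
    (S : {pred 'I_n * 'I_n * 'I_n}) :
  mutually_independent X -> measurable_fun setT g ->
  (forall e, itg P (fun t => g (X e t) ^+ 4)) ->
  (forall e, ex P (fun t => g (X e t)) = 0) ->
  (forall e, ex P (fun t => g (X e t) ^+ 2) = s ^+ 2) ->
  (forall q, q \in S -> q.1.1 != q.2) -> #|S|%:R <= c ->
  ex_le P (fun t => (\sum_(q in S) edge_mx (fun e => g (X e t)) q.1.1 q.1.2 *
                                  edge_mx (fun e => g (X e t)) q.1.2 q.2) ^+ 2)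
          (2 * s ^+ 4 * c).
Proof.
move=> indep mg i4 e1 e2 Sne Sc.
have s40 : 0 <= s ^+ 4 by rewrite (_ : 4 = 2 * 2)%N// exprM sqr_ge0.
have four a b c' e := ex_four_entries a b c' e indep mg i4 e1.
suff [h1 h2] : ex_le P (fun t => (\sum_(q in S) edge_mx (fun e => g (X e t)) q.1.1 q.1.2 *
      edge_mx (fun e => g (X e t)) q.1.2 q.2) ^+ 2) (2 * s ^+ 4 * #|S|%:R).
  by split => //; apply: (le_trans h2); apply: ler_wpM2l => //; rewrite mulr_ge0.
apply: (@ex_sqr_sum_le _ _ _ _ _ _ (fun q t => edge_mx (fun e => g (X e t)) q.1.1 q.1.2 *
      edge_mx (fun e => g (X e t)) q.1.2 q.2) (fun q => (q.2, q.1.2, q.1.1)) (s ^+ 4)) => //.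
- move=> [[i j] k]; apply/funext => t /=.
  by rewrite (edge_mx_sym _ k j) (edge_mx_sym _ j i) mulrC.
- move=> [[i j] k] [[i' j'] k']; rewrite /edge_mx /=.
  case: (edge i j) => [a|] /=; last by under eq_fun do rewrite !mul0r; exact: itg_cst.
  case: (edge j k) => [b|] /=; last by under eq_fun do rewrite mulr0 mul0r; exact: itg_cst.
  case: (edge i' j') => [a'|] /=; last by under eq_fun do rewrite mul0r mulr0; exact: itg_cst.
  case: (edge j' k') => [b'|] /=; last by under eq_fun do rewrite !mulr0; exact: itg_cst.
  by under eq_fun do rewrite mulrA; have [] := four a b a' b'.
- move=> [[i j] k] [[i' j'] k'] /Sne /= ik /Sne /= ik' q1 q2; rewrite /edge_mx /=.
  case ea : (edge i j) => [a|] /=; last by under eq_ex do rewrite !mul0r; exact: ex_cst.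
  case eb : (edge j k) => [b|] /=; last by under eq_ex do rewrite mulr0 mul0r; exact: ex_cst.
  case ea' : (edge i' j') => [a'|] /=; last by under eq_ex do rewrite mul0r mulr0; exact: ex_cst.
  case eb' : (edge j' k') => [b'|] /=; last by under eq_ex do rewrite !mulr0; exact: ex_cst.
  have ne u v w : @edge n u v = Some w -> u != v.
    by move=> h; apply/eqP => uv; rewrite uv edge_diag in h.
  have ij := ne _ _ _ ea; have jk := ne _ _ _ eb; have ij' := ne _ _ _ ea'; have jk' := ne _ _ _ eb'.
  have ab : a != b.
    apply/eqP => ab; subst b; have [[]|[]] := edge_inj ij (etrans ea (esym eb)).
      by move=> h; rewrite h eqxx in ij.
    by move=> h; rewrite h eqxx in ik.
  have [aN|aI] := boolP (a \notin [:: b; a'; b']).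
    rewrite -[RHS]((four b a' b' a).2 aN); apply: eq_ex => t; ring.
  have [bN|bI] := boolP (b \notin [:: a; a'; b']).
    rewrite -[RHS]((four a a' b' b).2 bN); apply: eq_ex => t; ring.
  exfalso; move: aI bI; rewrite !negbK !inE eq_sym (eq_sym b) (negbTE ab) /=.
  rewrite eq_sym => aI; rewrite eq_sym => bI; move: aI bI.
  move=> aI bI.
  have {}aI : a = a' \/ a = b' by move: aI; rewrite !(eq_sym _ a) => /orP[] /eqP; [left|right].
  have {}bI : b = a' \/ b = b' by move: bI; rewrite !(eq_sym _ b) => /orP[] /eqP; [left|right].
  case: aI => aI; case: bI => bI; subst.
  + by rewrite eqxx in ab.
  + have [[? ?]|[? ?]] := edge_inj ij (etrans ea (esym ea'));
    have [[? ?]|[? ?]] := edge_inj jk (etrans eb (esym eb')); subst;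
    by rewrite ?eqxx in ij jk ij' jk' ik ik' q1 q2.
  + have [[? ?]|[? ?]] := edge_inj ij (etrans ea (esym eb'));
    have [[? ?]|[? ?]] := edge_inj jk (etrans eb (esym ea')); subst;
    by rewrite ?eqxx in ij jk ij' jk' ik ik' q1 q2.
  + by rewrite eqxx in ab.
- move=> [[i j] k] /Sne /= ik; rewrite /edge_mx /=.
  case ea : (edge i j) => [a|] /=; last by under eq_ex do rewrite !mul0r; rewrite ex_cst.
  case eb : (edge j k) => [b|] /=; last by under eq_ex do rewrite mulr0 mul0r; rewrite ex_cst.
  have ij : i != j by apply/eqP => uv; rewrite uv edge_diag in ea.
  have ab : b \notin [set a]%SET.
    rewrite inE; apply/eqP => ab; subst b; have [[]|[]] := edge_inj ij (etrans ea (esym eb)).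
      by move=> h; rewrite h eqxx in ij.
    by move=> h; rewrite h eqxx in ik.
  have mg2 : measurable_fun setT (fun x => g x ^+ 2) by exact: measurable_funX.
  have i2 e : itg P (fun t => g (X e t) ^+ 2).
    apply: itg_le (itgD (itg_cst P 1) (i4 e)); first exact: (measurableT_comp mg2).
    move=> t; rewrite ger0_norm ?sqr_ge0//.
    have -> : g (X e t) ^+ 4 = (g (X e t) ^+ 2) ^+ 2 by ring.
    have := sqr_ge0 (g (X e t) ^+ 2 - 1); have := sqr_ge0 (g (X e t)); nra.
  have [_ h] := ex_coordM indep ab
    (depends_on_comp mg2 (@depends_on_coord _ _ _ _ _ X _ a (set11 a))) mg2 (i2 a) (i2 b).
  rewrite (@eq_ex _ _ _ _ _ (fun t => g (X a t) ^+ 2 * g (X b t) ^+ 2)); last by move=> t; ring.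
  rewrite h e2 (_ : ex P _ = s ^+ 2); last exact: e2.
  by rewrite -exprD.
Qed.

Lemma sum_delta (R : realType) (n : nat) (i : 'I_n) (F : 'I_n -> R) :
  \sum_j (j == i)%:R * F j = F i.
Proof.
rewrite (bigD1 i)//= eqxx mul1r big1 ?addr0// => j /negbTE ->.
by rewrite mul0r.
Qed.

Lemma sum_offdiag (R : realType) (n : nat) (i : 'I_n) (F : 'I_n -> R) :
  \sum_j F j = F i + \sum_j (i != j)%:R * F j.
Proof.
rewrite (bigD1 i)//= [in RHS](bigD1 i)//= eqxx mul0r add0r; congr (_ + _).
by apply: eq_bigr => j ji; rewrite eq_sym ji mul1r.
Qed.

Lemma sum_triples (R : realType) (n : nat) (C : 'I_n -> 'I_n -> 'I_n -> bool)
    (G : 'I_n -> 'I_n -> 'I_n -> R) :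
  \sum_(q in [pred q : 'I_n * 'I_n * 'I_n | C q.1.1 q.1.2 q.2]) G q.1.1 q.1.2 q.2 =
  \sum_i \sum_j \sum_k (C i j k)%:R * G i j k.
Proof.
rewrite big_mkcond /= (pair_bigA _ (fun i j => \sum_k (C i j k)%:R * G i j k)) /=.
rewrite (pair_bigA _ (fun (z : 'I_n * 'I_n) k => (C z.1 z.2 k)%:R * G z.1 z.2 k)) /=.
apply: eq_bigr => q _; rewrite inE /=; case: (C _ _ _); by rewrite ?mul1r ?mul0r.
Qed.

(** Moments of the quadratic functionals of a symmetric matrix [H] of independent centered
    entries of variance [s ^+ 2]. Each of them splits into closed paths [i - j - i], whose
    sums of squares concentrate, and open paths, which are uncorrelated. *)
Lemma edge_mx_quadratics d (T : measurableType d) (R : realType) (P : probability T R)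
    (n : nat) (X : upair n -> {RV P >-> R}) (g : R -> R)
    (s m4 : R) (H : T -> 'I_n -> 'I_n -> R) :
  mutually_independent X -> measurable_fun setT g ->
  (forall e, itg P (fun t => g (X e t) ^+ 4)) ->
  (forall e, ex P (fun t => g (X e t)) = 0) ->
  (forall e, ex P (fun t => g (X e t) ^+ 2) = s ^+ 2) ->
  (forall e, ex P (fun t => g (X e t) ^+ 4) <= m4) -> 0 <= m4 ->
  (forall t i j, H t i j = edge_mx (fun e => g (X e t)) i j) ->
  let M := 8 * n%:R ^+ 2 * (m4 + n%:R * s ^+ 4) in
  [/\ ex_le P (fun t => \sum_i rowsum (H t) i ^+ 4) M,
      ex_le P (fun t => \sum_i \sum_k (\sum_j H t i j * H t j k) ^+ 2) M,
      ex_le P (fun t => \sum_i mulfv (H t) (rowsum (H t)) i ^+ 2) M,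
      ex_le P (fun t => (\sum_i rowsum (H t) i) ^+ 2) (2 * s ^+ 2 * n%:R ^+ 2) &
      ex_le P (fun t => (\sum_i rowsum (H t) i ^+ 2 - n%:R * (n%:R - 1) * s ^+ 2) ^+ 2) M].
Proof.
move=> indep mg i4 e1 e2 e4 m40 HE M.
have mgX e : measurable_fun setT (fun t => g (X e t)) by exact: measurableT_comp.
have s40 : 0 <= s ^+ 4 by rewrite (_ : 4 = 2 * 2)%N// exprM sqr_ge0.
have s20 : 0 <= s ^+ 2 by exact: sqr_ge0.
have mg2 : measurable_fun setT (fun x => g x ^+ 2) by exact: measurable_funX.
have i2 e : itg P (fun t => g (X e t) ^+ 2).
  apply: itg_le (itgD (itg_cst P 1) (i4 e)); first exact: (measurableT_comp mg2).
  move=> t; rewrite ger0_norm ?sqr_ge0//.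
  have -> : g (X e t) ^+ 4 = (g (X e t) ^+ 2) ^+ 2 by ring.
  have := sqr_ge0 (g (X e t) ^+ 2 - 1); have := sqr_ge0 (g (X e t)); nra.
have mH i j : measurable_fun setT (fun t => H t i j).
  under eq_fun do rewrite HE /edge_mx.
  by case: (edge i j) => [e|] /=; [exact: mgX|exact: measurable_cst].
have mrow i : measurable_fun setT (fun t => rowsum (H t) i) by apply: measurable_sum => j.
have sH t i j : H t i j = H t j i by rewrite !HE edge_mx_sym.
(* the centered squares *)
pose q x := g x ^+ 2 - s ^+ 2.
have mq : measurable_fun setT q by apply: measurable_funB => //; exact: measurable_cst.
have q4E e : (fun t => q (X e t) ^+ 2) =
    (fun t => g (X e t) ^+ 4 + ((- (2 * s ^+ 2)) * g (X e t) ^+ 2 + s ^+ 4)).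
  by apply/funext => t; rewrite /q; ring.
have iq e : itg P (fun t => q (X e t) ^+ 2).
  by rewrite q4E; apply: itgD => //; apply: itgD; [exact: itgZ|exact: itg_cst].
have q1 e : ex P (fun t => q (X e t)) = 0.
  by rewrite exB//; [rewrite e2 ex_cst subrr|exact: itg_cst].
have q2 e : ex P (fun t => q (X e t) ^+ 2) <= m4.
  rewrite q4E exD//; last by apply: itgD; [exact: itgZ|exact: itg_cst].
  rewrite exD; [|exact: itgZ|exact: itg_cst].
  rewrite exZ// e2 ex_cst; have := e4 e.
  have -> : - (2 * s ^+ 2) * s ^+ 2 + s ^+ 4 = - s ^+ 4 by ring.
  by clear -s40; lra.
pose V t i j := edge_mx (fun e => q (X e t)) i j.
have HV t i j : H t i j ^+ 2 = V t i j + (i != j)%:R * s ^+ 2.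
  rewrite HE /V /edge_mx; have [->|ij] := eqVneq i j.
    by rewrite edge_diag /= mul0r addr0 expr0n.
  by have [e -> _] := edgeP ij; rewrite /= /q mul1r subrK.
pose D t i := \sum_j H t i j ^+ 2.
pose O C t := \sum_(q in [pred q : 'I_n * 'I_n * 'I_n | C q.1.1 q.1.2 q.2])
    edge_mx (fun e => g (X e t)) q.1.1 q.1.2 * edge_mx (fun e => g (X e t)) q.1.2 q.2.
have OE C t : O C t = \sum_i \sum_j \sum_k (C i j k)%:R * (H t i j * H t j k).
  rewrite -sum_triples; apply: eq_bigr => z _; by rewrite !HE.
have Ole (C : 'I_n -> 'I_n -> 'I_n -> bool) (c : R) : (forall i j k, C i j k -> i != k) ->
    #|[pred q : 'I_n * 'I_n * 'I_n | C q.1.1 q.1.2 q.2]|%:R <= c ->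
    ex_le P (fun t => O C t ^+ 2) (2 * s ^+ 4 * c).
  move=> Cne Cc; apply: two_paths_sqr_sum => // z; rewrite inE; exact: Cne.
have Dle i : ex_le P (fun t => D t i ^+ 2) (4 * n%:R * m4 + 2 * n%:R ^+ 2 * s ^+ 4).
  have := @edge_mx_sqr_sum _ _ _ P n X q m4 [pred z | z.1 == i] indep mq iq q1 q2 m40.
  have -> : #|[pred z : 'I_n * 'I_n | z.1 == i]|%:R = n%:R :> R.
    congr (_%:R); rewrite -[RHS]card_ord -(card_imset predT (_ : injective (fun j => (i, j)))); last by move=> ? ? [].
    apply: eq_card => z; rewrite inE; apply/eqP/imsetP => [zi|[j _ ->]] //=.
    by exists z.2 => //; rewrite -zi -surjective_pairing.
  have -> : (fun t => (\sum_(z in [pred z : 'I_n * 'I_n | z.1 == i]) edge_mx (fun e => q (X e t)) z.1 z.2) ^+ 2) =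
      (fun t => (\sum_j V t i j) ^+ 2).
    apply/funext => t; congr (_ ^+ 2).
    rewrite big_mkcond /= -(pair_bigA _ (fun a b => if a == i then V t a b else 0)) /=.
    rewrite -(sum_delta i (fun a => \sum_j V t a j)); apply: eq_bigr => a _.
    by case: (a == i); rewrite ?mul1r// mul0r big1.
  move=> Vle.
  have := ex_leD (ex_leZ (ler0n _ 2) Vle) (ex_le_cst P (2 * (n%:R * s ^+ 2) ^+ 2)).
  move=> /ex_le_dom; apply.
  - by apply: measurable_funX; apply: measurable_sum => j; exact: measurable_funX.
  - move=> t; rewrite sqr_ge0 /= /D.
    rewrite (eq_bigr (fun j => V t i j + (i != j)%:R * s ^+ 2)) ?big_split/=; last by move=> j _; exact: HV.
    set v := \sum_j V t i j; set w := \sum_j _ * _.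
    have w0 : 0 <= w by apply: sumr_ge0 => j _; exact: mulr_ge0.
    have w1 : w <= n%:R * s ^+ 2.
      rewrite mulr_natl -[n in _ *+ n]card_ord -sumr_const; apply: ler_sum => j _.
      by case: (i != j); rewrite ?mul1r ?mul0r.
    have w2 : w ^+ 2 <= (n%:R * s ^+ 2) ^+ 2 by rewrite lerXn2r// nnegrE// (le_trans w0).
    by move: w2; have := sqr_ge0 (v - w); clear; nra.
  - by rewrite le_eqVlt; apply/orP; left; apply/eqP; ring.
have nn0 : 0 <= (n%:R : R) by exact: ler0n.
have n0 : 0 <= (n%:R : R) ^+ 2 by exact: sqr_ge0.
have nm := mulr_ge0 nn0 m40; have ns := mulr_ge0 n0 s40.
have sqD (x y : R) : 0 <= (x + y) ^+ 2 <= 2 * x ^+ 2 + 2 * y ^+ 2.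
  by rewrite sqr_ge0 /=; have := sqr_ge0 (x - y); nra.
have mO C : measurable_fun setT (O C).
  have -> : O C = fun t => \sum_i \sum_j \sum_k (C i j k)%:R * (H t i j * H t j k).
    by apply/funext => t; exact: OE.
  apply: measurable_sum => i; apply: measurable_sum => j; apply: measurable_sum => k.
  by apply: measurable_funM; [exact: measurable_cst|exact: measurable_funM].
have mD i : measurable_fun setT (D ^~ i).
  by apply: measurable_sum => j; exact: measurable_funX.
have DO i (C : 'I_n -> 'I_n -> 'I_n -> bool) : (forall i j k, C i j k -> i != k) ->
    #|[pred q : 'I_n * 'I_n * 'I_n | C q.1.1 q.1.2 q.2]|%:R <= n%:R ^+ 2 :> R ->
    ex_le P (fun t => (D t i + O C t) ^+ 2) (8 * n%:R * m4 + 8 * n%:R ^+ 2 * s ^+ 4).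
  move=> Cne Cc; have := ex_leD (ex_leZ (ler0n _ 2) (Dle i)) (ex_leZ (ler0n _ 2) (Ole C _ Cne Cc)).
  move=> /ex_le_dom; apply; last by clear -nm ns; nra.
    by apply: measurable_funX; exact: measurable_funD.
  by move=> t; exact: sqD.
have card_pairs (f : 'I_n * 'I_n -> 'I_n * 'I_n * 'I_n) (S : {pred 'I_n * 'I_n * 'I_n}) :
    (forall z, z \in S -> exists y, z = f y) -> #|S|%:R <= n%:R ^+ 2 :> R.
  move=> Sf; rewrite -natrX ler_nat (leq_trans _ (_ : #|{: 'I_n * 'I_n}| <= _)%N)//; last first.
    by rewrite card_prod card_ord mulnn.
  rewrite -(size_codom f); apply: leq_trans (card_size _).
  by apply: fintype.subset_leq_card; apply/fintype.subsetP => z /Sf[y ->]; exact: codom_f.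
have nM : n%:R * (8 * n%:R * m4 + 8 * n%:R ^+ 2 * s ^+ 4) <= M.
  by rewrite le_eqVlt; apply/orP; left; apply/eqP; rewrite /M; ring.
split.
- apply: (ex_le_sum nM) => i.
  pose C (a b c : 'I_n) := (b == i) && (a != c).
  have -> : (fun t => rowsum (H t) i ^+ 4) = (fun t => (D t i + O C t) ^+ 2).
    apply/funext => t; rewrite (_ : 4 = 2 * 2)%N// exprM; congr (_ ^+ 2).
    rewrite OE [X in _ + X](_ : _ = \sum_a \sum_c (a != c)%:R * (H t i a * H t i c)); last first.
      apply: eq_bigr => a _; rewrite exchange_big /=; apply: eq_bigr => c _.
      rewrite -(sum_delta i (fun b => (a != c)%:R * (H t b a * H t b c))).
      by apply: eq_bigr => b _; rewrite /C -mulnb natrM (sH t a b); ring.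
    rewrite expr2 {1}/rowsum mulr_suml /D -big_split /=; apply: eq_bigr => a _.
    rewrite /rowsum (sum_offdiag a) mulrDr mulr_sumr; congr (_ + _).
    by apply: eq_bigr => c _; ring.
  apply: DO => [a b c /andP[_ //]|].
  apply: (card_pairs (fun y => (y.1, i, y.2))) => [[[a b] c]]; rewrite inE /C /= => /andP[/eqP -> _].
  by exists (a, c).
- have : ex_le P (fun t => \sum_i (D t i ^+ 2 +
      \sum_k (O (fun a b c => [&& a == i, c == k & a != c]) t) ^+ 2)) M.
    apply: (@ex_le_sum _ _ _ _ _ _ ((4 * n%:R * m4 + 2 * n%:R ^+ 2 * s ^+ 4) + 2 * s ^+ 4 * n%:R ^+ 2)).
      have h1 : 0 <= n%:R * (n%:R * m4) by exact: mulr_ge0.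
      have h2 : 0 <= n%:R * (n%:R ^+ 2 * s ^+ 4) by exact: mulr_ge0.
      by rewrite /M; clear -h1 h2; nra.
    move=> i; apply: ex_leD => //.
    apply: (@ex_le_sum _ _ _ _ _ _ (2 * s ^+ 4 * n%:R)) => [|k].
      by rewrite le_eqVlt; apply/orP; left; apply/eqP; ring.
    apply: Ole => [a b c /and3P[]//|].
    rewrite ler_nat -[leqRHS]card_ord.
    rewrite -(size_codom (fun j => (i, j, k))); apply: leq_trans (card_size _).
    apply: fintype.subset_leq_card; apply/fintype.subsetP => -[[a b] c]; rewrite inE /= => /and3P[/eqP -> /eqP -> _].
    exact: codom_f.
  congr (ex_le _ _ _); apply/funext => t; apply: eq_bigr => i _.
  rewrite [in RHS](sum_offdiag i); congr (_ + _).
    by congr (_ ^+ 2); apply: eq_bigr => j _; rewrite (sH t j i) expr2.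
  apply: eq_bigr => k _; rewrite OE.
  rewrite (_ : \sum_a _ = (i != k)%:R * \sum_j H t i j * H t j k).
    by case: (i != k); rewrite ?mul1r// !mul0r expr0n.
  rewrite -(sum_delta i (fun a => (a != k)%:R * \sum_j H t a j * H t j k)).
  apply: eq_bigr => a _; rewrite mulrA mulr_sumr; apply: eq_bigr => j _.
  rewrite -(sum_delta k (fun c => ((a == i)%:R * (a != c)%:R) * (H t a j * H t j c))).
  by apply: eq_bigr => c _; rewrite -!mulnb !natrM; ring.
- apply: (ex_le_sum nM) => i.
  pose C (a b c : 'I_n) := (a == i) && (a != c).
  have -> : (fun t => mulfv (H t) (rowsum (H t)) i ^+ 2) = (fun t => (D t i + O C t) ^+ 2).
    apply/funext => t; congr (_ ^+ 2).
    rewrite OE [X in _ + X](_ : _ = \sum_b \sum_c (i != c)%:R * (H t i b * H t b c)); last first.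
      rewrite -(sum_delta i (fun a => \sum_b \sum_c (a != c)%:R * (H t a b * H t b c))).
      apply: eq_bigr => a _; rewrite mulr_sumr; apply: eq_bigr => b _.
      rewrite mulr_sumr; apply: eq_bigr => c _.
      by rewrite /C -mulnb natrM; ring.
    rewrite /mulfv /D -big_split /=; apply: eq_bigr => b _.
    rewrite /rowsum mulr_sumr (sum_offdiag i); congr (_ + _).
    by rewrite (sH t b i) expr2.
  apply: DO => [a b c /andP[_ //]|].
  apply: (card_pairs (fun y => (i, y.1, y.2))) => [[[a b] c]]; rewrite inE /C /= => /andP[/eqP -> _].
  by exists (b, c).
- have := @edge_mx_sqr_sum _ _ _ P n X g (s ^+ 2) predT indep mg i2 e1 _ s20.
  have -> : #|{: 'I_n * 'I_n}|%:R = n%:R ^+ 2 :> R by rewrite card_prod card_ord -natrX mulnn.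
  have e2' e : ex P (fun t => g (X e t) ^+ 2) <= s ^+ 2 by rewrite e2.
  move=> /(_ e2'); congr (ex_le _ _ _); apply/funext => t; congr (_ ^+ 2).
  rewrite -(pair_bigA _ (fun a b => edge_mx (fun e => g (X e t)) a b)) /=.
  by apply: eq_bigr => i _; apply: eq_bigr => j _; rewrite HE.
- pose C (a b c : 'I_n) := a != c.
  have h1 := @edge_mx_sqr_sum _ _ _ P n X q m4 predT indep mq iq q1 q2 m40.
  have h2 : ex_le P (fun t => O C t ^+ 2) (2 * s ^+ 4 * n%:R ^+ 3).
    apply: Ole => //; rewrite -natrX ler_nat; apply: (leq_trans (max_card _)).
    by rewrite !card_prod !card_ord -mulnA.
  rewrite (_ : #|{: 'I_n * 'I_n}|%:R = n%:R ^+ 2 :> R) in h1; last first.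
    by rewrite card_prod card_ord -natrX mulnn.
  have := ex_leD (ex_leZ (ler0n _ 2) h1) (ex_leZ (ler0n _ 2) h2).
  move=> /ex_le_dom; apply.
  + apply: measurable_funX; apply: measurable_funB; last exact: measurable_cst.
    by apply: measurable_sum => i; exact: measurable_funX.
  + move=> t; rewrite (_ : \sum_i rowsum (H t) i ^+ 2 - _ =
        \sum_(z : 'I_n * 'I_n) edge_mx (fun e => q (X e t)) z.1 z.2 + O C t); first exact: sqD.
    rewrite -(pair_bigA _ (fun i j => edge_mx (fun e => q (X e t)) i j)) /=.
    have row2 i : rowsum (H t) i ^+ 2 = D t i + \sum_a \sum_c (a != c)%:R * (H t i a * H t i c).
      rewrite expr2 {1}/rowsum mulr_suml /D -big_split /=; apply: eq_bigr => a _.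
      rewrite /rowsum (sum_offdiag a) mulrDr mulr_sumr; congr (_ + _).
      by apply: eq_bigr => c _; ring.
    have -> : \sum_i rowsum (H t) i ^+ 2 = \sum_i D t i + O C t.
      rewrite (eq_bigr _ (fun i _ => row2 i)) big_split /= OE; congr (_ + _).
      rewrite exchange_big /=; apply: eq_bigr => a _; apply: eq_bigr => b _.
      by apply: eq_bigr => c _; rewrite /C (sH t a b).
    have -> : \sum_i D t i = \sum_i \sum_j V t i j + n%:R * (n%:R - 1) * s ^+ 2.
      have -> : n%:R * (n%:R - 1) * s ^+ 2 = \sum_(i < n) \sum_(j < n) (i != j)%:R * s ^+ 2.
        rewrite (eq_bigr (fun=> (n%:R - 1) * s ^+ 2)); last first.
          move=> i _; have := sum_offdiag i (fun=> s ^+ 2).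
          rewrite sumr_const card_ord => h; apply: (addrI (s ^+ 2)).
          by rewrite -h -(mulr_natl (s ^+ 2) n); ring.
        by rewrite sumr_const card_ord -(mulr_natl ((n%:R - 1) * s ^+ 2) n) mulrA.
      rewrite -big_split /=; apply: eq_bigr => i _; rewrite -big_split /=.
      by apply: eq_bigr => j _; exact: HV.
    by rewrite /V; ring.
  + have h3 : 0 <= n%:R ^+ 2 * m4 by exact: mulr_ge0.
    have h4 : 0 <= n%:R ^+ 3 * s ^+ 4 by apply: mulr_ge0 => //; exact: exprn_ge0.
    by rewrite /M; clear -h3 h4; nra.
Qed.

(** * Measurability of the operator norm *)

Lemma lpnorm_ge0 (R : realType) (n : nat) (q : R) (x : 'cV[R]_n) : 0 <= lpnorm q x.
Proof. exact: powR_ge0. Qed.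

Lemma lpnormZ (R : realType) (n : nat) (q k : R) (x : 'cV[R]_n) : 0 < q -> 0 <= k ->
  lpnorm q (k *: x) = k * lpnorm q x.
Proof.
move=> q0 k0; rewrite /lpnorm (eq_bigr (fun i => k `^ q * `|x i ord0| `^ q)); last first.
  by move=> i _; rewrite mxE normrM (ger0_norm k0) powRM.
rewrite -mulr_sumr powRM ?powR_ge0//; last by apply: sumr_ge0 => i _; exact: powR_ge0.
by rewrite -powRrM mulfV ?gt_eqF// powRr1.
Qed.

(** Unit vectors have entries at most [1], so the values are bounded and the supremum is
    genuine. *)
Lemma opnorm_has_sup (R : realType) (n : nat) (r p : R) (A : 'M[R]_n) : 0 < r -> 0 < p ->
  has_sup [set lpnorm p (A *m x) | x in [set x : 'cV[R]_n | lpnorm r x <= 1]].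
Proof.
move=> r0 p0; split.
  exists (lpnorm p (A *m 0)), 0 => //=; apply/(le_lpnorm _ r0 ler01).
  rewrite big1 ?powR_ge0// => i _; by rewrite mxE normr0 powR0// gt_eqF.
exists ((\sum_i (\sum_j `|A i j|) `^ p) `^ p^-1) => _ [x /= hx <-].
have x1 j : `|x j ord0| <= 1.
  move/(le_lpnorm _ r0 ler01) : hx; rewrite powR1 (bigD1 j)//= => hx.
  rewrite leNgt; apply/negP => xj.
  have : 1 < `|x j ord0| `^ r 
      by have := @gt0_ltr_powR _ r r0 1 `|x j ord0|; rewrite !nnegrE powR1; apply.
  apply/negP; rewrite -leNgt; apply: (le_trans _ hx); rewrite lerDl.
  by apply: sumr_ge0 => i _; exact: powR_ge0.
have s0 : 0 <= \sum_i (\sum_j `|A i j|) `^ p by apply: sumr_ge0 => i _; exact: powR_ge0.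
apply/(le_lpnorm _ p0 (powR_ge0 _ _)); rewrite -powRrM mulVf ?gt_eqF// powRr1//.
apply: ler_sum => i _; apply: ge0_ler_powR; rewrite ?nnegrE ?sumr_ge0//; first exact: ltW.
rewrite mxE; apply: (le_trans (ler_norm_sum _ _ _)); apply: ler_sum => j _.
by rewrite normrM ler_piMr.
Qed.

Lemma lpnorm_le_opnorm (R : realType) (n : nat) (r p : R) (A : 'M[R]_n) (x : 'cV[R]_n) :
  0 < r -> 0 < p -> lpnorm r x <= 1 -> lpnorm p (A *m x) <= opnorm r p A.
Proof.
move=> r0 p0 hx; apply: ub_le_sup; last by exists x.
by have [] := opnorm_has_sup A r0 p0.
Qed.

Lemma opnormZ (R : realType) (n : nat) (r p k : R) (A : 'M[R]_n) : 0 < r -> 0 < p -> 0 < k ->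
  opnorm r p (k *: A) = k * opnorm r p A.
Proof.
move=> r0 p0.
have half (B : 'M[R]_n) (c : R) : 0 < c -> opnorm r p (c *: B) <= c * opnorm r p B.
  move=> c0; have [[y hy] _] := opnorm_has_sup (c *: B) r0 p0.
  apply: ge_sup; first by exists y.
  move=> _ [x /= hx <-]; rewrite -scalemxAl lpnormZ ?(ltW c0)//.
  by apply: ler_wpM2l; [exact: ltW|exact: lpnorm_le_opnorm].
move=> k0; apply: le_anti; rewrite half//= -ler_pdivlMl// -[X in opnorm r p X <= _]scale1r.
have kE : 1 = k^-1 * k by rewrite mulVf// gt_eqF.
by rewrite [in leLHS]kE -scalerA half// invr_gt0.
Qed.

Lemma continuous_norm_powR (R : realType) (p : R) : 1 <= p ->
  continuous (fun z : R => `|z| `^ p).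
Proof.
move=> p1 z; have [->|z0] := eqVneq z 0.
  rewrite /continuous_at normr0 powR0; last by rewrite gt_eqF//; lra.
  apply: (@squeeze_cvgr _ _ _ _ (fun=> 0) (fun z : R => `|z|)); last 1 first.
  - by rewrite -[X in _ --> X](@normr0 R R); exact: norm_continuous.
  - have h : \forall z \near nbhs (0 : R), `|z| < 1.
      by have := @nbhs0_lt R R 1 ltr01.
    apply: filterS h => y y1; rewrite powR_ge0 /=.
    have [->|y0] := eqVneq y 0; first by rewrite normr0 powR0// gt_eqF//; lra.
    by rewrite -[leRHS]powRr1// ger_powR// normr_gt0 y0 ltW.
  - exact: cvg_cst.
have z0' : 0 < `|z| by rewrite normr_gt0.
have /(@ex_derive _ _ _ _ _ _ _) h := is_derive1_powR p z0'.
have c : {for `|z|, continuous (fun y : R => y `^ p)}.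
  by apply: differentiable_continuous; apply/derivable1_diffP.
by apply: (@continuous_comp _ _ _ (fun y : R => `|y|) (fun y => y `^ p)) => //; exact: norm_continuous.
Qed.

(** Rounding towards zero keeps vectors inside the unit ball, so that the ball can be
    exhausted by rational vectors. *)
Definition round0 (R : realType) (k : nat) (z : R) : R :=
  Num.sg z * ((Num.floor (k.+1%:R * `|z|))%:~R / k.+1%:R).

Lemma round0_le (R : realType) (k : nat) (z : R) : `|round0 k z| <= `|z|.
Proof.
have k0 : 0 < k.+1%:R :> R by rewrite ltr0n.
have f0 : 0 <= (Num.floor (k.+1%:R * `|z|))%:~R :> R.
  by rewrite ler0z floor_ge0 mulr_ge0.
rewrite /round0 normrM (ger0_norm (_ : 0 <= _ / _)) ?divr_ge0//.
rewrite normr_sg; case: eqVneq => [->|z0] /=; first by rewrite mul0r.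
by rewrite mul1r ler_pdivrMr// [leRHS]mulrC floor_le.
Qed.

Lemma round0_dist (R : realType) (k : nat) (z : R) : `|z - round0 k z| <= k.+1%:R^-1.
Proof.
have k0 : 0 < k.+1%:R :> R by rewrite ltr0n.
rewrite {1}[z]numEsg /round0 -mulrBr normrM normr_sg.
case: eqVneq => [->|z0] /=; first by rewrite mul0r invr_ge0.
rewrite mul1r ger0_norm.
  rewrite lerBlDr [leRHS](_ : _ = (1 + (Num.floor (k.+1%:R * `|z|))%:~R) / k.+1%:R); last first.
    by rewrite mulrDl mul1r.
  rewrite ler_pdivlMr// [leLHS]mulrC.
  by have /ltW := floorD1_gt (k.+1%:R * `|z|); rewrite intrD addrC.
by rewrite subr_ge0 ler_pdivrMr// [leRHS]mulrC floor_le.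
Qed.

(** By continuity the norm exceeds a level precisely if the value at some rational vector of
    the unit ball does. *)
Lemma measurable_opnorm d (T : measurableType d) (R : realType) (n : nat) (r p : R)
    (A : T -> 'I_n -> 'I_n -> R) : 0 < r -> 1 <= p ->
  (forall i j, measurable_fun setT (fun t => A t i j)) ->
  measurable_fun setT (fun t => opnorm r p (\matrix_(i, j) A t i j)).
Proof.
move=> r0 p1 mA mT.
have p0 : 0 < p by lra.
have val (x : 'cV[R]_n) t : lpnorm p (\matrix_(i, j) A t i j *m x) =
    (\sum_i `|\sum_j A t i j * x j ord0| `^ p) `^ p^-1.
  by congr (_ `^ _); apply: eq_bigr => i _; rewrite mxE; under eq_bigr do rewrite mxE.
have mval (x : 'cV[R]_n) : measurable_fun setT (fun t => lpnorm p (\matrix_(i, j) A t i j *m x)).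
  under eq_fun do rewrite val.
  apply: (measurableT_comp (measurable_powR _)); apply: measurable_sum => i.
  apply: (measurableT_comp (measurable_powR _)); apply: (measurableT_comp (@normr_measurable _ _)).
  by apply: measurable_sum => j; apply: measurable_funM => //; exact: measurable_cst.
pose vec (w : nat * {ffun 'I_n -> int}) : 'cV[R]_n := \col_i ((w.2 i)%:~R / w.1.+1%:R).
apply: (measurability _ (RGenOInfty.measurableE R)) => //.
move=> /= _ [_ [y ->] <-]; rewrite setTI.
rewrite (_ : _ @^-1` _ = \bigcup_w [set t | lpnorm r (vec w) <= 1 /\
    y < lpnorm p (\matrix_(i, j) A t i j *m vec w)]).
  apply: countable_bigcupT_measurable => // w.
  have [h|h] := boolP (lpnorm r (vec w) <= 1).
    rewrite (_ : [set t | _] = setT `&` (fun t => lpnorm p (\matrix_(i, j) A t i j *m vec w)) @^-1` `]y, +oo[%classic).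
      exact: mval.
    by rewrite setTI; apply/seteqP; split => t /=; rewrite in_itv /= andbT => // -[].
  rewrite (_ : [set t | _] = set0) ?measurable0//.
  by apply/seteqP; split => t // -[].
apply/seteqP; split => t; rewrite /= ?in_itv /= ?andbT; last first.
  case=> w _ [w1 w2]; exact: lt_le_trans w2 (lpnorm_le_opnorm _ r0 p0 w1).
move=> /(sup_gt (proj1 (opnorm_has_sup _ r0 p0)))[_ [x /= hx <-] yx].
pose q k : 'cV[R]_n := \col_i round0 k (x i ord0).
have qball k : lpnorm r (q k) <= 1.
  move: hx => /(le_lpnorm _ r0 ler01) hx; apply/(le_lpnorm _ r0 ler01); apply: (le_trans _ hx).
  apply: ler_sum => i _; rewrite mxE; apply: ge0_ler_powR; rewrite ?nnegrE ?(ltW r0)//.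
  exact: round0_le.
have [k yk] : exists k, y < lpnorm p (\matrix_(i, j) A t i j *m q k).
  have [y0|y0] := ltP y 0; first by exists 0%N; exact: lt_le_trans y0 (lpnorm_ge0 _ _).
  pose f (x : 'cV[R]_n) := \sum_i `|\sum_j A t i j * x j ord0| `^ p.
  have lt_f (z : 'cV[R]_n) : y < lpnorm p (\matrix_(i, j) A t i j *m z) <-> y `^ p < f z.
    have := le_lpnorm (\matrix_(i, j) A t i j *m z) p0 y0.
    have -> : \sum_(i < n) `|(\matrix_(i, j) A t i j *m z) i ord0| `^ p = f z.
      by apply: eq_bigr => i _; rewrite mxE; under eq_bigr do rewrite mxE.
    by move=> [h1 h2]; split => h; rewrite ltNge; apply/negP => h'; move: h; rewrite ltNge => /negP; apply; [exact: h2|exact: h1].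
  have qx j : (fun k => q k j ord0) @ \oo --> x j ord0.
    apply/cvgrPdist_le => e e0; have := @cvgr_dist_lt _ _ _ _ _ _ _ (@cvg_harmonic R) e e0 => /(_ _) h.
    apply: filterS h => k; rewrite sub0r normrN /= => hk; rewrite mxE.
    by apply: (le_trans (round0_dist _ _)); apply: (le_trans (ler_norm _)); exact: ltW.
  have fq : (fun k => f (q k)) @ \oo --> f x.
    apply: cvg_big; first exact: add_continuous.
    move=> i _; have lin : (fun k => \sum_j A t i j * q k j ord0) @ \oo -->
        \sum_j A t i j * x j ord0.
      apply: cvg_big; first exact: add_continuous.
      by move=> j _; apply: cvgM; [exact: cvg_cst|exact: qx].
    have c := @continuous_norm_powR R p p1 (\sum_j A t i j * x j ord0).
    by have := @cvg_comp _ _ _ _ _ _ _ _ lin c.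
  move/lt_f : yx => yx; have [k _ hk] := cvgr_gt _ fq _ yx.
  by exists k; apply/lt_f; apply: hk => /=.
pose w := (k, [ffun i => sgz (x i ord0) * Num.floor (k.+1%:R * `|x i ord0|)] : {ffun 'I_n -> int}).
have wq : vec w = q k.
  by apply/matrixP => i j; rewrite !mxE /= ffunE /round0 mulrA intrM -sgrEz.
by exists w; [exact: I|rewrite /= wq; split; [exact: qball|exact: yk]].
Qed.

(** * Moments of the entries *)

Lemma law_integral d (T : measurableType d) (R : realType) (P : probability T R)
    (F : probability (measurableTypeR R) R) (X : {RV P >-> R}) (h : R -> \bar R) :
  (forall B, measurable B -> distribution P X B = F B) -> measurable_fun setT h ->
  (forall x, 0 <= h x)%E -> (\int[P]_t h (X t) = \int[F]_x h x)%E.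
Proof.
move=> XF mh h0.
(* [F] lives on a copy of the real line, from which the identity transports it *)
have mid : measurable_fun [set: measurableTypeR R] (fun x : measurableTypeR R => x : R) by [].
pose Y : {RV F >-> R} := HB.pack (fun x : measurableTypeR R => x : R)
  (isMeasurableFun.Build _ _ _ _ _ mid).
rewrite -(@ge0_integral_distribution _ _ _ _ R P X h)//.
rewrite -[RHS](@ge0_integral_distribution _ _ _ _ R F Y h)//.
by apply: eq_measure_integral => B mB _; exact: XF.
Qed.

Lemma law_ex d (T : measurableType d) (R : realType) (P : probability T R)
    (F : probability (measurableTypeR R) R) (X : {RV P >-> R}) (h : R -> R) :
  (forall B, measurable B -> distribution P X B = F B) -> measurable_fun setT h ->
  itg F h -> itg P (fun t => h (X t)) /\ ex P (fun t => h (X t)) = ex F h.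
Proof.
move=> XF mh ih.
have mabs : measurable_fun setT (fun x : R => `|h x|%:E).
  by apply/measurable_EFinP; apply: measurableT_comp => //; exact: normr_measurable.
have i : itg P (fun t => h (X t)).
  apply/integrableP; split; first by apply/measurable_EFinP; exact: measurableT_comp.
  have := law_integral XF mabs (fun x => _).
  move=> -> //; by move/integrableP : ih => [].
split=> //; apply/EFin_inj; rewrite exE// exE//.
have mid : measurable_fun [set: measurableTypeR R] (fun x : measurableTypeR R => x : R) by [].
pose Y : {RV F >-> R} := HB.pack (fun x : measurableTypeR R => x : R)
  (isMeasurableFun.Build _ _ _ _ _ mid).
have mhE : measurable_fun setT (EFin \o h) by exact/measurable_EFinP.
rewrite -[LHS](@integral_distribution _ _ _ _ R P X (EFin \o h))//.
rewrite -[RHS](@integral_distribution _ _ _ _ R F Y (EFin \o h))//.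
by apply: eq_measure_integral => B mB _; exact: XF.
Qed.

Lemma entry_moments d (T : measurableType d) (R : realType) (P : probability T R)
    (F : probability (measurableTypeR R) R) (X : {RV P >-> R}) :
  (forall B, measurable B -> distribution P X B = F B) ->
  F.-integrable setT (EFin \o id) -> ('V_F[id] < +oo)%E ->
  ex P (fun t => X t - law_mean F) = 0 /\
  ex P (fun t => (X t - law_mean F) ^+ 2) = law_sd F ^+ 2.
Proof.
move=> XF iF VF; set mu := law_mean F.
have i1 : itg F (fun x => x - mu) by apply: itgD => //; exact: itg_cst.
have m1 : measurable_fun setT (fun x : R => x - mu).
  by apply: measurable_funB => //; exact: measurable_cst.
have m2 : measurable_fun setT (fun x : R => (x - mu) ^+ 2) by exact: measurable_funX.
have VE : 'V_F[id] = (\int[F]_x ((x - mu) ^+ 2)%:E)%E.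
  rewrite /variance unlock expectation.unlock; apply: eq_integral => x _.
  by rewrite /= /mu /law_mean expectation.unlock expr2.
have i2 : itg F (fun x => (x - mu) ^+ 2).
  apply/integrableP; split; first exact/measurable_EFinP.
  rewrite (_ : (\int[F]_x _)%E = 'V_F[id])// VE; apply: eq_integral => x _.
  by rewrite /= ger0_norm// sqr_ge0.
have [_ ->] := law_ex XF m1 i1; have [_ ->] := law_ex XF m2 i2; split.
  rewrite (exB _ (itg_cst F mu))// ex_cst.
  by rewrite (_ : ex F id = mu) ?subrr// /mu /law_mean unlock.
rewrite /law_sd VE sqr_sqrtr//.
by rewrite fine_ge0// integral_ge0// => x _; rewrite lee_fin sqr_ge0.
Qed.

Lemma entry_moment_le d (T : measurableType d) (R : realType) (P : probability T R)
    (F : probability (measurableTypeR R) R) (X Y : {RV P >-> R}) (mu b : R) (k : nat) :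
  (forall B, measurable B -> distribution P X B = F B) ->
  (forall B, measurable B -> distribution P Y B = F B) ->
  ('E_P[(fun t => `|Y t - mu| ^+ k)%R] <= b%:E)%E ->
  ex_le P (fun t => `|X t - mu| ^+ k) b.
Proof.
move=> XF YF; rewrite unlock => Yb.
have mh : measurable_fun setT (fun x : R => `|x - mu| ^+ k).
  apply: measurable_funX; apply: measurableT_comp; first exact: normr_measurable.
  by apply: measurable_funB => //; exact: measurable_cst.
have mhE : measurable_fun setT (fun x : R => (`|x - mu| ^+ k)%:E) by exact/measurable_EFinP.
have h0 x : (0 <= (`|x - mu| ^+ k)%:E)%E by rewrite lee_fin exprn_ge0.
have FXY : (\int[P]_t (`|X t - mu| ^+ k)%:E = \int[P]_t (`|Y t - mu| ^+ k)%:E)%E.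
  by rewrite (law_integral XF mhE h0) (law_integral YF mhE h0).
have i : itg P (fun t => `|X t - mu| ^+ k).
  apply/integrableP; split; first by apply/measurable_EFinP; exact: measurableT_comp mh _.
  apply: (le_lt_trans _ (ltry b)); apply: (le_trans _ Yb).
  rewrite -FXY le_eqVlt; apply/orP; left; apply/eqP; apply: eq_integral => t _.
  by rewrite /= ger0_norm ?exprn_ge0.
by split => //; rewrite -lee_fin exE// FXY.
Qed.

(** * The operator norm is close to the sum of the entries *)

Lemma ex_le_indic0 d (T : measurableType d) (R : realType) (P : probability T R)
    (A : set T) : measurable A -> P A = 0%E -> ex_le P (\1_A : T -> R) 0.
Proof.
move=> mA PA.
have i : itg P (\1_A : T -> R).
  apply: (@itg_bounded _ _ _ _ 1) => [|t]; first exact: measurable_indic.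
  by rewrite indicE normr_nat; case: (_ \in _) => //=; rewrite ler01.
split => //; rewrite le_eqVlt; apply/orP; left; apply/eqP/EFin_inj.
by rewrite exE//= integral_indic// setIT.
Qed.

Lemma ex_le_sum0 d (T : measurableType d) (R : realType) (P : probability T R)
    (I : finType) (f : I -> T -> R) :
  (forall i, ex_le P (f i) 0) -> ex_le P (fun t => \sum_i f i t) 0.
Proof.
move=> fa; split; first by apply: itg_sum => i _; case: (fa i).
rewrite ex_sum; last by move=> i _; case: (fa i).
by apply: sumr_le0 => i _; case: (fa i).
Qed.

Lemma sqrt_pairs_near (R : realType) (x : R) : 1 < x ->
  `|x^-1 - (Num.sqrt (x * (x - 1)))^-1| <= (x * (x - 1))^-1.
Proof.
move=> x1; have x0 : 0 < x by lra.
have y0 : 0 < x - 1 by lra.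
have xy0 : 0 < x * (x - 1) by exact: mulr_gt0.
have s0 : 0 < Num.sqrt (x * (x - 1)) by rewrite sqrtr_gt0.
have sx : Num.sqrt (x * (x - 1)) <= x.
  rewrite -[leRHS]gtr0_norm// -sqrtr_sqr ler_sqrt ?sqr_ge0//.
  by rewrite expr2; apply: ler_wpM2l; [exact: ltW|lra].
have ys : x - 1 <= Num.sqrt (x * (x - 1)).
  rewrite -[leLHS]gtr0_norm// -sqrtr_sqr ler_sqrt ?(ltW xy0)//.
  by rewrite expr2; apply: ler_wpM2r; [exact: ltW|lra].
have h1 : x^-1 <= (Num.sqrt (x * (x - 1)))^-1 by rewrite lef_pV2 ?posrE.
have h2 : (Num.sqrt (x * (x - 1)))^-1 <= (x - 1)^-1 by rewrite lef_pV2 ?posrE.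
have h3 : (x * (x - 1))^-1 = (x - 1)^-1 - x^-1 by field; rewrite !gt_eqF.
by rewrite h3 ler_norml; move: h1 h2; clear; lra.
Qed.

(** Markov's inequality for the events of [opnorm_near_sum]: up to constants the
    thresholds exceed the expectations by the factor [L ^+ 2], because [t ^+ 2] was chosen
    [L ^+ 2] times larger than the typical size of the squared row sums. *)
Lemma noise_budget (R : realType) (n mu s K L t M : R) :
  1 <= n -> 0 < mu -> 0 < s -> 0 <= K -> 1 <= L -> 1 <= n * mu ^+ 2 ->
  t ^+ 2 = L ^+ 2 * (s ^+ 2 / (n * mu ^+ 2) + n^-1) ->
  M = 8 * n ^+ 2 * (K * s ^+ 2 + n * s ^+ 4) ->
  [/\ 0 < n ^+ 5 * mu ^+ 4 * t ^+ 4, 0 < n ^+ 4 * mu ^+ 2 * t ^+ 4,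
      0 < M, M / (n ^+ 5 * mu ^+ 4 * t ^+ 4) <= (8 + 4 * K) / L ^+ 2 &
      2 * s ^+ 2 * n ^+ 2 / (n ^+ 4 * mu ^+ 2 * t ^+ 4) <= 1 / L ^+ 2].
Proof.
move=> n1 mu0 s0 K0 L1 nm tE ME.
have n0 : 0 < n by lra.
have L0 : 0 < L by lra.
have s20 : 0 < s ^+ 2 by exact: exprn_gt0.
have mu20 : 0 < mu ^+ 2 by exact: exprn_gt0.
have L20 : 0 < L ^+ 2 by exact: exprn_gt0.
have L21 : 1 <= L ^+ 2 by rewrite exprn_ege1.
have L4 : L ^+ 4 = L ^+ 2 * L ^+ 2 by ring.
have t4 : t ^+ 4 = L ^+ 4 * (s ^+ 2 + mu ^+ 2) ^+ 2 / (n ^+ 2 * mu ^+ 4).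
  have -> : t ^+ 4 = (t ^+ 2) ^+ 2 by ring.
  by rewrite tE; field; rewrite !gt_eqF.
have c1E : n ^+ 5 * mu ^+ 4 * t ^+ 4 = L ^+ 4 * (n ^+ 3 * (s ^+ 2 + mu ^+ 2) ^+ 2).
  by rewrite t4; field; rewrite !gt_eqF.
have c2E : n ^+ 4 * mu ^+ 2 * t ^+ 4 = L ^+ 4 * (n ^+ 2 * ((s ^+ 2 + mu ^+ 2) ^+ 2 / mu ^+ 2)).
  by rewrite t4; field; rewrite !gt_eqF.
have sm0 : 0 < (s ^+ 2 + mu ^+ 2) ^+ 2 by rewrite exprn_gt0// addr_gt0.
have L40 : 0 < L ^+ 4 by exact: exprn_gt0.
have c10 : 0 < n ^+ 5 * mu ^+ 4 * t ^+ 4.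
  by rewrite c1E; apply: mulr_gt0 => //; apply: mulr_gt0 => //; exact: exprn_gt0.
have c20 : 0 < n ^+ 4 * mu ^+ 2 * t ^+ 4.
  rewrite c2E; apply: mulr_gt0 => //; apply: mulr_gt0; first exact: exprn_gt0.
  exact: divr_gt0.
have s40 : 0 < s ^+ 4 by exact: exprn_gt0.
split => //.
- rewrite ME; apply: mulr_gt0; first by rewrite mulr_gt0// exprn_gt0.
  by apply: ltr_wpDl; [exact: mulr_ge0 K0 (ltW s20)|exact: mulr_gt0].
- rewrite ler_pdivrMr// c1E L4.
  have -> : (8 + 4 * K) / L ^+ 2 * (L ^+ 2 * L ^+ 2 * (n ^+ 3 * (s ^+ 2 + mu ^+ 2) ^+ 2)) =
     L ^+ 2 * ((8 + 4 * K) * (n ^+ 3 * (s ^+ 2 + mu ^+ 2) ^+ 2)) by field; rewrite gt_eqF.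
  apply: (@le_trans _ _ ((8 + 4 * K) * (n ^+ 3 * (s ^+ 2 + mu ^+ 2) ^+ 2))); last first.
    apply: ler_peMl => //; apply: mulr_ge0; first lra.
    by apply: mulr_ge0; [apply: exprn_ge0; exact: ltW|exact: ltW].
  rewrite ME.
  have h1 : 0 <= K * (n ^+ 2 * s ^+ 2) * (n * mu ^+ 2 - 1).
    apply: mulr_ge0; last lra.
    apply: mulr_ge0 => //; apply: mulr_ge0; last exact: ltW.
    by apply: exprn_ge0; exact: ltW.
  have h2 : 0 <= n ^+ 3 * s ^+ 4 by apply: mulr_ge0; [apply: exprn_ge0|]; exact: ltW.
  have h3 : 0 <= n ^+ 3 * (s ^+ 2 * mu ^+ 2).
    by apply: mulr_ge0; [apply: exprn_ge0; exact: ltW|apply: mulr_ge0; exact: ltW].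
  have h4 : 0 <= n ^+ 3 * mu ^+ 4.
    by apply: mulr_ge0; apply: exprn_ge0; exact: ltW.
  have h5 := mulr_ge0 K0 h2; have h6 := mulr_ge0 K0 h3; have h7 := mulr_ge0 K0 h4.
  rewrite -subr_ge0 (_ : _ - _ = 8 * (K * (n ^+ 2 * s ^+ 2) * (n * mu ^+ 2 - 1)) +
    16 * (n ^+ 3 * (s ^+ 2 * mu ^+ 2)) + 8 * (n ^+ 3 * mu ^+ 4) +
    4 * (K * (n ^+ 3 * s ^+ 4)) + 4 * (K * (n ^+ 3 * mu ^+ 4))); last by ring.
  by clear -h1 h2 h3 h4 h5 h6 h7; lra.
- rewrite ler_pdivrMr// c2E L4.
  have -> : 1 / L ^+ 2 * (L ^+ 2 * L ^+ 2 * (n ^+ 2 * ((s ^+ 2 + mu ^+ 2) ^+ 2 / mu ^+ 2))) =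
     L ^+ 2 * (n ^+ 2 * ((s ^+ 2 + mu ^+ 2) ^+ 2 / mu ^+ 2)) by field; rewrite !gt_eqF.
  have pos : 0 <= n ^+ 2 * ((s ^+ 2 + mu ^+ 2) ^+ 2 / mu ^+ 2).
    by apply: mulr_ge0; [exact: sqr_ge0|exact: ltW (divr_gt0 _ _)].
  apply: (le_trans _ (ler_peMl pos L21)).
  rewrite [leLHS]mulrC; apply: ler_wpM2l; first exact: sqr_ge0.
  rewrite ler_pdivlMr//; have := sqr_ge0 (s ^+ 2); have := sqr_ge0 (mu ^+ 2).
  by clear; nra.
Qed.

Lemma correction_ge0 (R : realType) (p r : R) : 1 < p -> p <= r ->
  0 <= (p - 1 + (r - 1)^-1) / 2.
Proof.
move=> p1 pr; have : 0 <= (r - 1)^-1 by rewrite invr_ge0; lra.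
lra.
Qed.

(** The certificate [Z] adds up the functionals of [edge_mx_quadratics], each divided by its
    threshold, and the indicators of negative entries. Where it is below [1], the noise is
    small and [noisy_opnorm] applies; the mean of the row sums gives the sum of the
    entries, and their mean square concentrates at its expectation, which is the correction
    in [alpha]. *)
Lemma opnorm_near_sum (R : realType) (p r : R) : 1 < p -> p <= r ->
  exists C th0 : R, [/\ 0 <= C, 0 < th0 &
  forall d (T : measurableType d) (P : probability T R) (n : nat)
    (X : upair n -> {RV P >-> R}) (mu s K L t th M : R),
  (1 < n)%N -> 0 < mu -> 0 < s -> 0 <= K -> 1 <= L -> 1 <= n%:R * mu ^+ 2 ->
  mutually_independent X ->
  (forall e, itg P (fun w => (X e w - mu) ^+ 4)) ->
  (forall e, ex P (fun w => X e w - mu) = 0) ->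
  (forall e, ex P (fun w => (X e w - mu) ^+ 2) = s ^+ 2) ->
  (forall e, ex P (fun w => (X e w - mu) ^+ 4) <= K * s ^+ 2) ->
  (forall e, P (X e @^-1` [set` `]-oo, 0[]) = 0%E) ->
  0 < t <= 1 -> t ^+ 2 = L ^+ 2 * (s ^+ 2 / (n%:R * mu ^+ 2) + n%:R^-1) ->
  Num.sqrt n%:R * t ^+ 2 <= th ^+ 2 -> 0 < th <= 1 / 8 -> th <= th0 ->
  M = 8 * n%:R ^+ 2 * (K * s ^+ 2 + n%:R * s ^+ 4) ->
  exists2 Z : T -> R, ex_le P Z ((28 + 12 * K) / L ^+ 2) /\ (forall w, 0 <= Z w) &
    forall w, Z w < 1 ->
    `|s^-1 * (opnorm r p (n%:R `^ (- (p^-1 - r^-1)) *: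
                          (\matrix_(i, j) edge_mx (fun e => X e w) i j)) - alpha p r mu s n) -
      2 / (s * Num.sqrt (n%:R * (n%:R - 1))) * \sum_e (X e w - mu)| <=
    L / (n%:R - 1) + (p - 1 + (r - 1)^-1) / 2 * (L * Num.sqrt M / (s * mu * n%:R ^+ 2)) +
    (p - 1 + (r - 1)^-1) / 2 * (s / (mu * n%:R)) + n%:R * mu * C * t ^+ 3 / s].
Proof.
move=> p1 pr; have [C [th0 [C0 th00 HC]]] := noisy_opnorm p1 pr.
exists C, th0; split => // d T P n X mu s K L t th M n1 mu0 s0 K0 L1 nm indep i4 e1 e2 e4 pX
  t01 tE tth th1 thth ME.
have p0 : 0 < p by lra.
have r0 : 0 < r by lra.
have n0 : (0 < n)%N by exact: ltn_trans n1.
have N1 : 1 < (n%:R : R) by rewrite ltr1n.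
have N0 : 0 < (n%:R : R) by rewrite ltr0n.
have L0 : 0 < L by lra.
have [c10 c20 M0 b1 b2] := noise_budget (ltW N1) mu0 s0 K0 L1 nm tE ME.
set c1 := n%:R ^+ 5 * mu ^+ 4 * t ^+ 4 in c10 b1.
set c2 := n%:R ^+ 4 * mu ^+ 2 * t ^+ 4 in c20 b2.
pose H w (i j : 'I_n) : R := edge_mx (fun e => X e w - mu) i j.
have mg : measurable_fun setT (fun x : R => x - mu).
  by apply: measurable_funB => //; exact: measurable_cst.
have K20 : 0 <= K * s ^+ 2 by rewrite mulr_ge0// sqr_ge0.
have HE w i j : H w i j = edge_mx (fun e => X e w - mu) i j by [].
have := edge_mx_quadratics indep mg i4 e1 e2 e4 K20 HE.
rewrite -ME => -[Q1 Q2 Q3 Q4 Q5].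
pose rs w := \sum_i rowsum (H w) i; pose q w := \sum_i rowsum (H w) i ^+ 2 - n%:R * (n%:R - 1) * s ^+ 2.
pose neg e : set T := X e @^-1` [set` `]-oo, 0[].
have neg0 := ex_le_sum0 (fun e => ex_le_indic0
  (measurable_funPTI (X e) (measurable_itv `]-oo, (0 : R)[)) (pX e)).
have c3 : 0 < L ^+ 2 * (s ^+ 2 * n%:R ^+ 2) 
  by apply: mulr_gt0; [exact: exprn_gt0|apply: mulr_gt0; exact: exprn_gt0].
have c4 : 0 < L ^+ 2 * M by rewrite mulr_gt0// exprn_gt0.
have ic1 : 0 <= c1^-1 by rewrite invr_ge0 ltW.
have ic2 : 0 <= c2^-1 by rewrite invr_ge0 ltW.
have ic3 : 0 <= (L ^+ 2 * (s ^+ 2 * n%:R ^+ 2))^-1 by rewrite invr_ge0 ltW.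
have ic4 : 0 <= (L ^+ 2 * M)^-1 by rewrite invr_ge0 ltW.
have Zle := ex_leD (ex_leD (ex_leD (ex_leD (ex_leD (ex_leD
   (ex_leZ ic1 Q1) (ex_leZ ic1 Q2)) (ex_leZ ic1 Q3)) (ex_leZ ic2 Q4)) (ex_leZ ic3 Q4))
   (ex_leZ ic4 Q5)) neg0.
have sq4 (x : R) : 0 <= x ^+ 4 by rewrite (_ : 4 = 2 * 2)%N// exprM sqr_ge0.
have z1 w : 0 <= c1^-1 * \sum_i rowsum (H w) i ^+ 4.
  by apply: mulr_ge0 => //; apply: sumr_ge0.
have z2 w : 0 <= c1^-1 * \sum_i \sum_k (\sum_j H w i j * H w j k) ^+ 2.
  by apply: mulr_ge0 => //; do 2 ! (apply: sumr_ge0 => ? _); exact: sqr_ge0.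
have z3 w : 0 <= c1^-1 * \sum_i mulfv (H w) (rowsum (H w)) i ^+ 2.
  by apply: mulr_ge0 => //; apply: sumr_ge0 => ? _; exact: sqr_ge0.
have z4 w : 0 <= c2^-1 * rs w ^+ 2 by apply: mulr_ge0 => //; exact: sqr_ge0.
have z5 w : 0 <= (L ^+ 2 * (s ^+ 2 * n%:R ^+ 2))^-1 * rs w ^+ 2.
  by apply: mulr_ge0 => //; exact: sqr_ge0.
have z6 w : 0 <= (L ^+ 2 * M)^-1 * q w ^+ 2 by apply: mulr_ge0 => //; exact: sqr_ge0.
have z7 w e : 0 <= \1_(neg e) w :> R by rewrite indicE ler0n.
have z7s w : 0 <= \sum_e \1_(neg e) w :> R by apply: sumr_ge0 => e _.
exists (fun w => c1^-1 * (\sum_i rowsum (H w) i ^+ 4) +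
    c1^-1 * (\sum_i \sum_k (\sum_j H w i j * H w j k) ^+ 2) +
    c1^-1 * (\sum_i mulfv (H w) (rowsum (H w)) i ^+ 2) +
    c2^-1 * rs w ^+ 2 + (L ^+ 2 * (s ^+ 2 * n%:R ^+ 2))^-1 * rs w ^+ 2 +
    (L ^+ 2 * M)^-1 * q w ^+ 2 + \sum_e \1_(neg e) w).
  split; last first.
    by move=> w; do ! apply: addr_ge0.
  case: Zle => Zi Zb; split => //; apply: (le_trans Zb).
  have -> : (L ^+ 2 * (s ^+ 2 * n%:R ^+ 2))^-1 * (2 * s ^+ 2 * n%:R ^+ 2) = 2 / L ^+ 2.
    by field; rewrite !gt_eqF.
  have -> : (L ^+ 2 * M)^-1 * M = 1 / L ^+ 2 by field; rewrite !gt_eqF.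
  rewrite [c1^-1 * M]mulrC [c2^-1 * _]mulrC.
  move: b1 b2; rewrite !mulrDl !mul1r.
  by move: (M / c1) (_ / c2) (L ^+ 2)^-1; clear; move=> ? ? ?; lra.
move=> w; move: (z1 w) (z2 w) (z3 w) (z4 w) (z5 w) (z6 w) (z7s w).
move=> y1 y2 y3 y4 y5 y6 y7 Z1.
have below (c x : R) : 0 < c -> c^-1 * x < 1 -> x <= c.
  by move=> c0; rewrite mulrC ltr_pdivrMr// mul1r => /ltW.
have [k1 k2 k3] : [/\ \sum_i rowsum (H w) i ^+ 4 <= c1,
    \sum_i \sum_k (\sum_j H w i j * H w j k) ^+ 2 <= c1 &
    \sum_i mulfv (H w) (rowsum (H w)) i ^+ 2 <= c1].
  by split; apply: below => //; move: Z1; clear -y1 y2 y3 y4 y5 y6 y7; lra.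
have [k4 k5 k6 k7] : [/\ rs w ^+ 2 <= c2, rs w ^+ 2 <= L ^+ 2 * (s ^+ 2 * n%:R ^+ 2),
    q w ^+ 2 <= L ^+ 2 * M & \sum_e \1_(neg e) w < 1 :> R].
  by split; [apply: below => //|apply: below => //|apply: below => //|];
    move: Z1; clear -y1 y2 y3 y4 y5 y6 y7; lra.
have X0 e : 0 <= X e w.
  rewrite leNgt; apply/negP => Xn.
  have : 1 <= \sum_e \1_(neg e) w :> R.
    rewrite (bigD1 e)//= indicE mem_set; last by rewrite /neg /= in_itv.
    by rewrite lerDl; apply: sumr_ge0 => f _.
  by move=> /(lt_le_trans k7); rewrite ltxx.
pose kk := (n%:R * mu)^-1.
have nmu0 : 0 < n%:R * mu by exact: mulr_gt0.
have kk0 : 0 < kk by rewrite invr_gt0.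
pose E i j := kk * H w i j.
have noisyE i j : edge_mx (fun e => X e w) i j = n%:R * mu * noisy E i j.
  rewrite /noisy /E /H /kk /edge_mx; have [->|ij] := eqVneq i j.
    by rewrite edge_diag /= !mulr0 mul0r addr0 mulr0.
  have [e -> _] := edgeP ij; rewrite /=.
  by field; rewrite !gt_eqF.
have rsE i : rowsum E i = kk * rowsum (H w) i by rewrite /rowsum mulr_sumr.
have k4E (x : R) : x <= c1 -> kk ^+ 4 * x <= n%:R * t ^+ 4.
  have -> : n%:R * t ^+ 4 = kk ^+ 4 * c1 by rewrite /c1 /kk; field; rewrite !gt_eqF.
  by move=> h; apply: ler_wpM2l => //; exact: sq4.
have sn : small_noise E t th.
  split.
  - split => [i j|i|i j].
    + by rewrite /E /H edge_mx_sym.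
    + by rewrite /E /H edge_mx_diag mulr0.
    + rewrite -(pmulr_rge0 _ nmu0) -noisyE /edge_mx; case: (edge i j) => [e|] //=.
  - split.
    + rewrite (eq_bigr (fun i => kk ^+ 4 * rowsum (H w) i ^+ 4)) -?mulr_sumr; first exact: k4E.
      by move=> i _; rewrite rsE exprMn.
    + rewrite (eq_bigr (fun i => kk ^+ 4 * \sum_k (\sum_j H w i j * H w j k) ^+ 2)) -?mulr_sumr; first exact: k4E.
      move=> i _; rewrite mulr_sumr; apply: eq_bigr => k _.
      rewrite (eq_bigr (fun j => kk ^+ 2 * (H w i j * H w j k))) -?mulr_sumr.
        by rewrite exprMn -exprM.
      by move=> j _; rewrite /E; ring.
    + rewrite (eq_bigr (fun i => kk ^+ 4 * mulfv (H w) (rowsum (H w)) i ^+ 2)) -?mulr_sumr; first exact: k4E.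
      move=> i _; have -> : mulfv E (rowsum E) i = kk ^+ 2 * mulfv (H w) (rowsum (H w)) i.
        rewrite /mulfv mulr_sumr; apply: eq_bigr => j _; rewrite rsE /E; ring.
      by rewrite exprMn -exprM.
  - rewrite (eq_bigr _ (fun i _ => rsE i)) -mulr_sumr -/(rs w) normrM (gtr0_norm kk0).
    rewrite mulrC ler_pdivrMr//.
    have e0 : 0 <= n%:R * t ^+ 2 * (n%:R * mu).
      by apply: mulr_ge0; [apply: mulr_ge0; [exact: ltW|exact: sqr_ge0]|exact: ltW].
    rewrite -ler_sqr ?nnegrE// real_normK ?num_real//; apply: (le_trans k4).
    by rewrite le_eqVlt; apply/orP; left; apply/eqP; rewrite /c2; ring.
  - split => //.
    rewrite tE (_ : n%:R * _ = L ^+ 2 * (s ^+ 2 / mu ^+ 2 + 1)); last first.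
      by field; rewrite !gt_eqF.
    have h1 : 1 <= L ^+ 2 by rewrite exprn_ege1.
    have h2 : 0 <= s ^+ 2 / mu ^+ 2 by rewrite divr_ge0// sqr_ge0.
    by have := mulr_ge0 (le_trans ler01 h1) h2; move: h1; clear; lra.
have := HC n E t th sn thth.
have -> : \matrix_(i, j) edge_mx (fun e => X e w) i j = (n%:R * mu) *: \matrix_(i, j) noisy E i j.
  by apply/matrixP => i j; rewrite !mxE noisyE.
have nr0 : 0 < n%:R `^ (- (p^-1 - r^-1)) :> R by exact: powR_gt0.
rewrite scalerA [_ * (n%:R * mu)]mulrC -scalerA !opnormZ//.
set nu := _ * opnorm r p _; set kap := (p - 1 + (r - 1)^-1) / 2.
have kap0 : 0 <= kap by exact: correction_ge0.
have -> : (\sum_i rowsum E i) / n%:R = kk * rs w / n%:R.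
  by rewrite (eq_bigr _ (fun i _ => rsE i)) -mulr_sumr.
have -> : (\sum_i rowsum E i ^+ 2) / n%:R = kk ^+ 2 * (q w + n%:R * (n%:R - 1) * s ^+ 2) / n%:R.
  rewrite /q subrK mulr_sumr; congr (_ / _); apply: eq_bigr => i _.
  by rewrite rsE exprMn.
have rsG : \sum_e (X e w - mu) = rs w / 2.
  have := edge_mx_total (fun e => X e w - mu).
  have -> : \sum_i \sum_j edge_mx (fun e => X e w - mu) i j = rs w by [].
  by move=> ->; field.
rewrite rsG => hnu.
set sq := Num.sqrt (n%:R * (n%:R - 1)).
have y0 : 0 < (n%:R : R) - 1 by rewrite subr_gt0.
have sq0 : 0 < sq by rewrite sqrtr_gt0 mulr_gt0.
set D := nu - _ in hnu.
have -> : s^-1 * (n%:R * mu * nu - alpha p r mu s n) - 2 / (s * sq) * (rs w / 2) =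
    rs w / s * (n%:R^-1 - sq^-1) + kap * (q w / (s * mu * n%:R ^+ 2)) -
    kap * (s / (mu * n%:R)) + n%:R * mu * D / s.
  have -> : alpha p r mu s n = (n%:R - 1) * mu + kap * (s ^+ 2 / mu).
    have r10 : r - 1 != 0 by rewrite gt_eqF// subr_gt0 (lt_le_trans p1).
    by rewrite /alpha /kap; clear -mu0 r10; field; rewrite r10 gt_eqF.
  by rewrite /D /kk; field; rewrite !gt_eqF.
have rsL : `|rs w| <= L * (s * n%:R).
  rewrite -ler_sqr ?nnegrE ?mulr_ge0// ?(ltW L0) ?(ltW s0)// real_normK ?num_real//.
  by apply: (le_trans k5); rewrite -!exprMn.
have qL : `|q w| <= L * Num.sqrt M.
  rewrite -ler_sqr ?nnegrE ?mulr_ge0 ?(ltW L0) ?sqrtr_ge0// real_normK ?num_real//.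
  by rewrite exprMn sqr_sqrtr// ltW.
have smn0 : 0 < s * mu * n%:R ^+ 2 by rewrite !mulr_gt0// exprn_gt0.
apply: (le_trans (ler_normD _ _)); apply: lerD.
  apply: (le_trans (ler_normB _ _)); apply: lerD.
    apply: (le_trans (ler_normD _ _)); apply: lerD.
      rewrite normrM.
      apply: (@le_trans _ _ (L * (s * n%:R) / s * (n%:R * (n%:R - 1))^-1)).
        apply: ler_pM => //; last exact: sqrt_pairs_near.
        rewrite normrM (gtr0_norm (_ : 0 < s^-1)) ?invr_gt0//.
        by apply: ler_wpM2r => //; rewrite invr_ge0 ltW.
      by rewrite le_eqVlt; apply/orP; left; apply/eqP; field; rewrite !gt_eqF.
    rewrite normrM (ger0_norm kap0); apply: ler_wpM2l => //.
    rewrite normrM (gtr0_norm (_ : 0 < (s * mu * n%:R ^+ 2)^-1)) ?invr_gt0//.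
    by apply: ler_wpM2r => //; rewrite invr_ge0 ltW.
  rewrite ger0_norm//; apply: mulr_ge0 => //.
  by rewrite divr_ge0 ?(ltW s0)// ltW// mulr_gt0.
rewrite !normrM (gtr0_norm mu0) (gtr0_norm N0) (gtr0_norm (_ : 0 < s^-1)) ?invr_gt0//.
apply: ler_wpM2r; first by rewrite invr_ge0 ltW.
by rewrite -[leRHS]mulrA; apply: ler_wpM2l; [exact: ltW|].
Qed.

(** * Asymptotics of the error terms *)

Lemma le_of_sqr_le (R : realType) (x y c g : R) : 0 <= y -> 0 < g -> x ^+ 2 <= c / g ->
  c <= y ^+ 2 * g -> x <= y.
Proof.
move=> y0 g0 xc cg; have : `|x| <= y.
  rewrite -ler_sqr ?nnegrE// real_normK ?num_real//; apply: (le_trans xc).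
  by rewrite ler_pdivrMr.
exact: le_trans (ler_norm _).
Qed.

(** Each error is bounded through its square, which is a constant times [G^-1] once
    [s ^+ 2 <= B * mu] has been used. *)
Lemma scales_small (R : realType) (B K kap C L e th : R) :
  0 < B -> 0 <= K -> 0 <= kap -> 0 <= C -> 1 <= L -> 0 < e -> 0 < th ->
  exists2 G : R, 2 <= G & forall n mu s t M : R,
  G <= n -> 0 < mu -> 0 < s -> mu <= B -> s ^+ 2 <= B * mu ->
  G <= n * mu -> G <= n * mu ^+ 2 -> G <= n * s ^+ 2 -> 0 <= t ->
  t ^+ 2 = L ^+ 2 * (s ^+ 2 / (n * mu ^+ 2) + n^-1) ->
  M = 8 * n ^+ 2 * (K * s ^+ 2 + n * s ^+ 4) ->
  Num.sqrt n * t ^+ 2 <= th ^+ 2 /\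
  L / (n - 1) + kap * (L * Num.sqrt M / (s * mu * n ^+ 2)) + kap * (s / (mu * n)) +
    n * mu * C * t ^+ 3 / s <= e.
Proof.
move=> B0 K0 kap0 C0 L1 e0 th0.
have L0 : 0 < L by lra.
pose q := e / 4; have q0 : 0 < q by rewrite divr_gt0.
pose k1 := 2 * L ^+ 4 * (B ^+ 2 + 1).
pose k2 := kap ^+ 2 * (8 * L ^+ 2 * (K + B)).
pose k3 := kap ^+ 2 * B.
pose k4 := 8 * C ^+ 2 * L ^+ 6 * B ^+ 2.
have Lp k : 0 <= L ^+ k by rewrite exprn_ge0// ltW.
have B0' := ltW B0.
have k10 : 0 <= k1.
  by apply: mulr_ge0; [exact: mulr_ge0|apply: addr_ge0 => //; exact: sqr_ge0].
have k20 : 0 <= k2.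
  apply: mulr_ge0; first exact: sqr_ge0.
  by apply: mulr_ge0; [exact: mulr_ge0|exact: addr_ge0].
have k30 : 0 <= k3 by apply: mulr_ge0 => //; exact: sqr_ge0.
have k40 : 0 <= k4.
  apply: mulr_ge0; last exact: sqr_ge0.
  by apply: mulr_ge0 => //; apply: mulr_ge0 => //; exact: sqr_ge0.
pose g1 := k1 / (th ^+ 2) ^+ 2; pose g0 := 2 * L / q.
pose g2 := k2 / q ^+ 2; pose g3 := k3 / q ^+ 2; pose g4 := k4 / q ^+ 2.
have g10 : 0 <= g1 by rewrite divr_ge0// sqr_ge0.
have g00 : 0 <= g0 by rewrite divr_ge0 ?(ltW q0)// mulr_ge0// ltW.
have g20 : 0 <= g2 by rewrite divr_ge0// sqr_ge0.
have g30 : 0 <= g3 by rewrite divr_ge0// sqr_ge0.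
have g40 : 0 <= g4 by rewrite divr_ge0// sqr_ge0.
pose G := 2 + g0 + g1 + g2 + g3 + g4.
have G2 : 2 <= G by rewrite /G; lra.
have big (k y : R) : 0 < y -> k / y <= G -> k <= y * G.
  by move=> y0; rewrite ler_pdivrMr// mulrC.
have th2 : 0 < (th ^+ 2) ^+ 2 by rewrite exprn_gt0// exprn_gt0.
have q2 : 0 < q ^+ 2 by exact: exprn_gt0.
have b0 : 2 * L <= q * G by apply: big => //; rewrite -/g0 /G; lra.
have b1 : k1 <= (th ^+ 2) ^+ 2 * G by apply: big => //; rewrite -/g1 /G; lra.
have b2 : k2 <= q ^+ 2 * G by apply: big => //; rewrite -/g2 /G; lra.
have b3 : k3 <= q ^+ 2 * G by apply: big => //; rewrite -/g3 /G; lra.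
have b4 : k4 <= q ^+ 2 * G by apply: big => //; rewrite -/g4 /G; lra.
exists G => // n mu s t M Gn mu0 s0 muB sB Gnm Gnm2 Gns t0 tE ME.
have G0 : 0 < G by lra.
have n0 : 0 < n by lra.
have n1 : 0 < n - 1 by lra.
have mu20 : 0 < mu ^+ 2 by exact: exprn_gt0.
have s20 : 0 < s ^+ 2 by exact: exprn_gt0.
have inv_le (x : R) : G <= x -> x^-1 <= G^-1.
  by move=> h; rewrite lef_pV2// posrE (lt_le_trans G0).
have v1 := inv_le _ Gn; have v2 := inv_le _ Gnm; have v3 := inv_le _ Gnm2; have v4 := inv_le _ Gns.
have G1 : 0 <= G^-1 <= 1 by rewrite invr_ge0 invf_le1// ltW//=; lra.
have p2 : 0 <= (n * mu)^-1 by rewrite invr_ge0 ltW// mulr_gt0.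
have p1 : 0 <= n^-1 by rewrite invr_ge0 ltW.
have p3 : 0 <= (n * mu ^+ 2)^-1 by rewrite invr_ge0 ltW// mulr_gt0.
have p4 : 0 <= (n * s ^+ 2)^-1 by rewrite invr_ge0 ltW// mulr_gt0.
have BB : 0 <= B ^+ 2 by exact: sqr_ge0.
have s4 : s ^+ 4 <= B ^+ 2 * mu ^+ 2.
  have -> : s ^+ 4 = s ^+ 2 * s ^+ 2 by ring.
  have -> : B ^+ 2 * mu ^+ 2 = (B * mu) * (B * mu) by ring.
  by apply: ler_pM => //; exact: ltW.
have ratio4 : s ^+ 4 / (n * mu ^+ 4) <= B ^+ 2 * G^-1.
  apply: (@le_trans _ _ (B ^+ 2 * (n * mu ^+ 2)^-1)); last exact: ler_wpM2l.
  have -> : B ^+ 2 * (n * mu ^+ 2)^-1 = (B ^+ 2 * mu ^+ 2) / (n * mu ^+ 4).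
    by field; rewrite !gt_eqF.
  by apply: ler_wpM2r => //; rewrite invr_ge0 mulr_ge0 ?exprn_ge0// ltW.
split.
  apply: (@le_of_sqr_le _ _ _ k1 G) => //; first exact: sqr_ge0.
  have -> : (Num.sqrt n * t ^+ 2) ^+ 2 = L ^+ 4 * ((s ^+ 2 / mu ^+ 2 + 1) ^+ 2 / n).
    rewrite exprMn sqr_sqrtr ?(ltW n0)// tE; field; rewrite !gt_eqF//.
  have -> : k1 / G = L ^+ 4 * (2 * ((B ^+ 2 + 1) * G^-1)) by rewrite /k1; ring.
  apply: ler_wpM2l; first exact: Lp.
  apply: (@le_trans _ _ (2 * (s ^+ 4 / (n * mu ^+ 4) + n^-1))).
    rewrite -subr_ge0 (_ : _ - _ = (s ^+ 2 / mu ^+ 2 - 1) ^+ 2 / n).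
      by rewrite divr_ge0 ?sqr_ge0// ltW.
    by field; rewrite !gt_eqF.
  apply: ler_wpM2l => //; move: ratio4 v1; clear; lra.
have -> : e = q + q + q + q by rewrite /q; field.
apply: lerD; [apply: lerD; [apply: lerD|]|].
- rewrite ler_pdivrMr//; apply: (@le_trans _ _ (q * G / 2)); first by move: b0; clear; lra.
  have -> : q * G / 2 = q * (G / 2) by ring.
  by apply: ler_wpM2l; [exact: ltW|move: Gn G2; clear; lra].
- apply: (@le_of_sqr_le _ _ _ k2 G) => //; first exact: ltW.
  have M0 : 0 <= M.
    rewrite ME; apply: mulr_ge0; first by apply: mulr_ge0 => //; exact: sqr_ge0.
    apply: addr_ge0; first by apply: mulr_ge0 => //; exact: sqr_ge0.
    by apply: mulr_ge0; [exact: ltW|apply: exprn_ge0; exact: ltW].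
  have -> : (kap * (L * Num.sqrt M / (s * mu * n ^+ 2))) ^+ 2 =
     kap ^+ 2 * (8 * L ^+ 2 * (K * ((n * mu)^-1 * (n * mu)^-1) + s ^+ 2 / (n * mu ^+ 2))).
    have -> : (kap * (L * Num.sqrt M / (s * mu * n ^+ 2))) ^+ 2 =
        kap ^+ 2 * (L ^+ 2 * Num.sqrt M ^+ 2 / (s * mu * n ^+ 2) ^+ 2).
      by field; rewrite !gt_eqF.
    by rewrite sqr_sqrtr// ME; field; rewrite !gt_eqF.
  have -> : k2 / G = kap ^+ 2 * (8 * L ^+ 2 * (K * G^-1 + B * G^-1)) by rewrite /k2; ring.
  apply: ler_wpM2l; first exact: sqr_ge0.
  apply: ler_wpM2l; first exact: mulr_ge0.
  apply: lerD.
    apply: ler_wpM2l => //; apply: (@le_trans _ _ (G^-1 * G^-1)); first exact: ler_pM.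
    by case/andP: G1 => ga gb; apply: ler_piMr.
  apply: (@le_trans _ _ (B * (n * mu)^-1)); last by apply: ler_wpM2l => //; exact: ltW.
  have -> : B * (n * mu)^-1 = (B * mu) / (n * mu ^+ 2) by field; rewrite !gt_eqF.
  exact: ler_wpM2r.
- apply: (@le_of_sqr_le _ _ _ k3 G) => //; first exact: ltW.
  rewrite exprMn /k3 -mulrA; apply: ler_wpM2l; first exact: sqr_ge0.
  apply: (@le_trans _ _ (B * (n * mu)^-1)); last by apply: ler_wpM2l => //; exact: ltW.
  have -> : (s / (mu * n)) ^+ 2 = s ^+ 2 * ((n * mu)^-1 * (n * mu)^-1).
    by field; rewrite !gt_eqF.
  rewrite mulrA; apply: (@le_trans _ _ (B * mu * (n * mu)^-1 * (n * mu)^-1)).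
    by apply: ler_wpM2r => //; apply: ler_wpM2r.
  have -> : B * mu * (n * mu)^-1 * (n * mu)^-1 = B * (n * mu)^-1 * n^-1.
    by field; rewrite !gt_eqF.
  apply: ler_piMr; first by rewrite mulr_ge0// ltW.
  by rewrite invf_le1//; move: Gn G2; clear; lra.
- apply: (@le_of_sqr_le _ _ _ k4 G) => //; first exact: ltW.
  have -> : (n * mu * C * t ^+ 3 / s) ^+ 2 =
     C ^+ 2 * L ^+ 6 * ((s ^+ 2 + mu ^+ 2) ^+ 3 / (n * mu ^+ 4 * s ^+ 2)).
    have -> : (n * mu * C * t ^+ 3 / s) ^+ 2 = n ^+ 2 * mu ^+ 2 * C ^+ 2 * (t ^+ 2) ^+ 3 / s ^+ 2.
      by field; rewrite !gt_eqF.
    by rewrite tE; field; rewrite !gt_eqF.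
  have -> : k4 / G = C ^+ 2 * L ^+ 6 * (4 * (B ^+ 2 * G^-1 + B ^+ 2 * G^-1)).
    by rewrite /k4; ring.
  apply: ler_wpM2l; first by rewrite mulr_ge0 ?sqr_ge0// exprn_ge0// ltW.
  apply: (@le_trans _ _ (4 * (s ^+ 4 / (n * mu ^+ 4) + mu ^+ 2 / (n * s ^+ 2)))).
    rewrite -subr_ge0 (_ : _ - _ = 3 * ((s ^+ 2 + mu ^+ 2) * (s ^+ 2 - mu ^+ 2) ^+ 2 /
       (n * mu ^+ 4 * s ^+ 2))); last by field; rewrite !gt_eqF.
    apply: mulr_ge0 => //; apply: divr_ge0.
      by apply: mulr_ge0; [rewrite addr_ge0// ltW|exact: sqr_ge0].
    by rewrite !mulr_ge0 ?exprn_ge0// ltW.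
  apply: ler_wpM2l => //; apply: lerD => //.
  apply: ler_pM => //; first exact: ltW.
  by apply: lerXn2r; rewrite ?nnegrE ?(ltW mu0) ?(ltW B0).
Qed.

Lemma card_edges (R : realType) (n : nat) :
  #|{: upair n}|%:R * 2 = n%:R * (n%:R - 1) :> R.
Proof.
have := @edge_mx_total R n (fun=> 1); rewrite sumr_const mulrC => <-.
rewrite (eq_bigr (fun=> n%:R - 1)).
  by rewrite sumr_const card_ord -(mulr_natl (n%:R - 1) n).
move=> i _; have := sum_offdiag i (fun=> 1 : R); rewrite sumr_const card_ord => ->.
rewrite addrAC subrr add0r; apply: eq_bigr => j _.
rewrite /edge_mx mulr1; have [->|ij] := eqVneq i j; first by rewrite edge_diag.
by have [e -> _] := edgeP ij.
Qed.

(** With [n * (n - 1) / 2] entries the normalisation makes the variance exactly [2]; the error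
    is of the order of the third moments, that is of [(n * s)^-1] and [n^-1]. *)
Lemma clt_edges d (T : measurableType d) (R : realType) (P : probability T R) (n : nat)
    (X : upair n -> {RV P >-> R}) (mu s K M C : R)
    (f f1 f2 : R -> R) :
  (1 < n)%N -> 0 < s -> 0 <= C -> taylor_test M C f f1 f2 -> mutually_independent X ->
  (forall e, ex_le P (fun w => `|X e w - mu| ^+ 3) (K * s ^+ 2)) ->
  (forall e, itg P (fun w => (X e w - mu) ^+ 2)) ->
  (forall e, ex P (fun w => X e w - mu) = 0) ->
  (forall e, ex P (fun w => (X e w - mu) ^+ 2) = s ^+ 2) ->
  `|ex P (fun w => f (2 / (s * Num.sqrt (n%:R * (n%:R - 1))) * \sum_e (X e w - mu))) -
    gauss_smooth (Num.sqrt 2) f 0| <=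
  C * (4 * K / (s * Num.sqrt (n%:R * (n%:R - 1))) + 16 / Num.sqrt (n%:R * (n%:R - 1))).
Proof.
move=> n1 s0 C0 tt indep e3 i2 e1 e2.
have N1 : 1 < (n%:R : R) by rewrite ltr1n.
set sq := Num.sqrt _; have y0 : 0 < (n%:R : R) * (n%:R - 1) by rewrite mulr_gt0//; lra.
have sq0 : 0 < sq by rewrite sqrtr_gt0.
have sq2 : sq ^+ 2 = n%:R * (n%:R - 1) by rewrite sqr_sqrtr// ltW.
set k := 2 / (s * sq); have k0 : 0 < k by rewrite divr_gt0// mulr_gt0.
have mg : measurable_fun setT (fun x : R => k * (x - mu)).
  apply: measurable_funM; first exact: measurable_cst.
  by apply: measurable_funB => //; exact: measurable_cst.
have cE := card_edges R n.
have g3 e : (fun t => `|k * (X e t - mu)| ^+ 3) = (fun t => k ^+ 3 * `|X e t - mu| ^+ 3).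
  by apply/funext => t; rewrite normrM (gtr0_norm k0) exprMn.
have i1 e : itg P (fun w => X e w - mu).
  apply: itg_le (itgD (itg_cst P 1) (i2 e)).
    by apply: measurable_funB => //; exact: measurable_cst.
  move=> t; rewrite -[_ ^+ 2]real_normK ?num_real//; move: (`|X e t - mu|) => z.
  by have := sqr_ge0 (z - 1); have := sqr_ge0 z; nra.
have k30 : 0 <= k ^+ 3 by rewrite exprn_ge0// ltW.
have ks0 : 0 < k * s by exact: mulr_gt0.
have szE : size (index_enum (upair n)) =
    #|{: upair n}|.
  by rewrite -sum1_size -sum1_card.
have sz : (0 < size (index_enum (upair n)))%N.
  rewrite szE -(ltr0n R); have : 0 < #|{: upair n}|%:R * 2 :> R.
    by rewrite cE.
  by rewrite pmulr_lgt0.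
have := @lindeberg _ T R P _ X (index_enum _) (fun x => k * (x - mu)) M C (k * s)
  (k ^+ 3 * (K * s ^+ 2)) f f1 f2 indep (index_enum_uniq _) sz mg ks0 C0 tt.
have h3 e : itg P (fun t => `|k * (X e t - mu)| ^+ 3).
  by rewrite g3; apply: itgZ; case: (e3 e).
have h3' e : ex P (fun t => `|k * (X e t - mu)| ^+ 3) <= k ^+ 3 * (K * s ^+ 2).
  by rewrite g3 exZ; [apply: ler_wpM2l => //|]; case: (e3 e).
have h1 e : ex P (fun t => k * (X e t - mu)) = 0 by rewrite exZ// e1 mulr0.
have h2 e : ex P (fun t => (k * (X e t - mu)) ^+ 2) = (k * s) ^+ 2.
  by rewrite exprMn -(e2 e) -exZ//; apply: eq_ex => t; rewrite exprMn.
move=> /(_ h3 h3' h1 h2).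
rewrite szE.
set c := #|_|%:R in cE *.
have c2 : c = sq ^+ 2 / 2 by rewrite sq2 -cE; field.
have -> : c * (k * s) ^+ 2 = 2 by rewrite c2 /k; field; rewrite !gt_eqF.
have -> : c * (C * (k ^+ 3 * (K * s ^+ 2) + 4 * (k * s) ^+ 3)) = C * (4 * K / (s * sq) + 16 / sq).
  by rewrite c2 /k; field; rewrite !gt_eqF.
congr (`|_ - _| <= _); congr ex; apply/funext => t; congr f.
by rewrite mulr_sumr.
Qed.

(** The lower bound on [mu] makes [n ^ (1/3) * mu] diverge, and the one on [sigma] makes
    [n * sigma ^+ 2] diverge; the other products follow. *)
Lemma scaling_regime (R : realType) (mu sigma : nat -> R) :
  (mu : nat -> R^o) =O_\oo (fun=> 1 : R^o) ->
  mu n / (ln n%:R `^ (2 / 3) / n%:R `^ (1 / 3)) @[n --> \oo] --> +oo ->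
  (exists2 c0 : R, 0 < c0 & \forall n \near \oo, n%:R `^ (- (1 / 2) + c0) <= sigma n) ->
  (fun n => sigma n ^+ 2 / mu n : R^o) =O_\oo (fun=> 1 : R^o) ->
  exists2 B, 0 < B & forall G, \forall n \near \oo,
    [/\ [/\ (1 < n)%N, 0 < mu n, 0 < sigma n & G <= n%:R],
        mu n <= B, sigma n ^+ 2 <= B * mu n &
        [/\ G <= n%:R * mu n, G <= n%:R * mu n ^+ 2 & G <= n%:R * sigma n ^+ 2]].
Proof.
move=> /eqO_exP[b1 b10 h1] /cvgryPge h2 [c0 c00 h3] /eqO_exP[b2 b20 h4].
exists (b1 + b2); first exact: addr_gt0.
move=> G0; pose G := Num.max 1 G0.
have G1 : 1 <= G by rewrite le_max lexx.
have G0G : G0 <= G by rewrite le_max lexx orbT.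
pose big := Num.max (expR 1) (Num.max (G `^ (2 * c0)^-1) G).
have h5 : \forall n \near \oo, big <= n%:R by exact: nbhs_infty_ger.
apply: filterS (filterI (filterI h1 (h2 G)) (filterI (filterI h3 h4) (filterI h5 (nbhs_infty_ge 2)))).
move=> n [[f1 f2] [[f3 f4] [f5 n1]]].
move: f5; rewrite /big ge_max => /andP[f5]; rewrite ge_max => /andP[f6 f7].
have N0 : 0 < (n%:R : R) by rewrite ltr0n (ltn_trans _ n1).
have G00 : 0 < G by exact: lt_le_trans G1.
pose x : R := n%:R `^ (1 / 3).
have x0 : 0 < x by exact: powR_gt0.
have x3 : x ^+ 3 = n%:R.
  rewrite -powR_mulrn ?(ltW x0)// /x -powRrM (_ : 1 / 3 * 3%:R = 1 :> R); last by field.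
  by rewrite powRr1// ltW.
have ln1 : 1 <= ln (n%:R : R) by rewrite -[leLHS](@expRK R) ler_ln// posrE// expR_gt0.
have lp : 1 <= ln (n%:R : R) `^ (2 / 3).
  have := @ge0_ler_powR R (2 / 3) _ 1 (ln n%:R); rewrite !nnegrE powR1; apply => //.
  by rewrite (le_trans ler01).
have l0 : 0 < ln (n%:R : R) `^ (2 / 3) by exact: lt_le_trans lp.
have xmu : G <= x * mu n.
  move: f2; rewrite -/x ler_pdivlMr ?divr_gt0// => f2.
  have h : G / x <= mu n.
    apply: (le_trans _ f2); rewrite mulrA; apply: ler_wpM2r; first by rewrite invr_ge0 ltW.
    by rewrite ler_peMr// ltW.
  by move: h; rewrite ler_pdivrMr// mulrC.
have mu0 : 0 < mu n by rewrite -(pmulr_rgt0 _ x0) (lt_le_trans G00).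
have x1 : 1 <= x.
  rewrite leNgt; apply/negP => x1; have : x ^+ 3 < 1 by rewrite exprn_ilt1// ltW.
  by rewrite x3 ltNge (le_trans G1).
have s0 : 0 < sigma n by apply: lt_le_trans f3; exact: powR_gt0.
have muB : mu n <= b1.
  by move: f1; rewrite normr1 mulr1 => /(le_trans (ler_norm _)).
have sB : sigma n ^+ 2 <= b2 * mu n.
  by move: f4; rewrite normr1 mulr1 => /(le_trans (ler_norm _)); rewrite ler_pdivrMr.
have GG : G <= G * G by rewrite ler_peMr// ltW.
have ns : G <= n%:R * sigma n ^+ 2.
  pose y : R := n%:R `^ (- (1 / 2) + c0).
  have y0 : 0 <= y by exact: powR_ge0.
  apply: (@le_trans _ _ (n%:R * y ^+ 2)); last first.
    by apply: ler_wpM2l; [exact: ltW|apply: lerXn2r; rewrite ?nnegrE// ltW].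
  have -> : n%:R * y ^+ 2 = n%:R `^ (2 * c0).
    have -> : 2 * c0 = 1 + (- (1 / 2) + c0) * 2%:R by field.
    rewrite powRD; last by apply/implyP => _; rewrite gt_eqF.
    by rewrite powRr1 ?(ltW N0)// powRrM powR_mulrn.
  have c20 : 0 < 2 * c0 by exact: mulr_gt0.
  have := @ge0_ler_powR R (2 * c0) (ltW c20) (G `^ (2 * c0)^-1) n%:R.
  rewrite !nnegrE powR_ge0 (ltW N0) => /(_ isT isT f6).
  by rewrite -powRrM mulVf ?gt_eqF// powRr1// ltW.
split=> //.
- by split => //; exact: le_trans f7.
- by move: muB; move: (b20); clear; lra.
- by apply: (le_trans sB); apply: ler_wpM2r; [exact: ltW|rewrite lerDr ltW].
- split; apply: (le_trans G0G) => //.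
  + apply: (le_trans xmu); apply: ler_wpM2r; first exact: ltW.
    by rewrite -x3 exprS ler_peMr ?(ltW x0)// exprn_ege1.
  + apply: (le_trans GG).
    have -> : n%:R * mu n ^+ 2 = x * (x * mu n * (x * mu n)) by rewrite -x3; ring.
    apply: (@le_trans _ _ (x * mu n * (x * mu n))).
      by apply: ler_pM => //; exact: ltW.
    by rewrite ler_peMl// mulr_ge0// mulr_ge0// ltW.
Qed.

Lemma random_mx_edge d (T : measurableType d) (R : realType) (P : probability T R) (n : nat)
    (a : 'I_n -> 'I_n -> {RV P >-> R}) (t : T) :
  (random_mx a t)^T = random_mx a t -> (forall i, random_mx a t i i = 0) ->
  random_mx a t = \matrix_(i, j) edge_mx (fun e => a (val e).1 (val e).2 t) i j.
Proof.
move=> sym diag; have symE i j : a j i t = a i j t.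
  by move/matrixP/(_ i j) : sym; rewrite !mxE.
apply/matrixP => i j; rewrite [RHS]mxE /edge_mx; have [->|ij] := eqVneq i j.
  by rewrite edge_diag diag.
by have [e -> ve] := edgeP ij; rewrite mxE /=; case: ve => -> //=; exact: symE.
Qed.

(** All that the argument uses about the law of the entries; the moments of order [3] and [4]
    are transported from one entry to all others through the common law. *)
Lemma entries_spec (R : realType) d (T : measurableType d) (P : probability T R)
    (F : probability (measurableTypeR R) R) (n : nat) (a : 'I_n -> 'I_n -> {RV P >-> R}) (c : R) :
  let mu := law_mean F in let s := law_sd F in
  (1 < n)%N -> F [set` `]-oo, 0[%R] = 0%E -> F.-integrable setT (EFin \o id) ->
  ('V_F[id] < +oo)%E ->
  (forall (i j : 'I_n), (i < j)%N ->
    forall B, measurable B -> distribution P (a i j) B = F B) ->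
  (forall (i j : 'I_n), i = 0%N :> nat -> j = 1%N :> nat -> forall k, (3 <= k)%N ->
      ('E_P[(fun t => `|a i j t - mu| ^+ k)%R] <=
        (k`!%:R / 2 * c ^+ (k - 2) * s ^+ 2)%:E)%E) ->
  forall e : upair n,
  let X := a (val e).1 (val e).2 in
  [/\ itg P (fun w => (X w - mu) ^+ 4) /\ itg P (fun w => (X w - mu) ^+ 2),
      ex P (fun w => X w - mu) = 0, ex P (fun w => (X w - mu) ^+ 2) = s ^+ 2,
      ex P (fun w => (X w - mu) ^+ 4) <= 12 * c ^+ 2 * s ^+ 2 /\
      ex_le P (fun w => `|X w - mu| ^+ 3) (3 * `|c| * s ^+ 2) &
      P (X @^-1` [set` `]-oo, 0[]) = 0%E].
Proof.
move=> mu s n1 F0 iF VF law mom e X.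
have n0 : (0 < n)%N by exact: ltn_trans n1.
pose Y := a (Ordinal n0) (Ordinal n1).
have XF B : measurable B -> distribution P X B = F B by apply: law; exact: valP e.
have YF B : measurable B -> distribution P Y B = F B by exact: law.
have [e1 e2] := entry_moments XF iF VF.
have pow4 : (fun w => `|X w - mu| ^+ 4) = (fun w => (X w - mu) ^+ 4).
  by apply/funext => w; rewrite -normrX ger0_norm// (_ : 4 = 2 * 2)%N// exprM sqr_ge0.
have m3 : ex_le P (fun w => `|X w - mu| ^+ 3) (3 * `|c| * s ^+ 2).
  apply: (@entry_moment_le _ _ _ _ F X Y mu _ 3 XF YF).
  apply: (le_trans (mom (Ordinal n0) (Ordinal n1) erefl erefl 3%N isT)).
  rewrite lee_fin; apply: ler_wpM2r; first exact: sqr_ge0.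
  rewrite (_ : 3`! = 6)%N// expr1 (_ : 6%:R / 2 = 3 :> R); last by field.
  by apply: ler_wpM2l => //; exact: ler_norm.
have [m4i m4] : ex_le P (fun w => (X w - mu) ^+ 4) (12 * c ^+ 2 * s ^+ 2).
  rewrite -pow4; apply: (@entry_moment_le _ _ _ _ F X Y mu _ 4 XF YF).
  apply: (le_trans (mom (Ordinal n0) (Ordinal n1) erefl erefl 4%N isT)).
  by rewrite lee_fin (_ : 4`! = 24)%N// (_ : 24%:R / 2 = 12 :> R)//; field.
split=> //; last first.
  by have := XF _ (measurable_itv `]-oo, (0 : R)[); rewrite F0.
split => //; apply: itg_le (itgD (itg_cst P 1) m4i).
  by apply: measurable_funX; apply: measurable_funB => //; exact: measurable_cst.
move=> w; rewrite ger0_norm ?sqr_ge0//; move: (X w - mu) => z.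
have -> : z ^+ 4 = (z ^+ 2) ^+ 2 by ring.
by have := sqr_ge0 (z ^+ 2 - 1); have := sqr_ge0 z; nra.
Qed.

Theorem theorem2p3 (R : realType) (p r : R)
    (d : nat -> measure_display) (T : forall n, measurableType (d n))
    (P : forall n, probability (T n) R)
    (F : nat -> probability (measurableTypeR R) R)
    (a : forall n, 'I_n -> 'I_n -> {RV (P n) >-> R}) :
  let mu n := law_mean (F n) in
  let sigma n := law_sd (F n) in
  let A n t := random_mx (@a n) t in
  let Abar n t := n%:R `^ (- (p^-1 - r^-1)) *: A n t in
  1 < p -> p <= r ->
  (forall n, (0 < n)%N ->
    [/\ F n [set` `]-oo, 0[%R] = 0%E,
        (F n).-integrable setT (EFin \o id) &
        ('V_(F n)[id] < +oo)%E]) ->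
  (forall n t, (0 < n)%N -> (A n t)^T = A n t) ->
  (forall n (i j : 'I_n), (i < j)%N ->
    forall B, measurable B -> distribution (P n) (a n i j) B = F n B) ->
  (forall n, mutually_independent
    (fun ij : {ij : 'I_n * 'I_n | (ij.1 < ij.2)%N} =>
       a n (val ij).1 (val ij).2)) ->
  (forall n (i : 'I_n) t, A n t i i = 0) ->
  (mu : nat -> R^o) =O_\oo (fun=> 1 : R^o) ->
  mu n / (ln n%:R `^ (2 / 3) / n%:R `^ (1 / 3)) @[n --> \oo] --> +oo ->
  (exists2 c0 : R, 0 < c0 &
    \forall n \near \oo, n%:R `^ (- (1 / 2) + c0) <= sigma n) ->
  (fun n => sigma n ^+ 2 / mu n : R^o) =O_\oo (fun=> 1 : R^o) ->
  (exists c : R, forall n (i j : 'I_n), i = 0%N :> nat -> j = 1%N :> nat ->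
    forall k, (3 <= k)%N ->
      ('E_(P n)[(fun t => `|a n i j t - mu n| ^+ k)%R] <=
        (k`!%:R / 2 * c ^+ (k - 2) * sigma n ^+ 2)%:E)%E) ->
  cvg_in_distribution P
    (fun n t => (sigma n)^-1 *
                (opnorm r p (Abar n t) - alpha p r (mu n) (sigma n) n))
    (normal_prob 0 (Num.sqrt 2)).
Proof.
move=> mu sigma A Abar p1 pr HF sym law indep diag O1 lim low O2 [c mom].
have [B B0 regime] := scaling_regime O1 lim low O2.
have r0 : 0 < r by lra.
have N2 n : (1 < n)%N -> (0 < n)%N by exact: ltn_trans.
pose X n (ij : {ij : 'I_n * 'I_n | (ij.1 < ij.2)%N}) := a n (val ij).1 (val ij).2.
have spec n (n1 : (1 < n)%N) e := let: And3 h1 h2 h3 := HF n (N2 n n1) in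
  entries_spec n1 h1 h2 h3 (@law n) (@mom n) e.
pose K3 := 3 * `|c|; pose K4 := 12 * c ^+ 2.
have K30 : 0 <= K3 by rewrite mulr_ge0.
have K40 : 0 <= K4 by rewrite mulr_ge0 ?sqr_ge0.
pose S n t := 2 / (sigma n * Num.sqrt (n%:R * (n%:R - 1))) * \sum_e (X n e t - mu n).
have mW n : measurable_fun setT (fun t => (sigma n)^-1 *
    (opnorm r p (Abar n t) - alpha p r (mu n) (sigma n) n)).
  apply: measurable_funM; first exact: measurable_cst.
  apply: measurable_funB; last exact: measurable_cst.
  have -> : (fun t => opnorm r p (Abar n t)) = (fun t => opnorm r p
      (\matrix_(i, j) (n%:R `^ (- (p^-1 - r^-1)) * a n i j t))).
    by apply/funext => t; congr opnorm; apply/matrixP => i j; rewrite !mxE.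
  apply: measurable_opnorm => //; first exact: ltW.
  by move=> i j; apply: measurable_funM => //; exact: measurable_cst.
have mS n : measurable_fun setT (S n).
  apply: measurable_funM; first exact: measurable_cst.
  by apply: measurable_sum => e; apply: measurable_funB => //; exact: measurable_cst.
apply: (cvg_normal_of_tests mW mS).
- move=> M C f f1 f2 C0 tt; apply/cvgrPdist_le => e e0.
  (* [D] is a lower bound for both denominators in [clt_edges] that makes its error at most [e] *)
  pose D := C * (4 * K3 + 16) / e + 1.
  have D0 : 0 <= C * (4 * K3 + 16) / e.
    by apply: divr_ge0; [apply: mulr_ge0 => //; lra|exact: ltW].
  have D1 : 1 <= D by rewrite /D lerDr.
  have D2 : 0 <= D ^+ 2 by exact: sqr_ge0.
  apply: filterS (regime (D ^+ 2 + D + 1)) => n [[n1 mu0 s0 nG] _ _ [_ _ sG]].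
  rewrite distrC; apply: (le_trans (@clt_edges _ _ _ _ _ (X n) (mu n) _ K3 _ _ _ _ _ n1 s0 C0 tt
    (indep n) _ _ _ _)).
  + by move=> e'; have [_ _ _ []] := spec n n1 e'.
  + by move=> e'; have [[]] := spec n n1 e'.
  + by move=> e'; have [_ ->] := spec n n1 e'.
  + by move=> e'; have [_ _ ->] := spec n n1 e'.
  set sq := Num.sqrt _.
  have y1 : 1 <= n%:R - 1 :> R by move: nG D1 D2; clear; lra.
  have y0 : 0 < n%:R - 1 :> R by exact: lt_le_trans y1.
  have N0 : 0 < n%:R :> R by rewrite ltr0n N2.
  have sq2 : sq ^+ 2 = n%:R * (n%:R - 1) by rewrite sqr_sqrtr// mulr_ge0// ltW.
  have sq0 : 0 <= sq by exact: sqrtr_ge0.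
  have sqD : D <= sq.
    rewrite -ler_sqr ?nnegrE// ?sq2; last by rewrite (le_trans ler01).
    apply: (@le_trans _ _ n%:R); first by move: nG D1 D2; clear; lra.
    by rewrite ler_peMr// ltW.
  have ssqD : D <= sigma n * sq.
    rewrite -ler_sqr ?nnegrE ?mulr_ge0 ?(ltW s0)//; last by rewrite (le_trans ler01).
    rewrite exprMn sq2; apply: (@le_trans _ _ (n%:R * sigma n ^+ 2)).
      by move: sG D1 D2; clear; lra.
    rewrite [leRHS]mulrC -mulrA; apply: ler_wpM2l; first exact: ltW.
    by rewrite ler_peMl// sqr_ge0.
  have Dp : 0 < D by exact: lt_le_trans D1.
  apply: (@le_trans _ _ (C * (4 * K3 / D + 16 / D))).
    apply: ler_wpM2l => //; apply: lerD; apply: ler_wpM2l => //.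
    - exact: mulr_ge0.
    - by rewrite lef_pV2// posrE (lt_le_trans Dp).
    - by rewrite lef_pV2// posrE (lt_le_trans Dp).
  have -> : C * (4 * K3 / D + 16 / D) = C * (4 * K3 + 16) / D by rewrite -mulrDl mulrA.
  by rewrite ler_pdivrMr// [leRHS]mulrC -ler_pdivrMr// /D lerDl.
- move=> e b e0 b0.
  have [C [th0 [C0 th00 near_sum]]] := opnorm_near_sum p1 pr.
  pose kap := (p - 1 + (r - 1)^-1) / 2.
  have kap0 : 0 <= kap by exact: correction_ge0.
  (* [L ^+ 2 >= L], so the exceptional event has probability at most [b] *)
  pose L := 1 + (28 + 12 * K4) / b.
  have Lb : 0 <= (28 + 12 * K4) / b by apply: divr_ge0; [move: K40; clear; lra|exact: ltW].
  have L1 : 1 <= L by rewrite /L lerDl.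
  pose th := Num.min (1 / 8) th0.
  have thp : 0 < th by rewrite lt_min th00 andbT divr_gt0.
  have th8 : th <= 1 / 8 by rewrite ge_min lexx.
  have thth0 : th <= th0 by rewrite ge_min lexx orbT.
  have [G G2 small] := scales_small B0 K40 kap0 C0 L1 e0 thp.
  apply: filterS (regime G) => n [[n1 mu0 s0 nG] muB sB [nm nm2 ns]].
  have N0 : 0 < n%:R :> R by rewrite ltr0n N2.
  have L0 : 0 < L by exact: lt_le_trans L1.
  pose t2 := L ^+ 2 * (sigma n ^+ 2 / (n%:R * mu n ^+ 2) + n%:R^-1).
  have t20 : 0 < t2.
    apply: mulr_gt0; first exact: exprn_gt0.
    by apply: addr_gt0; rewrite ?invr_gt0// divr_gt0 ?mulr_gt0 ?exprn_gt0.
  pose t := Num.sqrt t2.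
  have t0 : 0 < t by rewrite sqrtr_gt0.
  have tE : t ^+ 2 = t2 by rewrite sqr_sqrtr// ltW.
  have [tth err] := small n%:R (mu n) (sigma n) t _ nG mu0 s0 muB sB nm nm2 ns (ltW t0) tE erefl.
  have sn1 : 1 <= Num.sqrt (n%:R : R).
    by rewrite -[leLHS]sqrtr1 ler_sqrt// ler1n N2.
  have t1 : t <= 1.
    rewrite -ler_sqr ?nnegrE ?(ltW t0)// expr1n; apply: (@le_trans _ _ (Num.sqrt n%:R * t ^+ 2)).
      by rewrite ler_peMl// sqr_ge0.
    by apply: (le_trans tth); rewrite exprn_ile1 ?(ltW thp)//; move: th8; clear; lra.
  have t01 : 0 < t <= 1 by rewrite t0.
  have th01 : 0 < th <= 1 / 8 by rewrite thp.
  have nm1 : 1 <= n%:R * mu n ^+ 2 by move: nm2 G2; clear; lra.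
  have [Z [Zle Z0] HZ] := near_sum _ _ (P n) n (X n) (mu n) (sigma n) K4 L t th _ n1 mu0 s0 K40 L1
    nm1 (indep n) (fun e => let: And5 (conj h _) _ _ _ _ := spec n n1 e in h)
    (fun e => let: And5 _ h _ _ _ := spec n n1 e in h)
    (fun e => let: And5 _ _ h _ _ := spec n n1 e in h)
    (fun e => let: And5 _ _ _ (conj h _) _ := spec n n1 e in h)
    (fun e => let: And5 _ _ _ _ h := spec n n1 e in h) t01 tE tth th01 thth0 erefl.
  have [Zi Zb] := Zle.
  apply: (le_trans (@markov_ex _ _ _ (P n) Z 1 _ Zi Z0 ltr01 _ _)).
  + have m := measurableT_comp (@normr_measurable R setT) (measurable_funB (mW n) (mS n)).
    have := m measurableT _ (measurable_itv `]e, +oo[).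
    rewrite setTI; congr measurable; apply/seteqP; split => w /=; by rewrite in_itv /= andbT.
  + move=> w /= ew; rewrite leNgt; apply/negP => /HZ.
    rewrite -(random_mx_edge (sym n w (N2 n n1))) => [h|i]; last exact: diag.
    by have := lt_le_trans ew (le_trans h err); rewrite ltxx.
  + rewrite lee_fin divr1; apply: (le_trans Zb).
    have L2 : 0 < L ^+ 2 by exact: exprn_gt0.
    rewrite ler_pdivrMr// [leRHS]mulrC -ler_pdivrMr//.
    apply: (@le_trans _ _ L); first by rewrite /L lerDr.
    by rewrite expr2 ler_peMl// ltW.
Qed.
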